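(* Let $\varphi$ be a weak or mock Jacobi form of weight $2$ and index $m$ with optimal growth. Then the Fourier coefficients of $\varphi$ satisfy the asymptotic formula $$C_\varphi(\Delta,r)=\kappa_r\,e^{\pi\sqrt\Delta/m}+O\bigl(e^{\pi\sqrt\Delta/2m}\bigr)$$ as $\Delta\to\infty$, where the coefficient $\kappa_r=\kappa(\varphi;r)$ is given by $$\kappa_r=-\sum_{\ell\,(\mathrm{mod}\,2m),\ \ell^2\equiv1\,(\mathrm{mod}\,4m)}C_\varphi(-1,\ell)\,\cos\Bigl(\frac{\pi\ell r}m\Bigr).$$
   Context: Notation: $\tau\in\mathbb H$, $\tau_2=\mathrm{Im}(\tau)$, $z\in\mathbb C$, $q=e^{2\pi i\tau}$, $y=e^{2\pi iz}$, $m\ge1$ an integer. A weak elliptic form of index $m$ is a holomorphic function $\varphi$ on $\mathbb H\times\mathbb C$ with $\varphi(\tau,z+\lambda\tau+\mu)=e^{-2\pi im(\lambda^2\tau+2\lambda z)}\varphi(\tau,z)$ for all $\lambda,\mu\in\mathbb Z$ and with a Fourier expansion $\sum_{n\ge0,\ r\in\mathbb Z}c(n,r)q^ny^r$. Then $c(n,r)=C_\varphi(4mn-r^2,r)$, where $C_\varphi(\Delta,r)$ is defined for integers $\Delta\equiv-r^2\pmod{4m}$ and depends only on $\Delta$ and on $r$ modulo $2m$; in the asymptotic formula $r$ is fixed and $\Delta$ runs over integers with $\Delta\equiv-r^2\pmod{4m}$. Optimal growth means $C_\varphi(\Delta,r)=0$ for all $\Delta<-1$. A weak Jacobi form of weight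 2 and index $m$ is a weak elliptic form satisfying (J1) $\varphi\bigl(\frac{a\tau+b}{c\tau+d},\frac z{c\tau+d}\bigr)=(c\tau+d)^2e^{2\pi imcz^2/(c\tau+d)}\varphi(\tau,z)$ for all $\begin{pmatrix}a&b\\c&d\end{pmatrix}\in SL(2,\mathbb Z)$. A mock Jacobi form of weight 2 and index $m$ (in the weak sense): a weak elliptic form $\varphi=\sum_{\ell\,(\mathrm{mod}\,2m)}h_\ell(\tau)\vartheta_{m,\ell}(\tau,z)$, where $\vartheta_{m,\ell}=\sum_{r\equiv\ell\,(2m)}q^{r^2/4m}y^r$, such that there are holomorphic modular forms $g_\ell$ of weight $1/2$ on some congruence subgroup for which $\widehat\varphi=\sum_\ell(h_\ell+g_\ell^* )\vartheta_{m,\ell}$ satisfies (J1). Here for $g=\sum_{n\ge0}b_nq^n$ (with $n$ possibly rational) $g^*(\tau)=2\,\bar b_0(4\pi\tau_2)^{-1/2}+\sum_{n>0}n^{1/2}\,\bar b_n\,\Gamma(-\tfrac12,4\pi n\tau_2)\,q^{-n}$, $\Gamma(a,x)=\int_x^\infty t^{a-1}e^{-t}dt$. *)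

(* Defs.v *)
From Stdlib Require Export Reals ZArith List ClassicalEpsilon.
From Coquelicot Require Export Coquelicot.
Export ListNotations.

Open Scope C_scope.

Coercion IZR : Z >-> R.

Definition Cexp (z : C) : C :=
  (exp (Re z) * cos (Im z), exp (Re z) * sin (Im z))%R.

Definition e2pi (z : C) : C := Cexp (RtoC 2 * PI * Ci * z).

(* [qpow x tau] is q^x, y^r is [e2pi (r * z)]. *)
Definition qpow (x : R) (tau : C) : C := e2pi (x * tau).

Definition lsum {I : Type} (f : I -> C) (l : list I) : C :=
  fold_right Cplus (RtoC 0) (map f l).

(* Convergence along the net of finite subsets of [I], i.e. unconditional
   (equivalently, absolute) convergence. *)
Definition is_Csum {I : Type} (f : I -> C) (s : C) : Prop :=
  forall eps : R, (0 < eps)%R ->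
    exists l0 : list I, forall l : list I,
      NoDup l -> incl l0 l -> (Cmod (lsum f l - s) < eps)%R.

(* The sum of the family; unspecified if it does not converge. *)
Definition Csum {I : Type} (f : I -> C) : C :=
  epsilon (inhabits (RtoC 0)) (is_Csum f).

(* Representatives 0, 1, ..., M-1 of the residue classes modulo M. *)
Definition residues (M : Z) : list Z := map Z.of_nat (seq 0 (Z.to_nat M)).

Definition in_H (tau : C) : Prop := (0 < Im tau)%R.

Record mat2 := Mat2 { m11 : Z; m12 : Z; m21 : Z; m22 : Z }.

Definition SL2Z (A : mat2) : Prop := (m11 A * m22 A - m12 A * m21 A = 1)%Z.

Definition mat2_one : mat2 := Mat2 1 0 0 1.

Definition mat2_mul (A B : mat2) : mat2 :=
  Mat2 (m11 A * m11 B + m12 A * m21 B) (m11 A * m12 B + m12 A * m22 B)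
       (m21 A * m11 B + m22 A * m21 B) (m21 A * m12 B + m22 A * m22 B).

(* The inverse of a matrix of determinant 1. *)
Definition mat2_inv (A : mat2) : mat2 :=
  Mat2 (m22 A) (- m12 A) (- m21 A) (m11 A).

Definition Gamma (N : Z) (A : mat2) : Prop :=
  SL2Z A /\
  (N | m11 A - 1)%Z /\ (N | m12 A)%Z /\ (N | m21 A)%Z /\ (N | m22 A - 1)%Z.

Definition Gamma0 (N : Z) (A : mat2) : Prop := SL2Z A /\ (N | m21 A)%Z.

Definition congruence_subgroup (G : mat2 -> Prop) : Prop :=
  (forall A, G A -> SL2Z A) /\
  G mat2_one /\
  (forall A B, G A -> G B -> G (mat2_mul A B)) /\
  (forall A, G A -> G (mat2_inv A)) /\
  exists N : Z, (1 <= N)%Z /\ forall A, Gamma N A -> G A.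

Definition moebius (A : mat2) (tau : C) : C :=
  (m11 A * tau + m12 A) / (m21 A * tau + m22 A).

Definition cocycle (A : mat2) (tau : C) : C := m21 A * tau + m22 A.

Definition theta_null (tau : C) : C :=
  Csum (fun n : Z => qpow (n * n)%Z tau).

(* Shimura's automorphy factor of weight 1/2 on Gamma0(4), equal to
   (c/d) eps_d^{-1} (c tau + d)^{1/2}. *)
Definition theta_factor (A : mat2) (tau : C) : C :=
  theta_null (moebius A tau) / theta_null tau.

(* A congruence subgroup may always be shrunk, so G is taken inside Gamma0(4),
   where the theta multiplier lives.
   The last clause is holomorphy at the cusps: (c tau + d)^{-1/2} g(A tau) is
   bounded as Im tau -> oo, for every A in SL(2,Z) (the choice of the square
   root does not matter). *)
Definition modular_form_half (G : mat2 -> Prop) (g : C -> C) : Prop :=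
  (forall A, G A -> Gamma0 4 A) /\
  (forall tau, in_H tau ->
     ex_derive (K := C_AbsRing) (V := C_NormedModule) g tau) /\
  (forall A tau, G A -> in_H tau ->
     g (moebius A tau) = theta_factor A tau * g tau) /\
  (forall A, SL2Z A -> exists B Y : R, (0 < Y)%R /\
     forall tau, (Y <= Im tau)%R ->
       (Cmod (g (moebius A tau)) <= B * sqrt (Cmod (cocycle A tau)))%R).

(* g = sum_(k >= 0) b_k q^(k/w): the exponents are in (1/w)Z. *)
Definition q_expansion (g : C -> C) (w : nat) (b : nat -> C) : Prop :=
  forall tau, in_H tau ->
    is_Csum (fun k : nat => b k * qpow (INR k / INR w) tau) (g tau).

(* Gamma(a,x), for x > 0. *)
Definition inc_gamma (a x : R) : R :=
  RInt_gen (fun t : R => Rpower t (a - 1) * exp (- t))%R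
           (at_point x) (Rbar_locally p_infty).

(* g^* for g = sum_(k >= 0) b_k q^(k/w). *)
Definition star (w : nat) (b : nat -> C) (tau : C) : C :=
  RtoC 2 * Cconj (b O) * RtoC (/ sqrt (4 * PI * Im tau)) +
  Csum (fun j : nat =>
    let n := (INR (S j) / INR w)%R in
    RtoC (sqrt n) * Cconj (b (S j)) *
    RtoC (inc_gamma (- (1 / 2)) (4 * PI * n * Im tau)) * qpow (- n) tau).

(* Joint differentiability with a C-linear differential, on H x C. *)
Definition holomorphic_HC (phi : C -> C -> C) : Prop :=
  forall tau z : C, in_H tau ->
    ex_filterdiff (K := C_AbsRing)
      (U := prod_NormedModule C_AbsRing C_NormedModule C_NormedModule)
      (V := C_NormedModule)
      (fun p : C * C => phi (fst p) (snd p)) (locally (tau, z)).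

Definition elliptic (m : Z) (phi : C -> C -> C) : Prop :=
  forall (lambda mu : Z) (tau z : C), in_H tau ->
    phi tau (z + lambda * tau + mu) =
    e2pi (- (m * ((lambda * lambda)%Z * tau + RtoC 2 * lambda * z))) *
    phi tau z.

(* phi = sum c(n,r) q^n y^r over n >= 0 and r in Z; c(n,r) = 0 for n < 0. *)
Definition fourier_expansion (phi : C -> C -> C) (c : Z -> Z -> C) : Prop :=
  (forall n r : Z, (n < 0)%Z -> c n r = RtoC 0) /\
  (forall tau z : C, in_H tau ->
     is_Csum (fun p : Z * Z =>
                c (fst p) (snd p) * qpow (fst p) tau * e2pi (snd p * z))
             (phi tau z)).

Definition weak_elliptic_form (m : Z) (phi : C -> C -> C) : Prop :=
  holomorphic_HC phi /\ elliptic m phi /\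
  exists c : Z -> Z -> C, fourier_expansion phi c.

(* C_phi(Delta,r) = c((Delta + r^2)/4m, r), meaningful only when
   Delta = - r^2 (mod 4m), i.e. when the division is exact. *)
Definition Ccoef (m : Z) (c : Z -> Z -> C) (Delta r : Z) : C :=
  c ((Delta + r * r) / (4 * m))%Z r.

Definition disc_ok (m Delta r : Z) : Prop := (4 * m | Delta + r * r)%Z.

Definition optimal_growth (m : Z) (c : Z -> Z -> C) : Prop :=
  forall Delta r : Z,
    disc_ok m Delta r -> (Delta < -1)%Z -> Ccoef m c Delta r = RtoC 0.

Definition J1 (m : Z) (phi : C -> C -> C) : Prop :=
  forall (A : mat2) (tau z : C), SL2Z A -> in_H tau ->
    phi (moebius A tau) (z / cocycle A tau) =
    cocycle A tau ^ 2 * e2pi (m * m21 A * (z * z) / cocycle A tau) *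
    phi tau z.

Definition weak_jacobi_form2 (m : Z) (phi : C -> C -> C) : Prop :=
  weak_elliptic_form m phi /\ J1 m phi.

(* The sum over r = l (mod 2m), written r = l + 2mk with k in Z. *)
Definition vartheta (m l : Z) (tau z : C) : C :=
  Csum (fun k : Z =>
    let r := (l + 2 * m * k)%Z in
    qpow ((r * r)%Z / (4 * m)%Z) tau * e2pi (r * z)).

Definition mock_jacobi_form2 (m : Z) (phi : C -> C -> C) : Prop :=
  weak_elliptic_form m phi /\
  exists (h g : Z -> C -> C) (G : mat2 -> Prop)
         (w : Z -> nat) (b : Z -> nat -> C),
    (forall tau z : C, in_H tau ->
       phi tau z =
       lsum (fun l => h l tau * vartheta m l tau z) (residues (2 * m))) /\
    congruence_subgroup G /\
    (forall l : Z, In l (residues (2 * m)) ->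
       modular_form_half G (g l) /\
       (1 <= w l)%nat /\ q_expansion (g l) (w l) (b l)) /\
    J1 m (fun tau z =>
       lsum (fun l => (h l tau + star (w l) (b l) tau) * vartheta m l tau z)
            (residues (2 * m))).

(* 4m | l^2 - 1 says that Delta = -1 is admissible for l. *)
Definition kappa (m : Z) (c : Z -> Z -> C) (r : Z) : C :=
  - lsum (fun l : Z => Ccoef m c (-1) l * RtoC (cos (PI * l * r / m)))
         (filter (fun l : Z => ((l * l - 1) mod (4 * m) =? 0)%Z)
                 (residues (2 * m))).

(* Main.v *)
(* The circle method on the line Im tau = v = 1/(2 sqrt Delta), the saddle point of the
   denominator 2, where only the arc of denominator 1 needs more than an upper bound.  Write
   phi (in the mock case, its completion) as sum_rho H(tau, rho) y^rho.  For Delta > 0 the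
   mean of H(tau, r) q^(-n) over a period is c(n, r): in the mock case the completion only
   adds non-positive exponents.  Farey fractions give for every tau a matrix A with lower left
   entry c >= 1 and Im (A tau) >= 1/2, and (J1) followed by termwise integration over z in
   [0,1] expresses H(tau, r) through H(A tau, .), where only the terms with Delta = -1 grow.
   Bounding the terms by Gaussians settles c >= 2; only for c = 2 is care needed to avoid
   losing a power of Delta.  For c = 1 the polar terms sum to a Gaussian integral over R, and
   the resulting integral over tau has the primitive [peak_prim], known at the end points of
   the period up to a polynomial in Delta times exp(pi sqrt(Delta) / 4m).  Evenness in z turns
   the exponentials in r into cosines. *)
Require Import Defs.
From Stdlib Require Import Lra Lia Psatz Classical FinFun.
Open Scope R_scope.

(** * Unconditional sums *)

(** With a = pi/(2m) and y = sqrt Delta, a polar term of denominator c has size exp(a / (c^2 v)) at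
    height v, and q^(-n) has size exp(a y^2 v) up to a constant. For c = 2 the product is least at v
    = 1/(2y), where it equals exp(a y), exactly the error allowed: hence the choice of the line and
    the lack of any slack for c = 2. For c >= 3 the exponent falls short of a y by a fixed
    proportion, which pays for all powers of y. For c = 1 this line misses the saddle v = 1/y, and
    absolute values would give exp(5 a y / 2) instead of exp(2 a y): that contribution has to be
    evaluated exactly. That an elementary evaluation exists reflects the weight: unfolding the sum
    over frequencies turns tau^(-2) into tau^(-3/2), and the Bessel function that belongs to it,
    I_(1/2), is a hyperbolic sine up to a power. *)

Definition rsum {I : Type} (f : I -> R) (l : list I) : R :=
  fold_right Rplus 0 (map f l).

(** Absolute convergence with its bound carried along: a bound for every finite partial sum passes
    to the sum ([Cmod_is_Csum_le]), and this is how series are estimated below. *)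
Definition summable_by {I : Type} (f : I -> R) (B : R) : Prop :=
  forall l, NoDup l -> rsum f l <= B.

Lemma rsum_cons {I} (f : I -> R) i l : rsum f (i :: l) = f i + rsum f l.
Proof. reflexivity. Qed.

Lemma rsum_app {I} (f : I -> R) l1 l2 : rsum f (l1 ++ l2) = rsum f l1 + rsum f l2.
Proof.
  induction l1 as [|i l IH]; simpl; [unfold rsum; simpl; lra|].
  rewrite !rsum_cons, IH; lra.
Qed.

Lemma rsum_le {I} (f g : I -> R) l :
  (forall i, In i l -> f i <= g i) -> rsum f l <= rsum g l.
Proof.
  induction l as [|i l IH]; intros H; [right; reflexivity|].
  rewrite !rsum_cons; apply Rplus_le_compat; [apply H; now left|].
  apply IH; intros; apply H; now right.
Qed.

Lemma rsum_ext {I} (f g : I -> R) l :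
  (forall i, In i l -> f i = g i) -> rsum f l = rsum g l.
Proof.
  intros H; apply Rle_antisym; apply rsum_le; intros i Hi; rewrite (H i Hi); lra.
Qed.

Lemma rsum_scal {I} k (f : I -> R) l : rsum (fun i => k * f i) l = k * rsum f l.
Proof.
  induction l as [|i l IH]; [unfold rsum; simpl; lra|].
  rewrite !rsum_cons, IH; lra.
Qed.

Lemma rsum_plus {I} (f g : I -> R) l :
  rsum (fun i => f i + g i) l = rsum f l + rsum g l.
Proof.
  induction l as [|i l IH]; [unfold rsum; simpl; lra|].
  rewrite !rsum_cons, IH; lra.
Qed.

Lemma rsum_map {I J} (g : J -> I) (f : I -> R) l :
  rsum f (map g l) = rsum (fun j => f (g j)) l.
Proof. unfold rsum; now rewrite map_map. Qed.

Lemma rsum_nonneg {I} (f : I -> R) l : (forall i, 0 <= f i) -> 0 <= rsum f l.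
Proof.
  intros H; induction l as [|i l IH]; [unfold rsum; simpl; lra|].
  rewrite rsum_cons; generalize (H i); lra.
Qed.

Lemma rsum_incl {I} (f : I -> R) l l' :
  (forall i, 0 <= f i) -> NoDup l -> incl l l' -> rsum f l <= rsum f l'.
Proof.
  intros Hf; revert l'; induction l as [|i l IH]; intros l' Hl Hi.
  - apply rsum_nonneg, Hf.
  - inversion Hl as [|? ? H1 H2]; subst.
    destruct (in_split i l' (Hi i (or_introl eq_refl))) as [l1 [l2 ->]].
    rewrite rsum_cons, rsum_app, rsum_cons.
    assert (rsum f l <= rsum f (l1 ++ l2)).
    { apply IH; [assumption|].
      intros j Hj; destruct (in_app_or _ _ _ (Hi j (or_intror Hj))) as [H|[H|H]];
        apply in_or_app; auto.
      subst; contradiction. }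
    rewrite rsum_app in H; lra.
Qed.

Lemma lsum_cons {I} (f : I -> C) i l : lsum f (i :: l) = (f i + lsum f l)%C.
Proof. reflexivity. Qed.

Lemma lsum_app {I} (f : I -> C) l1 l2 : lsum f (l1 ++ l2) = (lsum f l1 + lsum f l2)%C.
Proof.
  induction l1 as [|i l IH]; simpl; [unfold lsum; simpl; ring|].
  rewrite !lsum_cons, IH; ring.
Qed.

Lemma lsum_ext {I} (f g : I -> C) l :
  (forall i, In i l -> f i = g i) -> lsum f l = lsum g l.
Proof.
  induction l as [|i l IH]; intros H; [reflexivity|].
  rewrite !lsum_cons, (H i (or_introl eq_refl)), IH; auto.
  intros; apply H; now right.
Qed.

Lemma lsum_scal {I} k (f : I -> C) l : lsum (fun i => k * f i)%C l = (k * lsum f l)%C.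
Proof.
  induction l as [|i l IH]; [unfold lsum; simpl; ring|].
  rewrite !lsum_cons, IH; ring.
Qed.

Lemma lsum_plus {I} (f g : I -> C) l :
  lsum (fun i => f i + g i)%C l = (lsum f l + lsum g l)%C.
Proof.
  induction l as [|i l IH]; [unfold lsum; simpl; ring|].
  rewrite !lsum_cons, IH; ring.
Qed.

Lemma lsum_map {I J} (g : J -> I) (f : I -> C) l :
  lsum f (map g l) = lsum (fun j => f (g j)) l.
Proof. unfold lsum; now rewrite map_map. Qed.

Lemma Cmod_lsum_le {I} (f : I -> C) l :
  Cmod (lsum f l) <= rsum (fun i => Cmod (f i)) l.
Proof.
  induction l as [|i l IH]; [unfold lsum, rsum; simpl; rewrite Cmod_0; lra|].
  rewrite lsum_cons, rsum_cons; eapply Rle_trans; [apply Cmod_triangle|lra].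
Qed.

Lemma Re_lsum {I} (f : I -> C) l : Re (lsum f l) = rsum (fun i => Re (f i)) l.
Proof.
  induction l as [|i l IH]; [reflexivity|]; rewrite lsum_cons, rsum_cons, <- IH; reflexivity.
Qed.

Lemma Im_lsum {I} (f : I -> C) l : Im (lsum f l) = rsum (fun i => Im (f i)) l.
Proof.
  induction l as [|i l IH]; [reflexivity|]; rewrite lsum_cons, rsum_cons, <- IH; reflexivity.
Qed.

Lemma classic_eq_dec (I : Type) (x y : I) : {x = y} + {x <> y}.
Proof. apply excluded_middle_informative. Qed.

Definition list_diff {I : Type} (l' l : list I) : list I :=
  filter (fun i => if in_dec (classic_eq_dec I) i l then false else true) l'.

Lemma in_list_diff {I} (l' l : list I) i : In i (list_diff l' l) -> ~ In i l.
Proof.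
  intros Hi; apply filter_In in Hi as [_ Hi].
  destruct (in_dec (classic_eq_dec I) i l); [discriminate|assumption].
Qed.

(** [is_Csum] tests only lists without repetition, so common refinements of finite index sets are
    formed as disjoint unions; equality on the index type is decided classically. *)
Definition merge_lists {I : Type} (l l' : list I) : list I := l ++ list_diff l' l.

Lemma in_merge_lists {I} (l l' : list I) i : In i (merge_lists l l') <-> In i l \/ In i l'.
Proof.
  unfold merge_lists, list_diff; rewrite in_app_iff, filter_In.
  destruct (in_dec (classic_eq_dec I) i l); intuition discriminate.
Qed.

Lemma NoDup_merge_lists {I} (l l' : list I) : NoDup l -> NoDup l' -> NoDup (merge_lists l l').
Proof.
  intros H H'; unfold merge_lists; apply NoDup_app; auto; [now apply NoDup_filter|].
  intros i Hi Hc; now apply in_list_diff in Hc.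
Qed.

Lemma incl_merge_l {I} (l l' : list I) : incl l (merge_lists l l').
Proof. intros i Hi; apply in_merge_lists; now left. Qed.

Lemma incl_merge_r {I} (l l' : list I) : incl l' (merge_lists l l').
Proof. intros i Hi; apply in_merge_lists; now right. Qed.

Definition dedup {I : Type} (l : list I) := nodup (classic_eq_dec I) l.

Lemma NoDup_dedup {I} (l : list I) : NoDup (dedup l).
Proof. apply NoDup_nodup. Qed.

Lemma incl_dedup {I} (l : list I) : incl l (dedup l).
Proof. intros i Hi; now apply nodup_In. Qed.

Lemma Cmod_le_eps_eq (z : C) : (forall eps, 0 < eps -> Cmod z <= eps) -> z = RtoC 0.
Proof.
  intros H; apply Cmod_eq_0; apply Rle_antisym; [|apply Cmod_ge_0].
  apply le_epsilon; intros eps He; generalize (H eps He); lra.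
Qed.

Lemma is_Csum_unique {I} (f : I -> C) s t : is_Csum f s -> is_Csum f t -> s = t.
Proof.
  intros Hs Ht.
  enough (E : (s - t)%C = RtoC 0) by (rewrite <- (Cplus_0_l t), <- E; ring).
  apply Cmod_le_eps_eq; intros eps He.
  destruct (Hs (eps/2)) as [l0 H0]; [lra|]. destruct (Ht (eps/2)) as [l1 H1]; [lra|].
  set (l := merge_lists (dedup l0) (dedup l1)).
  assert (Hl : NoDup l) by (apply NoDup_merge_lists; apply NoDup_dedup).
  specialize (H0 l Hl). specialize (H1 l Hl).
  assert (Cmod (lsum f l - s) < eps/2).
  { apply H0. intros i Hi; apply incl_merge_l, incl_dedup, Hi. }
  assert (Cmod (lsum f l - t) < eps/2).
  { apply H1. intros i Hi; apply incl_merge_r, incl_dedup, Hi. }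
  replace (s - t)%C with (- (lsum f l - s) + (lsum f l - t))%C by ring.
  eapply Rle_trans; [apply Cmod_triangle|]. rewrite Cmod_opp; lra.
Qed.

Lemma Csum_correct {I} (f : I -> C) s : is_Csum f s -> is_Csum f (Csum f).
Proof. intros H; unfold Csum; apply epsilon_spec; now exists s. Qed.

Lemma is_Csum_ext {I} (f g : I -> C) s :
  (forall i, f i = g i) -> is_Csum f s -> is_Csum g s.
Proof.
  intros H Hf eps He; destruct (Hf eps He) as [l0 H0]; exists l0; intros l Hl Hi.
  rewrite <- (lsum_ext f g); auto.
Qed.

Lemma is_Csum_scal {I} k (f : I -> C) s :
  is_Csum f s -> is_Csum (fun i => k * f i)%C (k * s)%C.
Proof.
  intros Hf eps He.
  assert (Hk : 0 < Cmod k + 1) by (generalize (Cmod_ge_0 k); lra).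
  destruct (Hf (eps / (Cmod k + 1))) as [l0 H0]; [now apply Rdiv_lt_0_compat|].
  exists l0; intros l Hl Hi; rewrite lsum_scal.
  replace (k * lsum f l - k * s)%C with (k * (lsum f l - s))%C by ring.
  rewrite Cmod_mult. specialize (H0 l Hl Hi).
  apply Rmult_lt_compat_r with (r := Cmod k + 1) in H0; [|lra].
  unfold Rdiv in H0; rewrite Rmult_assoc, Rinv_l in H0; [|lra].
  generalize (Cmod_ge_0 (lsum f l - s)); nra.
Qed.

Lemma is_Csum_plus {I} (f g : I -> C) s t :
  is_Csum f s -> is_Csum g t -> is_Csum (fun i => f i + g i)%C (s + t)%C.
Proof.
  intros Hf Hg eps He.
  destruct (Hf (eps/2)) as [l0 H0]; [lra|]. destruct (Hg (eps/2)) as [l1 H1]; [lra|].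
  exists (l0 ++ l1); intros l Hl Hi; rewrite lsum_plus.
  replace (lsum f l + lsum g l - (s + t))%C
    with ((lsum f l - s) + (lsum g l - t))%C by ring.
  eapply Rle_lt_trans; [apply Cmod_triangle|].
  apply incl_app_inv in Hi as [Ha Hb].
  specialize (H0 l Hl Ha); specialize (H1 l Hl Hb); lra.
Qed.

Lemma is_Csum_zero {I} : is_Csum (fun _ : I => RtoC 0) (RtoC 0).
Proof.
  intros eps He; exists nil; intros l _ _.
  replace (lsum (fun _ : I => RtoC 0) l) with (RtoC 0).
  - replace (0 - 0)%C with (RtoC 0) by ring; now rewrite Cmod_0.
  - induction l; [reflexivity|]; rewrite lsum_cons, <- IHl; ring.
Qed.

Lemma is_Csum_lsum {I J} (f : J -> I -> C) (s : J -> C) (l : list J) :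
  (forall j, In j l -> is_Csum (f j) (s j)) ->
  is_Csum (fun i => lsum (fun j => f j i) l) (lsum s l).
Proof.
  induction l as [|j l IH]; intros H; [apply is_Csum_zero|].
  apply is_Csum_plus; [apply H; now left|]. apply IH; intros; apply H; now right.
Qed.

Lemma is_Csum_inj {I J} (g : J -> I) (f : I -> C) s :
  (forall j j', g j = g j' -> j = j') ->
  (forall i, (forall j, g j <> i) -> f i = RtoC 0) ->
  is_Csum (fun j => f (g j)) s -> is_Csum f s.
Proof.
  intros Hg Hf H eps He; destruct (H eps He) as [l0 H0].
  exists (map g l0); intros l Hl Hi.
  assert (E : forall l, NoDup l -> exists l', NoDup l' /\
    (forall j, In j l' <-> In (g j) l) /\ lsum f l = lsum (fun j => f (g j)) l').
  { clear -Hg Hf; induction l as [|i l IH]; intros Hl.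
    - exists nil; repeat split; simpl; try tauto; constructor.
    - inversion Hl as [|? ? H1 H2]; subst. destruct (IH H2) as [l' [N [P Q]]].
      destruct (classic (exists j, g j = i)) as [[j <-]|Hn].
      + exists (j :: l'); split; [constructor; [now rewrite P|assumption]|]; split.
        * intros j'; simpl; rewrite P; split; intros [E|E]; auto; left; auto.
          now rewrite E.
        * now rewrite !lsum_cons, Q.
      + exists l'; split; [assumption|]; split.
        * intros j; rewrite P; simpl; split; auto; intros [E|E]; auto.
          exfalso; apply Hn; now exists j.
        * rewrite lsum_cons, (Hf i), Q; [ring|]. intros j Hj; apply Hn; now exists j. }
  destruct (E l Hl) as [l' [N [P Q]]]; rewrite Q; apply H0; auto.
  intros j Hj; apply P, Hi, in_map, Hj.
Qed.

Lemma abs_Re_le (z : C) : Rabs (Re z) <= Cmod z.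
Proof. apply Rle_trans with (2 := Rmax_Cmod z); apply Rmax_l. Qed.

Lemma abs_Im_le (z : C) : Rabs (Im z) <= Cmod z.
Proof. apply Rle_trans with (2 := Rmax_Cmod z); apply Rmax_r. Qed.

Lemma Cmod_le_Re_Im (z : C) : Cmod z <= Rabs (Re z) + Rabs (Im z).
Proof.
  replace z with (RtoC (Re z) + Ci * RtoC (Im z))%C at 1.
  - eapply Rle_trans; [apply Cmod_triangle|]. rewrite Cmod_mult, !Cmod_R.
    replace (Cmod Ci) with 1; [lra|]. unfold Cmod, Ci; simpl.
    rewrite <- sqrt_1 at 1; f_equal; ring.
  - destruct z; unfold Cplus, Cmult, RtoC, Ci; simpl; f_equal; ring.
Qed.

(** The terms of either sign form a sublist, which contributes at most [B]; this recovers absolute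
    values from bounds on signed sums. *)
Lemma rsum_abs_le {I} (f : I -> R) l B :
  (forall l', NoDup l' -> incl l' l -> Rabs (rsum f l') <= B) ->
  NoDup l -> rsum (fun i => Rabs (f i)) l <= 2 * B.
Proof.
  intros H Hl.
  set (p := filter (fun i => if Rle_dec 0 (f i) then true else false) l).
  set (n := filter (fun i => if Rle_dec 0 (f i) then false else true) l).
  assert (E : rsum (fun i => Rabs (f i)) l = rsum f p - rsum f n).
  { unfold p, n; clear; induction l as [|i l IH]; [unfold rsum; simpl; ring|].
    simpl; rewrite rsum_cons, IH; destruct (Rle_dec 0 (f i)); rewrite rsum_cons.
    - rewrite Rabs_right; lra.
    - rewrite Rabs_left; lra. }
  rewrite E.
  assert (Rabs (rsum f p) <= B) by (apply H; [now apply NoDup_filter|apply incl_filter]).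
  assert (Rabs (rsum f n) <= B) by (apply H; [now apply NoDup_filter|apply incl_filter]).
  apply Rabs_le_between in H0; apply Rabs_le_between in H1; lra.
Qed.

(** Unconditional convergence of a complex family is absolute: off a suitable finite set every
    finite partial sum is at most 2 in modulus by the Cauchy criterion, and so are its real and
    imaginary parts, to which [rsum_abs_le] applies. The 8 is 4 for each part. *)
Lemma is_Csum_abs {I} (f : I -> C) s :
  is_Csum f s -> exists B, summable_by (fun i => Cmod (f i)) B.
Proof.
  intros H; destruct (H 1) as [l0' H0']; [lra|].
  set (l0 := dedup l0').
  assert (N0 : NoDup l0) by apply NoDup_dedup.
  assert (H0 : forall l, NoDup l -> incl l0 l -> Cmod (lsum f l - s) < 1).
  { intros l Hl Hi; apply H0'; auto. intros i Ii; apply Hi, incl_dedup, Ii. }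
  assert (D : forall l, NoDup l -> (forall i, In i l -> ~ In i l0) -> Cmod (lsum f l) <= 2).
  { intros l Hl Hd.
    replace (lsum f l) with ((lsum f (l0 ++ l) - s) + - (lsum f l0 - s))%C
      by (rewrite lsum_app; ring).
    eapply Rle_trans; [apply Cmod_triangle|]; rewrite Cmod_opp.
    assert (Cmod (lsum f (l0 ++ l) - s) < 1).
    { apply H0; [|apply incl_appl, incl_refl].
      apply NoDup_app; auto. intros i Hi Hj; exact (Hd i Hj Hi). }
    assert (Cmod (lsum f l0 - s) < 1) by (apply H0; auto; apply incl_refl).
    lra. }
  exists (rsum (fun i => Cmod (f i)) l0 + 8); intros l Hl.
  set (l1 := list_diff l l0).
  assert (N1 : NoDup l1) by now apply NoDup_filter.
  assert (L : rsum (fun i => Cmod (f i)) l <= rsum (fun i => Cmod (f i)) (l0 ++ l1)).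
  { apply rsum_incl; auto; [intros; apply Cmod_ge_0|]. intros i Hi.
    apply in_merge_lists with (l' := l). now right. }
  rewrite rsum_app in L.
  assert (rsum (fun i => Rabs (Re (f i))) l1 <= 2 * 2).
  { apply rsum_abs_le; auto. intros l' N' I'. rewrite <- Re_lsum.
    eapply Rle_trans; [apply abs_Re_le|apply D]; auto.
    intros i Hi; apply (in_list_diff l), I', Hi. }
  assert (rsum (fun i => Rabs (Im (f i))) l1 <= 2 * 2).
  { apply rsum_abs_le; auto. intros l' N' I'. rewrite <- Im_lsum.
    eapply Rle_trans; [apply abs_Im_le|apply D]; auto.
    intros i Hi; apply (in_list_diff l), I', Hi. }
  assert (rsum (fun i => Cmod (f i)) l1 <=
     rsum (fun i => Rabs (Re (f i)) + Rabs (Im (f i))) l1).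
  { apply rsum_le; intros; apply Cmod_le_Re_Im. }
  rewrite rsum_plus in H3. lra.
Qed.

Lemma is_rsum_exists {I} (f : I -> R) B :
  (forall i, 0 <= f i) -> summable_by f B ->
  exists s : R, forall eps, 0 < eps -> exists l0, forall l, NoDup l -> incl l0 l ->
    Rabs (rsum f l - s) < eps.
Proof.
  intros Hf HB.
  destruct (completeness (fun x => exists l, NoDup l /\ x = rsum f l)) as [S [U L]].
  - exists B; intros x [l [Hl ->]]; now apply HB.
  - exists 0, nil; split; [constructor|reflexivity].
  - exists S; intros eps He.
    destruct (classic (exists l, NoDup l /\ S - eps < rsum f l)) as [[l0 [N0 H0]]|Hn].
    + exists l0; intros l Hl Hi.
      assert (rsum f l <= S) by (apply U; now exists l).
      assert (rsum f l0 <= rsum f l) by (apply rsum_incl; auto).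
      apply Rabs_def1; lra.
    + exfalso. assert (S <= S - eps); [|lra]. apply L; intros x [l [Hl ->]].
      destruct (Rle_lt_dec (rsum f l) (S - eps)); auto. exfalso; apply Hn; now exists l.
Qed.

Lemma summable_tail {I} (f : I -> R) B :
  (forall i, 0 <= f i) -> summable_by f B ->
  forall eps, 0 < eps -> exists l0, NoDup l0 /\
    forall l, NoDup l -> (forall i, In i l -> ~ In i l0) -> rsum f l < eps.
Proof.
  intros Hf HB eps He.
  destruct (is_rsum_exists f B Hf HB) as [s Hs], (Hs (eps / 2)) as [l0 H0]; [lra|].
  assert (N0 := NoDup_dedup l0). exists (dedup l0); split; [exact N0|]; intros l Hl Hd.
  assert (H1 := H0 _ N0 (incl_dedup l0)).
  assert (H2 : Rabs (rsum f (dedup l0 ++ l) - s) < eps / 2).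
  { apply H0; [|apply incl_appl, incl_dedup].
    apply NoDup_app; auto. intros i Hi Hj; exact (Hd i Hj Hi). }
  rewrite rsum_app in H2. apply Rabs_lt_between in H1, H2; lra.
Qed.

Lemma is_Csum_real {I} (f : I -> R) B :
  (forall i, 0 <= f i) -> summable_by f B -> exists s, is_Csum (fun i => RtoC (f i)) s.
Proof.
  intros Hf HB; destruct (is_rsum_exists f B Hf HB) as [s Hs]; exists (RtoC s).
  intros eps He; destruct (Hs eps He) as [l0 H0]; exists l0; intros l Hl Hi.
  replace (lsum (fun i => RtoC (f i)) l - s)%C with (RtoC (rsum f l - s)).
  - rewrite Cmod_R; auto.
  - rewrite RtoC_minus; f_equal. induction l; [reflexivity|].
    rewrite lsum_cons, rsum_cons, RtoC_plus; f_equal.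
    clear; induction l; [reflexivity|]. now rewrite lsum_cons, rsum_cons, RtoC_plus, IHl.
Qed.

Lemma summable_le {I} (f g : I -> R) B :
  (forall i, f i <= g i) -> summable_by g B -> summable_by f B.
Proof.
  intros H HB l Hl; eapply Rle_trans; [apply rsum_le; intros; apply H|now apply HB].
Qed.

Lemma is_Csum_exists {I} (f : I -> C) B :
  summable_by (fun i => Cmod (f i)) B -> exists s, is_Csum f s.
Proof.
  intros HB.
  set (p := fun x : R => Rmax x 0). set (n := fun x : R => Rmax (- x) 0).
  assert (P0 : forall x, 0 <= p x) by (intros; apply Rmax_r).
  assert (N0 : forall x, 0 <= n x) by (intros; apply Rmax_r).
  assert (P1 : forall x, p x <= Rabs x).
  { intros; apply Rmax_lub; [apply Rle_abs|apply Rabs_pos]. }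
  assert (N1 : forall x, n x <= Rabs x).
  { intros; apply Rmax_lub; [|apply Rabs_pos]. rewrite <- Rabs_Ropp; apply Rle_abs. }
  assert (PN : forall x, x = p x - n x).
  { intros x; unfold p, n, Rmax.
    destruct (Rle_dec x 0), (Rle_dec (-x) 0); lra. }
  destruct (is_Csum_real (fun i => p (Re (f i))) B) as [s1 H1]; auto.
  { eapply summable_le; [|exact HB]; intros; eapply Rle_trans; [apply P1|apply abs_Re_le]. }
  destruct (is_Csum_real (fun i => n (Re (f i))) B) as [s2 H2]; auto.
  { eapply summable_le; [|exact HB]; intros; eapply Rle_trans; [apply N1|apply abs_Re_le]. }
  destruct (is_Csum_real (fun i => p (Im (f i))) B) as [s3 H3]; auto.
  { eapply summable_le; [|exact HB]; intros; eapply Rle_trans; [apply P1|apply abs_Im_le]. }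
  destruct (is_Csum_real (fun i => n (Im (f i))) B) as [s4 H4]; auto.
  { eapply summable_le; [|exact HB]; intros; eapply Rle_trans; [apply N1|apply abs_Im_le]. }
  exists ((s1 + (-1) * s2) + Ci * (s3 + (-1) * s4))%C.
  eapply is_Csum_ext; [|apply is_Csum_plus; [apply is_Csum_plus; [exact H1|
    apply is_Csum_scal, H2]|apply is_Csum_scal, is_Csum_plus; [exact H3|apply is_Csum_scal, H4]]].
  intros i; cbv beta. rewrite (surjective_pairing (f i)) at 5.
  change (fst (f i)) with (Re (f i)); change (snd (f i)) with (Im (f i)).
  rewrite (PN (Re (f i))) at 3; rewrite (PN (Im (f i))) at 3.
  unfold Cplus, Cmult, Copp, RtoC, Ci; simpl; f_equal; ring.
Qed.

Lemma Cmod_is_Csum_le {I} (f : I -> C) s B :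
  is_Csum f s -> summable_by (fun i => Cmod (f i)) B -> Cmod s <= B.
Proof.
  intros H HB; apply le_epsilon; intros eps He.
  destruct (H eps He) as [l0 H0].
  assert (N := NoDup_dedup l0). assert (I0 := incl_dedup l0).
  specialize (H0 _ N I0).
  replace s with (lsum f (dedup l0) + - (lsum f (dedup l0) - s))%C by ring.
  eapply Rle_trans; [apply Cmod_triangle|]; rewrite Cmod_opp.
  generalize (HB _ N) (Cmod_lsum_le f (dedup l0)); lra.
Qed.

Lemma is_Csum_fst_fiber {I J} (f : I * J -> C) s :
  is_Csum f s -> forall j, exists t, is_Csum (fun i => f (i, j)) t.
Proof.
  intros H j; destruct (is_Csum_abs f s H) as [B HB].
  apply is_Csum_exists with B; intros l Hl.
  rewrite <- (rsum_map (fun i => (i, j)) (fun p => Cmod (f p))).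
  apply HB. apply Injective_map_NoDup; auto. intros a b E; now inversion E.
Qed.

(** A finite sum of fibre sums is close to a finite sum of [f] over a set that contains [l0], the
    set beyond which the sums of [f] have settled. *)
Lemma is_Csum_fibers {I J} (f : I * J -> C) s (g : J -> C) :
  is_Csum f s -> (forall j, is_Csum (fun i => f (i, j)) (g j)) -> is_Csum g s.
Proof.
  intros H Hg eps He.
  destruct (H (eps/2)) as [l0 H0]; [lra|].
  exists (map snd l0); intros lj Nj Ij.
  (* Induction over the fibres, each new one spending half of the remaining tolerance [d]; the third
     clause keeps all of [l0] that lies over [lj]. *)
  assert (A : forall d, 0 < d -> forall lj, NoDup lj ->
    exists l, NoDup l /\ (forall p, In p l -> In (snd p) lj) /\
      (forall p, In p l0 -> In (snd p) lj -> In p l) /\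
      Cmod (lsum f l - lsum g lj) <= d).
  { clear lj Nj Ij; intros d Hd lj; revert d Hd; induction lj as [|j lj IH]; intros d Hd Nj.
    - exists nil; split; [constructor|]; split; [simpl; tauto|]; split; [simpl; tauto|].
      unfold lsum; simpl. replace (0 - 0)%C with (RtoC 0) by ring; rewrite Cmod_0; lra.
    - inversion Nj as [|? ? Hj Nj']; subst.
      destruct (IH (d/2)) as [l [N [P [Q R]]]]; [lra|assumption|].
      destruct (Hg j (d/2)) as [li0 Hi0]; [lra|].
      set (li := merge_lists (dedup li0) (dedup (map fst l0))).
      assert (Ni : NoDup li) by (apply NoDup_merge_lists; apply NoDup_dedup).
      specialize (Hi0 li Ni).
      exists (map (fun i => (i, j)) li ++ l); split.
      { apply NoDup_app; auto.
        - apply Injective_map_NoDup; auto. intros a b E; now inversion E.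
        - intros p Hp Hq. apply P in Hq. apply in_map_iff in Hp as [i [<- _]].
          contradiction. }
      split; [|split].
      + intros p Hp; apply in_app_or in Hp as [Hp|Hp].
        * apply in_map_iff in Hp as [i [<- _]]; now left.
        * right; now apply P.
      + intros [i j'] Hp [E|E]; simpl in E; apply in_or_app.
        * subst j'; left; apply in_map_iff; exists i; split; auto.
          apply incl_merge_r, incl_dedup. now apply (in_map fst) in Hp.
        * right; now apply Q.
      + rewrite lsum_app, lsum_map, lsum_cons.
        replace (lsum (fun i => f (i, j)) li + lsum f l - (g j + lsum g lj))%C
          with ((lsum (fun i => f (i, j)) li - g j) + (lsum f l - lsum g lj))%C by ring.
        eapply Rle_trans; [apply Cmod_triangle|].
        assert (Cmod (lsum (fun i => f (i, j)) li - g j) < d/2); [|lra].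
        apply Hi0. intros i Ii; apply incl_merge_l, incl_dedup, Ii. }
  destruct (A (eps/2)) with (lj := lj) as [l [N [P [Q R]]]]; [lra|assumption|].
  replace (lsum g lj - s)%C with (- (lsum f l - lsum g lj) + (lsum f l - s))%C by ring.
  eapply Rle_lt_trans; [apply Cmod_triangle|]; rewrite Cmod_opp.
  assert (Cmod (lsum f l - s) < eps/2); [|lra].
  apply H0; auto. intros p Hp; apply Q; auto. apply Ij, in_map, Hp.
Qed.

(** * Curves in the complex plane and their integrals *)

(* Coquelicot states equations in the carrier of a canonical structure, where [ring] fails. *)
Ltac eqR := match goal with |- @eq _ ?a ?b => change (@eq R a b) end.
Ltac eqC := match goal with |- @eq _ ?a ?b => change (@eq C a b) end.

Ltac pos := repeat first
  [ lra | apply Cmod_ge_0 | apply pow2_ge_0 | apply exp_pos | left; apply exp_pos | apply Rabs_pos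
  | apply Rmult_lt_0_compat | apply Rmult_le_pos | apply Rinv_0_lt_compat
  | left; apply Rinv_0_lt_compat | apply Rdiv_lt_0_compat | apply Rdiv_le_0_compat
  | apply pow_lt | apply sqrt_lt_R0 | apply sqrt_pos | assumption | nra ].

Lemma Ceq (z w : C) : Re z = Re w -> Im z = Im w -> z = w.
Proof. destruct z, w; simpl; intros -> ->; reflexivity. Qed.

Lemma Re_mult (z w : C) : Re (z * w)%C = Re z * Re w - Im z * Im w.
Proof. reflexivity. Qed.

Lemma Im_mult (z w : C) : Im (z * w)%C = Re z * Im w + Im z * Re w.
Proof. reflexivity. Qed.

Lemma Re_plus (z w : C) : Re (z + w)%C = Re z + Re w.
Proof. reflexivity. Qed.

Lemma Im_plus (z w : C) : Im (z + w)%C = Im z + Im w.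
Proof. reflexivity. Qed.

Lemma Re_opp (z : C) : Re (- z)%C = - Re z.
Proof. reflexivity. Qed.

Lemma Im_opp (z : C) : Im (- z)%C = - Im z.
Proof. reflexivity. Qed.

Lemma Re_scal (x : R) (w : C) : Re (x * w)%C = x * Re w.
Proof. rewrite Re_mult; simpl; ring. Qed.

Lemma Im_scal (x : R) (w : C) : Im (x * w)%C = x * Im w.
Proof. rewrite Im_mult; simpl; ring. Qed.

Lemma Cexp_plus (z w : C) : Cexp (z + w) = (Cexp z * Cexp w)%C.
Proof.
  unfold Cexp; apply Ceq; rewrite ?Re_mult, ?Im_mult, Re_plus, Im_plus; simpl;
    rewrite exp_plus, ?cos_plus, ?sin_plus; ring.
Qed.

Lemma Cexp_R (x : R) : Cexp x = RtoC (exp x).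
Proof. unfold Cexp; apply Ceq; simpl; rewrite ?cos_0, ?sin_0; ring. Qed.

Lemma Cexp_0 : Cexp 0 = RtoC 1.
Proof. rewrite Cexp_R, exp_0; reflexivity. Qed.

Lemma Cmod_Cexp (z : C) : Cmod (Cexp z) = exp (Re z).
Proof.
  unfold Cmod, Cexp; simpl.
  replace (_ + _) with (exp (Re z) ^ 2 * (Rsqr (sin (Im z)) + Rsqr (cos (Im z))))
    by (unfold Rsqr; ring).
  rewrite sin2_cos2, Rmult_1_r. simpl; rewrite Rmult_1_r.
  apply sqrt_square; left; apply exp_pos.
Qed.

Lemma e2pi_plus (z w : C) : e2pi (z + w) = (e2pi z * e2pi w)%C.
Proof. unfold e2pi; rewrite <- Cexp_plus; f_equal; ring. Qed.

Lemma e2pi_0 : e2pi 0 = RtoC 1.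
Proof. unfold e2pi; rewrite Cmult_0_r; apply Cexp_0. Qed.

Lemma Re_2piI (z : C) : Re (RtoC 2 * PI * Ci * z)%C = - (2 * PI * Im z).
Proof. unfold Re, Im; simpl; ring. Qed.

Lemma Im_2piI (z : C) : Im (RtoC 2 * PI * Ci * z)%C = 2 * PI * Re z.
Proof. unfold Re, Im; simpl; ring. Qed.

Lemma Cmod_e2pi (z : C) : Cmod (e2pi z) = exp (- (2 * PI * Im z)).
Proof. unfold e2pi; rewrite Cmod_Cexp, Re_2piI; reflexivity. Qed.

Lemma Cmod_e2pi_R (x : R) : Cmod (e2pi x) = 1.
Proof. rewrite Cmod_e2pi; simpl; rewrite Rmult_0_r, Ropp_0; apply exp_0. Qed.

Lemma e2pi_opp (z : C) : (e2pi z * e2pi (- z))%C = RtoC 1.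
Proof. rewrite <- e2pi_plus, <- e2pi_0; f_equal; ring. Qed.

Lemma e2pi_1 : e2pi 1 = RtoC 1.
Proof.
  unfold e2pi, Cexp; rewrite Re_2piI, Im_2piI; simpl.
  rewrite Rmult_0_r, Rmult_1_r, Ropp_0, exp_0, cos_2PI, sin_2PI.
  apply Ceq; simpl; ring.
Qed.

Lemma e2pi_nat (n : nat) : e2pi (INR n) = RtoC 1.
Proof.
  induction n; [apply e2pi_0|].
  rewrite S_INR, RtoC_plus, e2pi_plus, IHn, e2pi_1; ring.
Qed.

Lemma e2pi_Z (k : Z) : e2pi (IZR k) = RtoC 1.
Proof.
  destruct (Z_le_gt_dec 0 k) as [H|H].
  - rewrite <- (Z2Nat.id k H), <- INR_IZR_INZ; apply e2pi_nat.
  - generalize (e2pi_opp (IZR k)).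
    replace (- RtoC (IZR k))%C with (RtoC (INR (Z.to_nat (- k)))).
    + rewrite e2pi_nat, Cmult_1_r; auto.
    + rewrite INR_IZR_INZ, Z2Nat.id, opp_IZR, RtoC_opp; auto; lia.
Qed.

Lemma e2pi_add_Z (z : C) (k : Z) : e2pi (z + IZR k) = e2pi z.
Proof. rewrite e2pi_plus, e2pi_Z; ring. Qed.

(** All integrals run over real segments, so a derivative in a real parameter suffices; taking it
    componentwise gives access to the real theory and to [auto_derive]. *)
Definition cder (f : R -> C) (x : R) (l : C) : Prop :=
  is_derive (fun t => Re (f t)) x (Re l) /\ is_derive (fun t => Im (f t)) x (Im l).

Definition ccont (f : R -> C) (x : R) : Prop :=
  continuous (fun t => Re (f t)) x /\ continuous (fun t => Im (f t)) x.

Notation is_CInt := (is_RInt (V := C_R_NormedModule)).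

Lemma cder_ccont f x l : cder f x l -> ccont f x.
Proof.
  intros [H1 H2]; split; apply (ex_derive_continuous (K := R_AbsRing) (V := R_NormedModule)); eexists; eassumption.
Qed.

Lemma cder_eq f x l l' : cder f x l -> l = l' -> cder f x l'.
Proof. intros H <-; exact H. Qed.

Lemma cder_ext f g x l : (forall t, f t = g t) -> cder f x l -> cder g x l.
Proof.
  intros E [H1 H2]; split; eapply is_derive_ext; try eassumption;
    intros; cbv beta; now rewrite E.
Qed.

Lemma cder_const (k : C) x : cder (fun _ => k) x 0.
Proof. split; apply (is_derive_const (K := R_AbsRing) (V := R_NormedModule)). Qed.

Lemma cder_R f x l : is_derive f x l -> cder (fun t => RtoC (f t)) x (RtoC l).
Proof. intros H; split; simpl; [exact H|apply (is_derive_const (K := R_AbsRing) (V := R_NormedModule))]. Qed.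

Lemma cder_plus f g x lf lg : cder f x lf -> cder g x lg ->
  cder (fun t => f t + g t)%C x (lf + lg)%C.
Proof.
  intros [H1 H2] [H3 H4]; split.
  - apply (is_derive_plus (K := R_AbsRing) (V := R_NormedModule)); assumption.
  - apply (is_derive_plus (K := R_AbsRing) (V := R_NormedModule)); assumption.
Qed.

Lemma cder_mult f g x lf lg : cder f x lf -> cder g x lg ->
  cder (fun t => f t * g t)%C x (lf * g x + f x * lg)%C.
Proof.
  intros [H1 H2] [H3 H4]; split.
  - apply is_derive_ext with (fun t => Re (f t) * Re (g t) + (-1) * (Im (f t) * Im (g t))).
    { intros; rewrite Re_mult; eqR; ring. }
    evar_last.
    { apply (is_derive_plus (K := R_AbsRing) (V := R_NormedModule)).
      - apply Derive.is_derive_mult; eassumption.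
      - apply is_derive_scal, Derive.is_derive_mult; eassumption. }
    rewrite Re_plus, !Re_mult; unfold plus; simpl; eqR; ring.
  - apply is_derive_ext with (fun t => Re (f t) * Im (g t) + Im (f t) * Re (g t)).
    { reflexivity. }
    evar_last.
    { apply (is_derive_plus (K := R_AbsRing) (V := R_NormedModule)).
      - apply Derive.is_derive_mult; eassumption.
      - apply Derive.is_derive_mult; eassumption. }
    rewrite Im_plus, !Im_mult; unfold plus; simpl; eqR; ring.
Qed.

Lemma cder_scal k f x l : cder f x l -> cder (fun t => k * f t)%C x (k * l)%C.
Proof.
  intros H; eapply cder_eq; [apply cder_mult; [apply cder_const|exact H]|]; cbv beta; ring.
Qed.

Lemma cder_Cexp f x l : cder f x l ->
  cder (fun t => Cexp (f t)) x (l * Cexp (f x))%C.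
Proof.
  intros [H1 H2].
  (* The components are abstracted to [u] and [w] so that [auto_derive] meets variables instead of
     projections. *)
  assert (G : forall u w : R -> R, forall u' w',
    is_derive u x u' -> is_derive w x w' ->
    is_derive (fun t => exp (u t) * cos (w t)) x
      (u' * (exp (u x) * cos (w x)) - w' * (exp (u x) * sin (w x))) /\
    is_derive (fun t => exp (u t) * sin (w t)) x
      (u' * (exp (u x) * sin (w x)) + w' * (exp (u x) * cos (w x)))).
  { intros u w u' w' Hu Hw; split; (auto_derive;
      [repeat split; eexists; eassumption|]);
    rewrite (is_derive_unique (fun x : R => u x) _ _ Hu),
      (is_derive_unique (fun x : R => w x) _ _ Hw); ring. }
  destruct (G _ _ _ _ H1 H2) as [G1 G2]; split; [exact G1|exact G2].
Qed.

Lemma cder_inv f x l : f x <> RtoC 0 -> cder f x l ->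
  cder (fun t => / f t)%C x (- l / (f x * f x))%C.
Proof.
  intros H0 [H1 H2].
  assert (G : forall u w : R -> R, forall u' w' : R, u x ^ 2 + w x ^ 2 <> 0 ->
    is_derive u x u' -> is_derive w x w' ->
    cder (fun t => / (u t, w t))%C x (- (u', w') / ((u x, w x) * (u x, w x)))%C).
  { intros u w u' w' Hn Hu Hw.
    assert (Hm : Re ((u x, w x) * (u x, w x)) ^ 2 + Im ((u x, w x) * (u x, w x)) ^ 2
                 = (u x ^ 2 + w x ^ 2) ^ 2) by (simpl; ring).
    assert (Hm' : (u x * u x - w x * w x) ^ 2 + (u x * w x + w x * u x) ^ 2 <> 0).
    { simpl in Hm; intros E; apply Hn.
      apply Rsqr_0_uniq; unfold Rsqr; rewrite <- E; ring. }
    split; simpl; (auto_derive;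
      [repeat split; try (eexists; eassumption); intros E; apply Hn; rewrite <- E; ring|]);
    rewrite (is_derive_unique (fun x : R => u x) _ _ Hu),
      (is_derive_unique (fun x : R => w x) _ _ Hw); field;
    repeat split; intros E; first [apply Hn; rewrite <- E; ring | apply Hm'; rewrite <- E; ring]. }
  assert (G' := fun h => G _ _ _ _ h H1 H2).
  eapply cder_ext; [|eapply cder_eq; [apply G'|]].
  - intros t; cbv beta; rewrite <- surjective_pairing; reflexivity.
  - intros E; apply H0, Ceq; simpl; nra.
  - cbv beta; unfold Re, Im; rewrite <- !surjective_pairing; reflexivity.
Qed.

Lemma is_CInt_split f a b S :
  is_RInt (fun t => Re (f t)) a b (Re S) -> is_RInt (fun t => Im (f t)) a b (Im S) ->
  is_CInt f a b S.
Proof.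
  intros H1 H2; rewrite (surjective_pairing S).
  apply (is_RInt_fct_extend_pair (U := R_NormedModule) (V := R_NormedModule)); assumption.
Qed.

Lemma is_CInt_Re f a b S : is_CInt f a b S -> is_RInt (fun t => Re (f t)) a b (Re S).
Proof. exact (is_RInt_fct_extend_fst (U := R_NormedModule) (V := R_NormedModule) f a b S). Qed.

Lemma is_CInt_Im f a b S : is_CInt f a b S -> is_RInt (fun t => Im (f t)) a b (Im S).
Proof. exact (is_RInt_fct_extend_snd (U := R_NormedModule) (V := R_NormedModule) f a b S). Qed.

Lemma is_CInt_unique f a b S T : is_CInt f a b S -> is_CInt f a b T -> S = T.
Proof.
  intros H1 H2; rewrite <- (is_RInt_unique (V := C_R_CompleteNormedModule) _ _ _ _ H1).
  exact (is_RInt_unique (V := C_R_CompleteNormedModule) _ _ _ _ H2).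
Qed.

Lemma is_CInt_derive f df a b :
  a <= b -> (forall x, a <= x <= b -> cder f x (df x)) ->
  (forall x, a <= x <= b -> ccont df x) -> is_CInt df a b (f b - f a)%C.
Proof.
  intros Hab Hf Hc; apply is_CInt_split.
  - apply (is_RInt_derive (V := R_CompleteNormedModule) (fun t => Re (f t)));
      rewrite Rmin_left, Rmax_right; auto; intros x Hx; [apply Hf|apply Hc]; auto.
  - apply (is_RInt_derive (V := R_CompleteNormedModule) (fun t => Im (f t)));
      rewrite Rmin_left, Rmax_right; auto; intros x Hx; [apply Hf|apply Hc]; auto.
Qed.

Lemma is_CInt_plus f g a b S T : is_CInt f a b S -> is_CInt g a b T ->
  is_CInt (fun t => f t + g t)%C a b (S + T)%C.
Proof. apply (is_RInt_plus (V := C_R_NormedModule)). Qed.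

Lemma is_CInt_scal k f a b S : is_CInt f a b S ->
  is_CInt (fun t => k * f t)%C a b (k * S)%C.
Proof.
  intros H; assert (H1 := is_CInt_Re _ _ _ _ H); assert (H2 := is_CInt_Im _ _ _ _ H).
  apply is_CInt_split.
  - apply (is_RInt_ext (fun t => minus (Re k * Re (f t)) (Im k * Im (f t))));
      [reflexivity|].
    apply (is_RInt_minus (V := R_NormedModule)); apply (is_RInt_scal (V := R_NormedModule)); auto.
  - apply (is_RInt_ext (fun t => plus (Re k * Im (f t)) (Im k * Re (f t))));
      [reflexivity|].
    apply (is_RInt_plus (V := R_NormedModule)); apply (is_RInt_scal (V := R_NormedModule)); auto.
Qed.

Lemma is_CInt_ext f g a b S : a <= b -> (forall t, a < t < b -> f t = g t) ->
  is_CInt f a b S -> is_CInt g a b S.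
Proof.
  intros Hab E; apply (is_RInt_ext (V := C_R_NormedModule)).
  rewrite Rmin_left, Rmax_right; auto.
Qed.

Lemma is_CInt_const k a b : is_CInt (fun _ => k) a b ((b - a) * k)%C.
Proof.
  assert (H := is_RInt_const (V := C_R_NormedModule) a b k).
  replace ((b - a) * k)%C with (scal (b - a) (k : C_R_NormedModule)); auto.
  apply Ceq; unfold scal; simpl; unfold prod_scal, scal; simpl; unfold mult; simpl;
    unfold Re, Im; ring.
Qed.

Lemma Cmod_CInt_le f g a b S T : a <= b ->
  (forall t, a <= t <= b -> Cmod (f t) <= g t) ->
  is_CInt f a b S -> is_RInt g a b T -> Cmod S <= T.
Proof.
  intros Hab H H1 H2. rewrite Cmod_norm.
  refine (norm_RInt_le (V := C_R_NormedModule) f g a b S T Hab _ H1 H2).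
  intros x Hx; generalize (H x Hx); now rewrite Cmod_norm.
Qed.

Lemma ex_CInt_ccont f a b : a <= b -> (forall x, a <= x <= b -> ccont f x) ->
  exists S, is_CInt f a b S.
Proof.
  intros Hab H.
  destruct (ex_RInt_continuous (V := R_CompleteNormedModule) (fun t => Re (f t)) a b) as [x Hx].
  { rewrite Rmin_left, Rmax_right; auto; intros; now apply H. }
  destruct (ex_RInt_continuous (V := R_CompleteNormedModule) (fun t => Im (f t)) a b) as [y Hy].
  { rewrite Rmin_left, Rmax_right; auto; intros; now apply H. }
  exists (x, y); apply is_CInt_split; assumption.
Qed.

(** * Fourier coefficients of absolutely convergent expansions *)

Lemma Cmod_is_Csum_tail {I} (g : I -> C) s l0 e :
  is_Csum g s -> NoDup l0 ->
  (forall l, NoDup l -> (forall i, In i l -> ~ In i l0) ->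
     rsum (fun i => Cmod (g i)) l <= e) ->
  Cmod (lsum g l0 - s) <= e.
Proof.
  intros Hs N0 Ht; apply le_epsilon; intros eps He.
  destruct (Hs eps He) as [l1 H1].
  set (l2 := list_diff (dedup l1) l0).
  assert (D : forall i, In i l2 -> ~ In i l0) by (intros i; apply in_list_diff).
  assert (N2 : NoDup l2) by (apply NoDup_filter, NoDup_dedup).
  assert (H := H1 (merge_lists l0 (dedup l1))).
  change (merge_lists l0 (dedup l1)) with (l0 ++ l2) in H.
  replace (lsum g l0 - s)%C with ((lsum g (l0 ++ l2) - s) + - lsum g l2)%C
    by (rewrite lsum_app; ring).
  eapply Rle_trans; [apply Cmod_triangle|]; rewrite Cmod_opp.
  assert (Cmod (lsum g (l0 ++ l2) - s) < eps).
  { apply H; [apply NoDup_merge_lists; auto; apply NoDup_dedup|].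
    intros i Hi; apply (incl_merge_r l0 (dedup l1)), incl_dedup, Hi. }
  generalize (Cmod_lsum_le g l2) (Ht l2 N2 D); lra.
Qed.

Lemma is_CInt_lsum {I} (f : I -> R -> C) (J : I -> C) a b l :
  (forall i, In i l -> is_CInt (f i) a b (J i)) ->
  is_CInt (fun t => lsum (fun i => f i t) l) a b (lsum J l).
Proof.
  induction l as [|i l IH]; intros H.
  - replace (lsum J nil) with ((b - a) * RtoC 0)%C by (unfold lsum; simpl; ring).
    apply is_CInt_const.
  - apply is_CInt_plus; [apply H; now left|]. apply IH; intros; apply H; now right.
Qed.

(** The majorant [M] gives uniform convergence on [a, b], hence termwise integration. Integrability
    of [F] is part of the conclusion because [F] is known only as a sum. *)
Lemma is_CInt_is_Csum {I} (f : I -> R -> C) (F : R -> C) (M : I -> R) B (J : I -> C) a b :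
  a <= b ->
  (forall t, a <= t <= b -> is_Csum (fun i => f i t) (F t)) ->
  (forall i t, a <= t <= b -> Cmod (f i t) <= M i) ->
  summable_by M B ->
  (forall i, is_CInt (f i) a b (J i)) ->
  exists S, is_CInt F a b S /\ is_Csum J S.
Proof.
  intros Hab HF HM HB HJ.
  assert (M0 : forall i, 0 <= M i).
  { intros i; eapply Rle_trans; [apply Cmod_ge_0|apply (HM i a); lra]. }
  assert (T : forall eps, 0 < eps -> exists l0, NoDup l0 /\ forall l, NoDup l -> incl l0 l ->
    forall t, a <= t <= b -> Cmod (lsum (fun i => f i t) l - F t) <= eps).
  { intros eps He; destruct (summable_tail M B M0 HB eps He) as [l0 [N0 H0]].
    exists l0; split; auto. intros l Nl Il t Ht.
    apply Cmod_is_Csum_tail; auto. intros l' N' D'.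
    apply Rle_trans with (rsum M l'); [apply rsum_le; intros; now apply HM|].
    left; apply H0; auto. intros i Hi Hc; exact (D' i Hi (Il i Hc)). }
  (* The limit theorem for integrals is applied along a sequence, so the net is thinned to lists
     with error 1/(n+1). *)
  assert (Tn : forall n, exists l0, NoDup l0 /\ forall l, NoDup l -> incl l0 l ->
    forall t, a <= t <= b -> Cmod (lsum (fun i => f i t) l - F t) <= / (INR n + 1)).
  { intros n; apply T, Rinv_0_lt_compat; generalize (pos_INR n); lra. }
  set (ln := fun n => proj1_sig (constructive_indefinite_description _ (Tn n))).
  assert (Hln : forall n, NoDup (ln n) /\ forall l, NoDup l -> incl (ln n) l ->
    forall t, a <= t <= b -> Cmod (lsum (fun i => f i t) l - F t) <= / (INR n + 1)).
  { intros n; exact (proj2_sig (constructive_indefinite_description _ (Tn n))). }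
  (* Uniform convergence is demanded on all of R but holds on [a, b] only: the functions are cut off
     outside. *)
  set (ind := fun t => if Rle_dec a t then if Rle_dec t b then true else false else false).
  assert (ind1 : forall t, a <= t <= b -> ind t = true).
  { intros t Ht; unfold ind; destruct (Rle_dec a t), (Rle_dec t b); auto; lra. }
  assert (ind2 : forall t, ind t = true -> a <= t <= b).
  { intros t; unfold ind; destruct (Rle_dec a t), (Rle_dec t b); auto; discriminate. }
  destruct (filterlim_RInt (V := C_R_CompleteNormedModule)
    (fun (n : nat) (t : R) => if ind t then lsum (fun i => f i t) (ln n) else RtoC 0)
    a b eventually eventually_filter
    (fun t => if ind t then F t else RtoC 0)
    (fun n => lsum J (ln n))) as [S [_ HS]].
  { intros n. apply (is_CInt_ext (fun t => lsum (fun i => f i t) (ln n))); auto.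
    - intros t Ht; rewrite ind1; auto; lra.
    - apply is_CInt_lsum; auto. }
  { intros P [eps HP]. destruct (archimed_cor1 eps (cond_pos eps)) as [N [HN N0]].
    exists N; intros n Hn. apply HP; intros t. apply (norm_compat1 (V := C_R_NormedModule)).
    assert (En : / (INR n + 1) < eps).
    { eapply Rle_lt_trans; [|exact HN]. apply Rinv_le_contravar; [apply lt_0_INR, N0|].
      apply le_INR in Hn; lra. }
    rewrite <- Cmod_norm; destruct (ind t) eqn:E.
    - eapply Rle_lt_trans; [|exact En].
      apply (proj2 (Hln n) (ln n)); [apply Hln|apply incl_refl|auto].
    - change (Cmod (0 - 0)%C < eps). replace (0 - 0)%C with (RtoC 0) by ring.
      rewrite Cmod_0; apply cond_pos. }
  assert (HF' : is_CInt F a b S).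
  { revert HS; apply is_CInt_ext; auto. intros t Ht; rewrite ind1; auto; lra. }
  exists S; split; auto.
  intros eps He. destruct (T (eps / (b - a + 1))) as [l0 [N0 H0]].
  { apply Rdiv_lt_0_compat; lra. }
  exists l0; intros l Nl Il.
  assert (Cmod (lsum J l - S) <= (b - a) * (eps / (b - a + 1))).
  { apply (Cmod_CInt_le (fun t => lsum (fun i => f i t) l + (-1) * F t)%C
             (fun _ => eps / (b - a + 1)) a b); auto.
    - intros t Ht; replace (lsum (fun i => f i t) l + -1 * F t)%C
        with (lsum (fun i => f i t) l - F t)%C by ring. now apply H0.
    - replace (lsum J l - S)%C with (lsum J l + (-1) * S)%C by ring.
      apply is_CInt_plus; [apply is_CInt_lsum; auto|now apply is_CInt_scal].
    - apply (is_RInt_const (V := R_NormedModule)). }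
  eapply Rle_lt_trans; [exact H|]. unfold Rdiv.
  apply Rmult_lt_reg_r with (b - a + 1); [lra|].
  replace ((b - a) * (eps * / (b - a + 1)) * (b - a + 1)) with ((b - a) * eps)
    by (field; lra). nra.
Qed.

Lemma cder_linear (k : C) x : cder (fun t => k * RtoC t)%C x k.
Proof.
  eapply cder_eq; [apply cder_scal, (cder_R (fun t => t)), (is_derive_id (K := R_AbsRing))|].
  unfold one; simpl; ring.
Qed.

Lemma cder_e2pi f x l : cder f x l ->
  cder (fun t => e2pi (f t)) x (RtoC 2 * PI * Ci * l * e2pi (f x))%C.
Proof. intros H; unfold e2pi; apply cder_Cexp, cder_scal, H. Qed.

Lemma two_pi_i_neq_0 : (RtoC 2 * PI * Ci)%C <> RtoC 0.
Proof.
  intros E; apply (f_equal Im) in E; simpl in E; generalize PI_RGT_0; lra.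
Qed.

Lemma is_CInt_character (k : Z) x0 :
  is_CInt (fun t => e2pi (RtoC (IZR k * t))) x0 (x0 + 1)
    (if Z.eq_dec k 0 then RtoC 1 else RtoC 0).
Proof.
  destruct (Z.eq_dec k 0) as [->|Hk].
  - apply (is_CInt_ext (fun _ => RtoC 1)); [lra| |].
    + intros t _; rewrite Rmult_0_l; symmetry; apply e2pi_0.
    + assert (Hc := is_CInt_const (RtoC 1) x0 (x0 + 1)).
      replace ((RtoC (x0 + 1) - RtoC x0) * RtoC 1)%C with (RtoC 1) in Hc
        by (rewrite RtoC_plus; ring). exact Hc.
  - assert (Hk' : RtoC (IZR k) <> RtoC 0).
    { intros E; apply RtoC_inj in E; apply Hk, eq_IZR, E. }
    assert (D : forall x, cder (fun t => / (RtoC 2 * PI * Ci * IZR k) * e2pi (RtoC (IZR k * t)))%C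
                 x (e2pi (RtoC (IZR k * x)))).
    { intros x; eapply cder_eq.
      - apply cder_scal, cder_e2pi.
        eapply cder_ext; [intros t; symmetry; apply RtoC_mult|]. apply cder_linear.
      - cbv beta; field; repeat split; auto;
          (intros E; apply two_pi_i_neq_0; rewrite E; ring). }
    replace (RtoC 0) with (/ (RtoC 2 * PI * Ci * IZR k) * e2pi (RtoC (IZR k * (x0 + 1))) -
      / (RtoC 2 * PI * Ci * IZR k) * e2pi (RtoC (IZR k * x0)))%C.
    + apply (is_CInt_derive (fun t => / (RtoC 2 * PI * Ci * IZR k) * e2pi (RtoC (IZR k * t)))%C);
        [lra|intros; apply D|].
      intros x _; eapply cder_ccont, cder_e2pi.
      eapply cder_ext; [intros t; symmetry; apply RtoC_mult|]. apply cder_linear.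
    + rewrite Rmult_plus_distr_l, Rmult_1_r, RtoC_plus, e2pi_add_Z; ring.
Qed.

(** [k] may repeat values, so the coefficient comes out as the sum of all terms of frequency [rho].
    Characters have modulus 1, whence absolute convergence at the single point [x0] majorises the
    whole period. *)
Lemma fourier_extraction {I} (a : I -> C) (k : I -> Z) F x0 rho :
  (forall t, x0 <= t <= x0 + 1 -> is_Csum (fun i => a i * e2pi (RtoC (IZR (k i) * t)))%C (F t)) ->
  exists S, is_CInt (fun t => F t * e2pi (RtoC (- (IZR rho * t))))%C x0 (x0 + 1) S /\
    is_Csum (fun i => if Z.eq_dec (k i) rho then a i else RtoC 0) S.
Proof.
  intros H.
  assert (Hm : forall i t, Cmod (a i * e2pi (RtoC (IZR (k i) * t))) = Cmod (a i)).
  { intros; rewrite Cmod_mult, Cmod_e2pi_R; ring. }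
  assert (E : forall i t, ((e2pi (RtoC (- (IZR rho * t))) * (a i * e2pi (RtoC (IZR (k i) * t)))) =
                           a i * e2pi (RtoC (IZR (k i - rho) * t)))%C).
  { intros i t. rewrite minus_IZR.
    replace (RtoC ((IZR (k i) - IZR rho) * t))
      with (RtoC (- (IZR rho * t)) + RtoC (IZR (k i) * t))%C
      by (rewrite <- RtoC_plus; f_equal; ring).
    rewrite e2pi_plus; ring. }
  destruct (is_Csum_abs _ _ (H x0 ltac:(lra))) as [B HB].
  destruct (is_CInt_is_Csum (fun i t => a i * e2pi (RtoC (IZR (k i - rho) * t)))%C
    (fun t => F t * e2pi (RtoC (- (IZR rho * t))))%C (fun i => Cmod (a i)) B
    (fun i => if Z.eq_dec (k i) rho then a i else RtoC 0) x0 (x0 + 1)) as [S HS].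
  - lra.
  - intros t Ht. rewrite Cmult_comm.
    eapply is_Csum_ext; [|apply is_Csum_scal, (H t Ht)]. intros i; apply E.
  - intros; rewrite Cmod_mult, Cmod_e2pi_R; lra.
  - eapply summable_le; [|exact HB]; intros i; simpl; rewrite Hm; lra.
  - intros i. replace (if Z.eq_dec (k i) rho then a i else RtoC 0)
      with (a i * (if Z.eq_dec (k i - rho) 0 then RtoC 1 else RtoC 0))%C.
    + apply is_CInt_scal, is_CInt_character.
    + destruct (Z.eq_dec (k i) rho), (Z.eq_dec (k i - rho) 0); try lia; ring.
  - now exists S.
Qed.

(** * The primitive of exp(z^2) *)

Lemma is_derive_eps (f : R -> R) x l :
  is_derive f x l <-> forall eps, 0 < eps -> exists d, 0 < d /\
    forall h, Rabs h < d -> Rabs (f (x + h) - f x - h * l) <= eps * Rabs h.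
Proof.
  rewrite is_derive_Reals; split.
  - intros H eps He; destruct (H eps He) as [d Hd]; exists d; split; [apply cond_pos|].
    intros h Hh; destruct (Req_dec h 0) as [->|H0].
    + rewrite Rplus_0_r; replace (f x - f x - 0 * l) with 0 by ring.
      rewrite Rabs_R0; lra.
    + specialize (Hd h H0 Hh).
      replace (f (x + h) - f x - h * l) with (((f (x + h) - f x) / h - l) * h)
        by (field; auto).
      rewrite Rabs_mult; apply Rmult_le_compat_r; [apply Rabs_pos|lra].
  - intros H eps He; destruct (H (eps / 2)) as [d [Hd Hh]]; [lra|].
    exists (mkposreal d Hd); intros h H0 Hhd; simpl in Hhd; specialize (Hh h Hhd).
    replace ((f (x + h) - f x) / h - l) with ((f (x + h) - f x - h * l) / h)
      by (field; auto).
    unfold Rdiv at 1; rewrite Rabs_mult, Rabs_inv.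
    assert (0 < Rabs h) by now apply Rabs_pos_lt.
    apply Rmult_lt_reg_r with (Rabs h); auto.
    rewrite Rmult_assoc, Rinv_l; nra.
Qed.

Lemma cder_eps (f : R -> C) x l :
  cder f x l <-> forall eps, 0 < eps -> exists d, 0 < d /\
    forall h, Rabs h < d -> Cmod (f (x + h)%R - f x - h * l)%C <= eps * Rabs h.
Proof.
  unfold cder; rewrite !is_derive_eps; split.
  - intros [H1 H2] eps He.
    destruct (H1 (eps / 2)) as [d1 [D1 E1]]; [lra|].
    destruct (H2 (eps / 2)) as [d2 [D2 E2]]; [lra|].
    exists (Rmin d1 d2); split; [now apply Rmin_pos|]; intros h Hh.
    eapply Rle_trans; [apply Cmod_le_Re_Im|].
    assert (h1 := E1 h ltac:(generalize (Rmin_l d1 d2); lra)).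
    assert (h2 := E2 h ltac:(generalize (Rmin_r d1 d2); lra)).
    unfold Cminus; rewrite !Re_plus, !Im_plus, !Re_opp, !Im_opp, Re_scal, Im_scal.
    unfold Rminus in h1, h2; lra.
  - intros H; split; intros eps He; destruct (H eps He) as [d [D E]]; exists d;
      (split; [exact D|]); intros h Hh; eapply Rle_trans; [|apply (E h Hh)| |apply (E h Hh)].
    + eapply Rle_trans; [|apply abs_Re_le]; right; f_equal.
      unfold Cminus; rewrite !Re_plus, !Re_opp, Re_scal; ring.
    + eapply Rle_trans; [|apply abs_Im_le]; right; f_equal.
      unfold Cminus; rewrite !Im_plus, !Im_opp, Im_scal; ring.
Qed.

(** Complex differentiability with a quadratic remainder: easily read off an integral formula, and
    enough for the chain rule along real curves. *)
Definition quad_derivative (f : C -> C) (z l : C) : Prop :=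
  exists K, 0 <= K /\ forall h : C, Cmod h <= 1 ->
    Cmod (f (z + h) - f z - h * l)%C <= K * (Cmod h * Cmod h).

Lemma cder_quad_derivative f g x l lg : quad_derivative f (g x) l -> cder g x lg ->
  cder (fun t => f (g t)) x (lg * l)%C.
Proof.
  intros [K [K0 HK]] Hg; rewrite cder_eps in *; intros eps He.
  set (A := Cmod lg + 1). assert (A1 : 1 <= A) by (unfold A; generalize (Cmod_ge_0 lg); lra).
  destruct (Hg 1) as [d1 [D1 E1]]; [lra|].
  set (e2 := eps / (2 * (Cmod l + 1))).
  assert (L0 := Cmod_ge_0 l).
  assert (He2 : 0 < e2) by pos.
  destruct (Hg e2 He2) as [d2 [D2 E2]].
  (* [d3] makes the quadratic remainder at most half of [eps]; the bound [/ A] on [h] keeps the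
     increment of [g] in the unit disc, where that remainder is valid. *)
  set (d3 := eps / (2 * (K + 1) * (A * A))).
  assert (D3 : 0 < d3) by pos.
  assert (D4 : 0 < / A) by pos.
  exists (Rmin (Rmin d1 d2) (Rmin d3 (/ A))); split; [repeat apply Rmin_pos; auto|].
  intros h Hh.
  assert (Hh1 : Rabs h < d1) by (eapply Rlt_le_trans; [exact Hh|];
    eapply Rle_trans; [apply Rmin_l|apply Rmin_l]).
  assert (Hh2 : Rabs h < d2) by (eapply Rlt_le_trans; [exact Hh|];
    eapply Rle_trans; [apply Rmin_l|apply Rmin_r]).
  assert (Hh3 : Rabs h < d3) by (eapply Rlt_le_trans; [exact Hh|];
    eapply Rle_trans; [apply Rmin_r|apply Rmin_l]).
  assert (Hh4 : Rabs h < / A) by (eapply Rlt_le_trans; [exact Hh|];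
    eapply Rle_trans; [apply Rmin_r|apply Rmin_r]).
  specialize (E1 h Hh1); specialize (E2 h Hh2).
  set (D := (g (x + h)%R - g x)%C).
  assert (HD : Cmod D <= A * Rabs h).
  { replace D with ((D - h * lg) + h * lg)%C by ring.
    eapply Rle_trans; [apply Cmod_triangle|]. rewrite Cmod_mult, Cmod_R.
    unfold A; unfold D; lra. }
  assert (Hp := Rabs_pos h).
  assert (HA : A * / A = 1) by (apply Rinv_r; lra).
  assert (HD1 : Cmod D <= 1) by nra.
  specialize (HK D HD1).
  replace (g x + D)%C with (g (x + h)%R) in HK by (unfold D; ring).
  replace (f (g (x + h)%R) - f (g x) - h * (lg * l))%C
    with ((f (g (x + h)%R) - f (g x) - D * l) + (D - h * lg) * l)%C by ring.
  eapply Rle_trans; [apply Cmod_triangle|]. rewrite Cmod_mult.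
  assert (T1 : K * (Cmod D * Cmod D) <= eps / 2 * Rabs h).
  { assert (Cmod D * Cmod D <= (A * Rabs h) * (A * Rabs h))
      by (apply Rmult_le_compat; auto using Cmod_ge_0).
    assert (E3 : d3 * ((K + 1) * (A * A)) = eps / 2).
    { unfold d3; field; split; [|lra]; lra. }
    assert (0 < (K + 1) * (A * A)) by nra.
    apply Rle_trans with (K * ((A * Rabs h) * (A * Rabs h))); [now apply Rmult_le_compat_l|].
    replace (K * (A * Rabs h * (A * Rabs h))) with ((Rabs h * (K * (A * A))) * Rabs h) by ring.
    apply Rmult_le_compat_r; auto. rewrite <- E3.
    apply Rle_trans with (Rabs h * ((K + 1) * (A * A))); [apply Rmult_le_compat_l; nra|].
    apply Rmult_le_compat_r; lra. }
  assert (T2 : Cmod (D - h * lg) * Cmod l <= eps / 2 * Rabs h).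
  { change (Cmod (D - h * lg) <= e2 * Rabs h) in E2.
    assert (E3 : e2 * (Cmod l + 1) = eps / 2) by (unfold e2; field; lra).
    rewrite <- E3. apply Rle_trans with (e2 * Rabs h * Cmod l).
    - apply Rmult_le_compat_r; auto.
    - nra. }
  lra.
Qed.

Lemma exp_le x y : x <= y -> exp x <= exp y.
Proof. intros [H| ->]; [left; now apply exp_increasing|right; reflexivity]. Qed.

Lemma Cmod_Cexp_le (z : C) : Cmod (Cexp z) <= exp (Cmod z).
Proof.
  rewrite Cmod_Cexp; apply exp_le. eapply Rle_trans; [apply Rle_abs|apply abs_Re_le].
Qed.

Lemma is_CInt_Cexp (z : C) : is_CInt (fun t => z * Cexp (t * z))%C 0 1 (Cexp z - 1)%C.
Proof.
  assert (D : forall x, cder (fun t => Cexp (t * z))%C x (z * Cexp (x * z))%C).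
  { intros x; apply cder_Cexp. eapply cder_ext; [|apply (cder_linear z)].
    intros; cbv beta; ring. }
  assert (H := is_CInt_derive (fun t => Cexp (t * z)) (fun t => z * Cexp (t * z))%C 0 1).
  cbv beta in H; rewrite Cmult_1_l, Cmult_0_l, Cexp_0 in H. apply H; [lra|auto|].
  intros x _; eapply cder_ccont, cder_scal, D.
Qed.

Lemma is_RInt_const_01 (K : R) : is_RInt (fun _ : R => K) 0 1 K.
Proof.
  evar_last; [apply (is_RInt_const (V := R_NormedModule))|].
  unfold scal; simpl; unfold mult; simpl; eqR; ring.
Qed.

Lemma Cexp_minus_1 (z : C) : Cmod (Cexp z - 1) <= Cmod z * exp (Cmod z).
Proof.
  apply (Cmod_CInt_le (fun t => z * Cexp (t * z))%C (fun _ => Cmod z * exp (Cmod z)) 0 1).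
  - lra.
  - intros t Ht; rewrite Cmod_mult; apply Rmult_le_compat_l; [apply Cmod_ge_0|].
    eapply Rle_trans; [apply Cmod_Cexp_le|]; apply exp_le.
    rewrite Cmod_mult, Cmod_R, Rabs_right; [|lra]. generalize (Cmod_ge_0 z); nra.
  - apply is_CInt_Cexp.
  - apply is_RInt_const_01.
Qed.

Lemma Cexp_taylor (z : C) : Cmod (Cexp z - 1 - z)%C <= Cmod z * Cmod z * exp (Cmod z).
Proof.
  apply (Cmod_CInt_le (fun t => z * Cexp (t * z) + - z)%C
           (fun _ => Cmod z * Cmod z * exp (Cmod z)) 0 1).
  - lra.
  - intros t Ht; replace (z * Cexp (t * z) + - z)%C with (z * (Cexp (t * z) - 1))%C by ring.
    rewrite Cmod_mult, Rmult_assoc; apply Rmult_le_compat_l; [apply Cmod_ge_0|].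
    assert (Cmod (t * z)%C <= Cmod z).
    { rewrite Cmod_mult, Cmod_R, Rabs_right; [|lra]. generalize (Cmod_ge_0 z); nra. }
    eapply Rle_trans; [apply Cexp_minus_1|].
    apply Rmult_le_compat; auto using Cmod_ge_0; [left; apply exp_pos|now apply exp_le].
  - replace (Cexp z - 1 - z)%C with ((Cexp z - 1) + (RtoC 1 - RtoC 0) * - z)%C by ring.
    apply is_CInt_plus; [apply is_CInt_Cexp|apply is_CInt_const].
  - apply is_RInt_const_01.
Qed.

(* The entire primitive of exp(z^2) vanishing at 0. *)
Definition Cerf (z : C) : C :=
  (z * RInt (V := C_R_CompleteNormedModule) (fun t : R => Cexp ((t * t)%R * (z * z))) 0 1)%C.

Lemma cder_Cexp_sqr z x :
  cder (fun t : R => Cexp ((t * t)%R * (z * z)))%C x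
    ((2 * x)%R * (z * z) * Cexp ((x * x)%R * (z * z)))%C.
Proof.
  apply (cder_Cexp (fun t : R => (t * t)%R * (z * z))%C).
  eapply cder_eq.
  - apply cder_mult; [|apply cder_const].
    apply (cder_R (fun t => t * t)). auto_derive; [exact I|reflexivity].
  - cbv beta. replace (RtoC (2 * x)) with (RtoC (1 * x + x * 1)) by (f_equal; ring). ring.
Qed.

Lemma is_CInt_Cerf z :
  is_CInt (fun t : R => z * Cexp ((t * t)%R * (z * z)))%C 0 1 (Cerf z).
Proof.
  apply is_CInt_scal. apply (RInt_correct (V := C_R_CompleteNormedModule)).
  destruct (ex_CInt_ccont (fun t : R => Cexp ((t * t)%R * (z * z))%C) 0 1) as [S HS].
  - lra.
  - intros; eapply cder_ccont, cder_Cexp_sqr.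
  - now exists S.
Qed.

(** exp(z^2) is itself the integral over [0,1] of the t-derivative of t exp(t^2 z^2), called [dF].
    The remainder is thus a single integral, with integrand exp(t^2 z^2) times (z+h)(exp p - 1 - p)
    + t^2 (3z+h) h^2 where p = t^2 (2zh + h^2), visibly quadratic in h. *)
Lemma quad_derivative_Cerf z : quad_derivative Cerf z (Cexp (z * z)).
Proof.
  set (a := Cmod z). assert (Ha : 0 <= a) by pos.
  set (K := (a + 1) * ((2 * a + 1) * (2 * a + 1) * exp (2 * a + 1)) + (3 * a + 1)).
  assert (X1 := exp_pos (a * a)). assert (X2 := exp_pos (2 * a + 1)).
  assert (K0 : 0 <= K).
  { apply Rplus_le_le_0_compat; [|lra]. repeat apply Rmult_le_pos; lra. }
  exists (exp (a * a) * K); split; [apply Rmult_le_pos; lra|].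
  intros h Hh. set (b := Cmod h) in *. assert (Hb : 0 <= b) by pos.
  set (dF := fun t : R => (Cexp ((t * t)%R * (z * z)) * (1 + RtoC 2 * (t * t)%R * (z * z)))%C).
  assert (HI : is_CInt dF 0 1 (Cexp (z * z))).
  { assert (D : forall x, cder (fun t : R => (t * Cexp ((t * t)%R * (z * z)))%C) x (dF x)).
    { intros x; eapply cder_eq.
      - apply cder_mult; [apply (cder_R (fun t => t)), (is_derive_id (K := R_AbsRing))|].
        apply cder_Cexp_sqr.
      - unfold dF, one; simpl. rewrite !RtoC_mult; ring. }
    assert (H := is_CInt_derive (fun t : R => (t * Cexp ((t * t)%R * (z * z)))%C) dF 0 1).
    cbv beta in H.
    replace (1 * Cexp ((1 * 1)%R * (z * z)) - 0 * Cexp ((0 * 0)%R * (z * z)))%C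
      with (Cexp (z * z)) in H by (rewrite Rmult_1_l, !Cmult_1_l; ring).
    apply H; [lra|auto|]. intros x _; eapply cder_ccont.
    unfold dF; apply cder_mult; [apply cder_Cexp_sqr|].
    apply cder_plus; [apply cder_const|]. apply cder_mult; [|apply cder_const].
    apply cder_scal, (cder_R (fun t => t * t)). auto_derive; [exact I|reflexivity]. }
  apply (Cmod_CInt_le (fun t : R => ((z + h) * Cexp ((t * t)%R * ((z + h) * (z + h)))
      + (-1) * (z * Cexp ((t * t)%R * (z * z)))) + - h * dF t)%C
      (fun _ => exp (a * a) * K * (b * b)) 0 1).
  - lra.
  - intros t Ht.
    set (p := ((t * t)%R * (RtoC 2 * z * h + h * h))%C).
    replace ((t * t)%R * ((z + h) * (z + h)))%C with ((t * t)%R * (z * z) + p)%C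
      by (unfold p; ring).
    rewrite Cexp_plus.
    replace ((z + h) * (Cexp ((t * t)%R * (z * z)) * Cexp p)
      + -1 * (z * Cexp ((t * t)%R * (z * z))) + - h * dF t)%C
      with (Cexp ((t * t)%R * (z * z)) * ((z + h) * (Cexp p - 1 - p) +
        (t * t)%R * (RtoC 3 * z + h) * (h * h)))%C by (unfold dF, p; ring).
    assert (Ht2 : 0 <= t * t <= 1) by nra.
    assert (Hc : Cmod (RtoC (t * t)) = t * t) by (rewrite Cmod_R, Rabs_right; lra).
    assert (Hp : Cmod p <= (2 * a + 1) * b).
    { unfold p; replace (RtoC 2 * z * h + h * h)%C with ((RtoC 2 * z + h) * h)%C by ring.
      rewrite !Cmod_mult, Hc. fold b.
      assert (Cmod (RtoC 2 * z + h) <= 2 * a + 1).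
      { eapply Rle_trans; [apply Cmod_triangle|]. rewrite Cmod_mult, Cmod_R, Rabs_right by lra.
        fold a b; lra. }
      assert (0 <= Cmod (RtoC 2 * z + h)%C) by pos.
      assert (0 <= Cmod (RtoC 2 * z + h)%C * b) by pos.
      nra. }
    assert (Hp0 := Cmod_ge_0 p).
    assert (HR : Cmod (Cexp p - 1 - p) <= (2 * a + 1) * (2 * a + 1) * exp (2 * a + 1) * (b * b)).
    { eapply Rle_trans; [apply Cexp_taylor|].
      replace ((2 * a + 1) * (2 * a + 1) * exp (2 * a + 1) * (b * b))
        with (((2 * a + 1) * b) * ((2 * a + 1) * b) * exp (2 * a + 1)) by ring.
      apply Rmult_le_compat; [nra|left; apply exp_pos|apply Rmult_le_compat; auto|].
      apply exp_le; nra. }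
    rewrite Cmod_mult, Rmult_assoc. apply Rmult_le_compat; auto using Cmod_ge_0.
    + eapply Rle_trans; [apply Cmod_Cexp_le|]; apply exp_le.
      rewrite !Cmod_mult, Hc; fold a; nra.
    + eapply Rle_trans; [apply Cmod_triangle|].
      unfold K; rewrite Rmult_plus_distr_r; apply Rplus_le_compat.
      * rewrite Cmod_mult, Rmult_assoc; apply Rmult_le_compat; auto using Cmod_ge_0.
        eapply Rle_trans; [apply Cmod_triangle|]; fold a b; lra.
      * rewrite !Cmod_mult, Hc; fold b.
        apply Rmult_le_compat_r; [nra|].
        assert (Cmod (RtoC 3 * z + h)%C <= 3 * a + 1).
        { eapply Rle_trans; [apply Cmod_triangle|]. rewrite Cmod_mult, Cmod_R, Rabs_right by lra.
          fold a b; lra. }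
        generalize (Cmod_ge_0 (RtoC 3 * z + h)%C); nra.
  - replace (Cerf (z + h) - Cerf z - h * Cexp (z * z))%C
      with ((Cerf (z + h) + (-1) * Cerf z) + - h * Cexp (z * z))%C by ring.
    apply is_CInt_plus; [apply is_CInt_plus|]; [|apply is_CInt_scal|apply is_CInt_scal, HI];
      apply is_CInt_Cerf.
  - apply is_RInt_const_01.
Qed.

Lemma cder_Cerf f x l : cder f x l ->
  cder (fun t => Cerf (f t)) x (l * Cexp (f x * f x))%C.
Proof. apply cder_quad_derivative, quad_derivative_Cerf. Qed.

Lemma Cerf_opp z : Cerf (- z) = (- Cerf z)%C.
Proof.
  unfold Cerf. replace (- z * - z)%C with (z * z)%C by ring. ring.
Qed.

(** The integral of exp(-s^2) for s from 0 to y, up to normalisation the error function. *)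
Definition real_erf (y : R) : R := Im (Cerf (Ci * y)).

Lemma Ci_sqr (y : R) : ((Ci * y) * (Ci * y))%C = RtoC (- (y * y)).
Proof. apply Ceq; simpl; ring. Qed.

Lemma is_RInt_real_erf y : is_RInt (fun t => y * exp (- (t * t * (y * y)))) 0 1 (real_erf y).
Proof.
  generalize (is_CInt_Im _ _ _ _ (is_CInt_Cerf (Ci * y))).
  apply is_RInt_ext; intros t _.
  rewrite Ci_sqr, <- RtoC_mult, Cexp_R, Im_mult; simpl.
  replace (t * t * - (y * y)) with (- (t * t * (y * y))) by ring. ring.
Qed.

Lemma Re_Cerf_Ci (y : R) : Re (Cerf (Ci * y)) = 0.
Proof.
  assert (H := is_CInt_Re _ _ _ _ (is_CInt_Cerf (Ci * y))).
  assert (H0 : is_RInt (fun _ => 0) 0 1 0).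
  { apply is_RInt_const_01. }
  rewrite <- (is_RInt_unique _ _ _ _ H). apply is_RInt_unique.
  revert H0; apply is_RInt_ext; intros t _.
  cbv beta; rewrite Ci_sqr, <- RtoC_mult, Cexp_R, Re_mult; simpl; ring.
Qed.

Lemma is_derive_real_erf y : is_derive real_erf y (exp (- (y * y))).
Proof.
  assert (H := cder_Cerf (fun t => Ci * t)%C y Ci (cder_linear Ci y)).
  destruct H as [_ H]. rewrite Ci_sqr, Cexp_R in H.
  replace (exp (- (y * y))) with (Im (Ci * RtoC (exp (- (y * y))))) by (simpl; ring).
  exact H.
Qed.

(** The auxiliary kernel of the classical evaluation of the Gaussian integral: the y-derivative of
    its integral over t cancels that of the square of [real_erf], and at y = 0 that integral is
    arctan 1 = pi/4. *)
Definition erf_kernel (y t : R) : R := exp (- (y * y * (1 + t * t))) / (1 + t * t).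

Lemma is_derive_erf_kernel y t :
  is_derive (fun u => erf_kernel u t) y (- (2 * y) * exp (- (y * y * (1 + t * t)))).
Proof.
  unfold erf_kernel; auto_derive; [nra|]. field; nra.
Qed.

Lemma ex_RInt_erf_kernel y : ex_RInt (erf_kernel y) 0 1.
Proof.
  apply (ex_RInt_continuous (V := R_CompleteNormedModule)); intros t _.
  apply (ex_derive_continuous (K := R_AbsRing) (V := R_NormedModule)).
  unfold erf_kernel; auto_derive; nra.
Qed.

Lemma is_derive_RInt_erf_kernel y :
  is_derive (fun y => RInt (erf_kernel y) 0 1) y (- (2 * exp (- (y * y)) * real_erf y)).
Proof.
  evar_last.
  - apply (is_derive_RInt_param erf_kernel 0 1 y).
    + exists (mkposreal 1 Rlt_0_1); intros u _ t _; eexists; apply is_derive_erf_kernel.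
    + intros t _.
      apply continuity_2d_pt_ext with (fun u v => - (2 * u) * exp (- (u * u * (1 + v * v)))).
      { intros u v; symmetry; apply is_derive_unique, is_derive_erf_kernel. }
      apply continuity_2d_pt_mult.
      * apply continuity_2d_pt_opp, continuity_2d_pt_mult;
          [apply continuity_2d_pt_const|apply continuity_2d_pt_id1].
      * apply (continuity_1d_2d_pt_comp exp (fun u v => - (u * u * (1 + v * v)))).
        { apply derivable_continuous_pt, derivable_pt_exp. }
        apply continuity_2d_pt_opp, continuity_2d_pt_mult.
        -- apply continuity_2d_pt_mult; apply continuity_2d_pt_id1.
        -- apply continuity_2d_pt_plus; [apply continuity_2d_pt_const|].
           apply continuity_2d_pt_mult; apply continuity_2d_pt_id2.
    + exists (mkposreal 1 Rlt_0_1); intros u _; apply ex_RInt_erf_kernel.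
  - apply is_RInt_unique.
    assert (H := is_RInt_scal (V := R_NormedModule) _ 0 1 (- 2 * exp (- (y * y))) _ (is_RInt_real_erf y)).
    replace (- (2 * exp (- (y * y)) * real_erf y)) with (scal (- 2 * exp (- (y * y))) (real_erf y))
      by (unfold scal; simpl; unfold mult; simpl; eqR; ring).
    revert H; apply is_RInt_ext; intros t _.
    symmetry; eapply eq_trans; [apply is_derive_unique, is_derive_erf_kernel|].
    unfold scal; simpl; unfold mult; simpl; eqR.
    replace (- (y * y * (1 + t * t))) with (- (y * y) + - (t * t * (y * y))) by ring.
    rewrite exp_plus; ring.
Qed.

Lemma RInt_erf_kernel_0 : RInt (erf_kernel 0) 0 1 = PI / 4.
Proof.
  apply is_RInt_unique.
  replace (PI / 4) with (minus (atan 1) (atan 0))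
    by (rewrite atan_1, atan_0; unfold minus, plus, opp; simpl; eqR; ring).
  apply (is_RInt_ext (fun t => / (1 + t²))).
  { intros t _; unfold erf_kernel, Rsqr; rewrite !Rmult_0_l, Ropp_0, exp_0; unfold Rdiv; eqR; ring. }
  apply (is_RInt_derive (V := R_CompleteNormedModule)); intros t _.
  - rewrite Rsqr_pow2, is_derive_Reals; apply derivable_pt_lim_atan.
  - apply (ex_derive_continuous (K := R_AbsRing) (V := R_NormedModule)).
    unfold Rsqr; auto_derive; nra.
Qed.

Lemma is_derive_0_const (f : R -> R) x y :
  (forall t, is_derive f t 0) -> f x = f y.
Proof.
  intros H. destruct (MVT_gen f x y (fun _ => 0)) as [c [_ Hc]].
  - intros; apply H.
  - intros t _; apply continuity_pt_filterlim.
    apply (ex_derive_continuous (K := R_AbsRing) (V := R_NormedModule)); eexists; apply H.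
  - lra.
Qed.

Lemma real_erf_sqr y : real_erf y * real_erf y + RInt (erf_kernel y) 0 1 = PI / 4.
Proof.
  rewrite <- RInt_erf_kernel_0.
  replace (RInt (erf_kernel 0) 0 1) with (real_erf 0 * real_erf 0 + RInt (erf_kernel 0) 0 1).
  - apply (is_derive_0_const (fun y => real_erf y * real_erf y + RInt (erf_kernel y) 0 1)).
    intros t; evar_last.
    + apply (is_derive_plus (K := R_AbsRing) (V := R_NormedModule)).
      * apply Derive.is_derive_mult; apply is_derive_real_erf.
      * apply is_derive_RInt_erf_kernel.
    + unfold plus; simpl; eqR; ring.
  - unfold real_erf. rewrite Cmult_0_r; unfold Cerf. rewrite Cmult_0_l; simpl; ring.
Qed.

(** By [real_erf_sqr] the product of sqrt(pi)/2 - [real_erf y] and sqrt(pi)/2 + [real_erf y] is the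
    integral of the kernel, which is at most exp(-y^2), and the second factor is at least 1/2. *)
Lemma real_erf_bound y : 0 <= y -> Rabs (real_erf y - sqrt PI / 2) <= 2 * exp (- (y * y)).
Proof.
  intros Hy.
  assert (G0 : 0 <= real_erf y).
  { assert (H := is_RInt_real_erf y).
    rewrite <- (is_RInt_unique _ _ _ _ H); apply RInt_ge_0; [lra|eexists; exact H|].
    intros t _; apply Rmult_le_pos; [auto|left; apply exp_pos]. }
  assert (K1 : 0 <= RInt (erf_kernel y) 0 1).
  { apply RInt_ge_0; [lra|apply ex_RInt_erf_kernel|]. intros t _; unfold erf_kernel, Rdiv.
    apply Rmult_le_pos; [left; apply exp_pos|left; apply Rinv_0_lt_compat; nra]. }
  assert (K2 : RInt (erf_kernel y) 0 1 <= exp (- (y * y))).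
  { replace (exp (- (y * y))) with (RInt (fun _ => exp (- (y * y))) 0 1).
    - apply RInt_le; [lra|apply ex_RInt_erf_kernel|apply ex_RInt_const|].
      intros t Ht; unfold erf_kernel.
      assert (exp (- (y * y * (1 + t * t))) <= exp (- (y * y))) by (apply exp_le; nra).
      assert (0 < exp (- (y * y * (1 + t * t)))) by apply exp_pos.
      apply Rmult_le_reg_r with (1 + t * t); [nra|]. unfold Rdiv.
      rewrite Rmult_assoc, Rinv_l by nra. nra.
    - rewrite RInt_const; unfold scal; simpl; unfold mult; simpl; eqR; ring. }
  assert (S := real_erf_sqr y).
  assert (P := PI_RGT_0). assert (P2 := PI2_1).
  assert (Q0 : 1 <= sqrt PI).
  { rewrite <- sqrt_1; apply sqrt_le_1; lra. }
  assert (Q := sqrt_sqrt PI ltac:(lra)).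
  assert (E : (sqrt PI / 2 - real_erf y) * (sqrt PI / 2 + real_erf y) = RInt (erf_kernel y) 0 1) by nra.
  assert (D0 : 0 <= sqrt PI / 2 - real_erf y) by nra.
  rewrite Rabs_minus_sym, Rabs_right by lra.
  assert (HE := exp_pos (- (y * y))).
  assert (HQ : 2 <= 2 * sqrt PI) by lra.
  nra.
Qed.

(** The path goes up the imaginary axis to i Im z, where [real_erf_bound] applies, and then
    horizontally to z; on the second piece the real part of the square is largest at z itself. *)
Lemma Cerf_bound (z : C) : 0 <= Im z ->
  Cmod (Cerf z - Ci * (sqrt PI / 2)%R) <= (2 + Cmod z) * exp (Re (z * z)).
Proof.
  intros Hy. set (X := Re z); set (Y := Im z) in *.
  assert (Ez : z = (X + Ci * Y)%C) by (apply Ceq; unfold X, Y; simpl; unfold Re, Im; ring).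
  assert (Es : Re (z * z)%C = X * X - Y * Y) by (rewrite Re_mult; reflexivity).
  replace (Cerf z - Ci * (sqrt PI / 2)%R)%C
    with ((Cerf z - Cerf (Ci * Y)) + (Cerf (Ci * Y) - Ci * (sqrt PI / 2)%R))%C by ring.
  eapply Rle_trans; [apply Cmod_triangle|].
  rewrite Rplus_comm, Rmult_plus_distr_r; apply Rplus_le_compat.
  - replace (Cerf (Ci * Y) - Ci * (sqrt PI / 2)%R)%C
      with (Ci * RtoC (real_erf Y - sqrt PI / 2))%C.
    + rewrite Cmod_mult, Cmod_R.
      replace (Cmod Ci) with 1.
      * rewrite Rmult_1_l; eapply Rle_trans; [apply real_erf_bound, Hy|].
        apply Rmult_le_compat_l; [lra|]. apply exp_le; rewrite Es; nra.
      * unfold Cmod, Ci; simpl. rewrite <- sqrt_1 at 1; f_equal; ring.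
    + assert (H := Re_Cerf_Ci Y). apply Ceq.
      * unfold Cminus; rewrite Re_plus, H; simpl; ring.
      * unfold Cminus; rewrite Im_plus; fold (real_erf Y); simpl; ring.
  - assert (D : forall t, cder (fun t : R => Cerf (t * X + Ci * Y)) t
      (X * Cexp ((t * X + Ci * Y) * (t * X + Ci * Y)))%C).
    { intros t; apply cder_Cerf. eapply cder_eq.
      - apply cder_plus; [|apply cder_const]. apply cder_mult; [|apply cder_const].
        apply (cder_R (fun t => t)), (is_derive_id (K := R_AbsRing)).
      - unfold one; simpl; ring. }
    apply (Cmod_CInt_le (fun t : R => X * Cexp ((t * X + Ci * Y) * (t * X + Ci * Y)))%C
      (fun _ => Cmod z * exp (Re (z * z)%C)) 0 1).
    + lra.
    + intros t Ht; rewrite Cmod_mult, Cmod_Cexp, Cmod_R.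
      apply Rmult_le_compat; [apply Rabs_pos|left; apply exp_pos|apply abs_Re_le|].
      apply exp_le; rewrite Es, Re_mult; simpl.
      assert (0 <= (1 - t * t) * (X * X)) by (apply Rmult_le_pos; nra). nra.
    + replace (Cerf z - Cerf (Ci * Y))%C
        with (Cerf (RtoC 1 * X + Ci * Y) - Cerf (RtoC 0 * X + Ci * Y))%C
        by (rewrite Cmult_1_l, Cmult_0_l, Cplus_0_l, <- Ez; reflexivity).
      apply (is_CInt_derive (fun t : R => Cerf (t * X + Ci * Y))); [lra|auto|].
      intros x _; eapply cder_ccont. apply cder_scal, cder_Cexp, cder_mult;
      (apply cder_plus; [|apply cder_const]; apply cder_mult; [|apply cder_const];
        apply (cder_R (fun t => t)), (is_derive_id (K := R_AbsRing))).
    + apply is_RInt_const_01.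
Qed.

Lemma Cerf_bound_neg (z : C) : Im z <= 0 ->
  Cmod (Cerf z + Ci * (sqrt PI / 2)%R) <= (2 + Cmod z) * exp (Re (z * z)).
Proof.
  intros Hz. replace (Cerf z + Ci * (sqrt PI / 2)%R)%C
    with (- (Cerf (- z) - Ci * (sqrt PI / 2)%R))%C by (rewrite Cerf_opp; ring).
  rewrite Cmod_opp. replace (z * z)%C with (- z * - z)%C by ring.
  rewrite <- (Cmod_opp z). apply Cerf_bound. rewrite Im_opp; lra.
Qed.

(** * Farey fractions and sums over Z *)

Lemma half_le_sqrt v : 1 / 4 <= v -> 1 / 2 <= sqrt v.
Proof.
  intros H. replace (1 / 2) with (sqrt ((1 / 2) * (1 / 2))) by (apply sqrt_square; lra).
  apply sqrt_le_1; lra.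
Qed.

(** a/b and c/d are the neighbours of x in the Farey sequence of order [N]; passing to the next
    order inserts their mediant exactly when its denominator b + d equals that order. *)
Lemma farey (x : R) (N : nat) : (1 <= N)%nat -> exists a b c d : Z,
  (1 <= b <= Z.of_nat N /\ 1 <= d <= Z.of_nat N /\ Z.of_nat N < b + d /\ c * b - a * d = 1)%Z /\
  IZR a <= IZR b * x /\ IZR d * x <= IZR c.
Proof.
  induction N as [|N IH]; [lia|]; intros _.
  destruct N as [|N].
  - exists (up x - 1)%Z, 1%Z, (up x), 1%Z.
    destruct (archimed x) as [H1 H2]; rewrite minus_IZR; split; [lia|lra].
  - destruct (IH ltac:(lia)) as (a & b & c & d & (Hb & Hd & Hs & Hdet) & H1 & H2).
    destruct (Z.eq_dec (b + d) (Z.of_nat (S (S N)))) as [E|E].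
    + destruct (Rle_lt_dec (IZR (b + d) * x) (IZR (a + c))) as [H|H].
      * exists a, b, (a + c)%Z, (b + d)%Z; split; [split; [|split; [|split]]; nia|auto].
      * exists (a + c)%Z, (b + d)%Z, c, d; split; [split; [|split; [|split]]; nia|].
        split; [lra|auto].
    + exists a, b, c, d; split; [lia|auto].
Qed.

(** The neighbour on the same side of the mediant as x is taken: it is no farther from x than from
    the mediant, that is 1/(b(b+d)) or 1/(d(b+d)), and b + d >= N + 1. It supplies the lower row and
    the other neighbour the upper one. *)
Lemma dirichlet_SL2 (x : R) (N : nat) : (1 <= N)%nat -> exists A, SL2Z A /\
  (1 <= m21 A <= Z.of_nat N)%Z /\ Rabs (IZR (m21 A) * x + IZR (m22 A)) * (INR N + 1) <= 1.
Proof.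
  intros HN; destruct (farey x N HN) as (a & b & c & d & (Hb & Hd & Hs & Hdet) & H1 & H2).
  assert (Hdet' : IZR c * IZR b - IZR a * IZR d = 1)
    by (rewrite <- !mult_IZR, <- minus_IZR, Hdet; reflexivity).
  assert (Hb' : 1 <= IZR b) by (apply IZR_le; lia).
  assert (Hd' : 1 <= IZR d) by (apply IZR_le; lia).
  assert (Hs' : INR N + 1 <= IZR b + IZR d).
  { rewrite INR_IZR_INZ, <- plus_IZR, <- plus_IZR; apply IZR_le; lia. }
  assert (HN0 := pos_INR N).
  destruct (Rle_lt_dec ((IZR b + IZR d) * x) (IZR a + IZR c)) as [H|H].
  - exists (Mat2 d (- c) b (- a)); unfold SL2Z; simpl; split; [nia|split; [lia|]].
    rewrite opp_IZR, Rabs_right by lra.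
    (* b (b + d) x <= b (a + c) = a (b + d) + 1 *)
    nra.
  - exists (Mat2 (- b) a d (- c)); unfold SL2Z; simpl; split; [nia|split; [lia|]].
    rewrite opp_IZR, Rabs_left1 by lra.
    nra.
Qed.

(** The inequality says that Im (A tau) >= 1/2. With [N] the integer part of v^(-1/2), both |cx + d|
    and cv are at most sqrt v. *)
Lemma SL2_high (x v : R) : 0 < v <= 1 -> exists A, SL2Z A /\ (1 <= m21 A)%Z /\
  (IZR (m21 A) * x + IZR (m22 A)) ^ 2 + (IZR (m21 A) * v) ^ 2 <= 2 * v.
Proof.
  intros Hv.
  assert (S0 : 0 < sqrt v) by pos.
  assert (SS : sqrt v * sqrt v = v) by (apply sqrt_sqrt; lra).
  assert (S1 : sqrt v <= 1) by nra.
  assert (Hi : 1 <= / sqrt v) by (rewrite <- Rinv_1; apply Rinv_le_contravar; lra).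
  destruct (nfloor_ex (/ sqrt v)) as [N [N1 N2]]; [lra|].
  assert (HN : (1 <= N)%nat).
  { destruct N; [simpl in N2; lra|lia]. }
  destruct (dirichlet_SL2 x N HN) as [A [HA [[c1 c2] Hd]]].
  exists A; split; [exact HA|split; [exact c1|]].
  assert (Hr : sqrt v * / sqrt v = 1) by (apply Rinv_r; lra).
  set (y := IZR (m21 A) * x + IZR (m22 A)) in *.
  assert (Hy : Rabs y <= sqrt v) by pos.
  assert (Hy2 : y ^ 2 <= v).
  { rewrite <- pow2_abs. generalize (Rabs_pos y); nra. }
  assert (Hc : IZR (m21 A) * sqrt v <= 1).
  { apply IZR_le in c2; rewrite <- INR_IZR_INZ in c2.
    rewrite <- Hr, Rmult_comm; apply Rmult_le_compat_l; lra. }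
  assert (Hc0 : 1 <= IZR (m21 A)) by (apply IZR_le; exact c1).
  assert (IZR (m21 A) * v <= sqrt v) by pos.
  assert (0 <= IZR (m21 A) * v) by nra.
  nra.
Qed.

Definition zrange (a : Z) (n : nat) : list Z := map (fun i => (a + Z.of_nat i)%Z) (seq 0 n).

Lemma in_zrange a n k : In k (zrange a n) <-> (a <= k < a + Z.of_nat n)%Z.
Proof.
  unfold zrange; rewrite in_map_iff; split.
  - intros [i [<- Hi]]; apply in_seq in Hi; lia.
  - intros H; exists (Z.to_nat (k - a)); split; [lia|apply in_seq; lia].
Qed.

Lemma NoDup_zrange a n : NoDup (zrange a n).
Proof.
  apply Injective_map_NoDup; [intros i j E; lia|apply seq_NoDup].
Qed.

Lemma zrange_app a n p : zrange a (n + p) = zrange a n ++ zrange (a + Z.of_nat n) p.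
Proof.
  unfold zrange; rewrite seq_app, map_app; f_equal.
  rewrite <- (Nat.add_0_r n) at 1. simpl.
  rewrite Nat.add_comm. clear.
  assert (H : forall s q, map (fun i => (a + Z.of_nat i)%Z) (seq (s + n) q) =
                     map (fun i => (a + Z.of_nat n + Z.of_nat i)%Z) (seq s q)).
  { intros s q; revert s; induction q as [|q IH]; intros s; [reflexivity|].
    simpl; f_equal; [lia|apply (IH (S s))]. }
  exact (H 0%nat p).
Qed.

Lemma zrange_shift a n : zrange a n = map (fun l => (a + l)%Z) (zrange 0 n).
Proof. unfold zrange; rewrite map_map; apply map_ext; intros; lia. Qed.

Lemma residues_zrange M : residues M = zrange 0 (Z.to_nat M).
Proof. unfold residues, zrange; apply map_ext; intros; lia. Qed.

Lemma zlist_bounded (l : list Z) : exists N : nat, forall k, In k l -> (Z.abs k < Z.of_nat N)%Z.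
Proof.
  induction l as [|k l [N HN]]; [exists 0%nat; intros k []|].
  exists (N + S (Z.to_nat (Z.abs k)))%nat; intros j [<-|Hj]; [lia|].
  specialize (HN j Hj); lia.
Qed.

Lemma summable_by_zrange (f : Z -> R) B : (forall k, 0 <= f k) ->
  (forall a n, rsum f (zrange a n) <= B) -> summable_by f B.
Proof.
  intros H0 HB l Hl; destruct (zlist_bounded l) as [N HN].
  eapply Rle_trans; [|apply (HB (- Z.of_nat N)%Z (2 * N)%nat)].
  apply rsum_incl; auto. intros k Hk; apply in_zrange; specialize (HN k Hk); lia.
Qed.

Lemma is_Csum_zrange_lim (f : Z -> C) s L : (1 <= L)%nat -> is_Csum f s ->
  forall eps, 0 < eps -> exists N0, forall N, (N0 <= N)%nat ->
    Cmod (lsum f (zrange (- Z.of_nat (L * N)) (2 * (L * N))) - s) < eps.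
Proof.
  intros HL H eps He; destruct (H eps He) as [l0 H0].
  destruct (zlist_bounded l0) as [N0 HN0]; exists N0; intros N HN.
  apply H0; [apply NoDup_zrange|]. intros k Hk; apply in_zrange.
  specialize (HN0 k Hk). nia.
Qed.

Lemma rsum_telescope (Q : Z -> R) a n :
  rsum (fun k => Q (k - 1)%Z - Q k) (zrange a n) = Q (a - 1)%Z - Q (a + Z.of_nat n - 1)%Z.
Proof.
  induction n as [|n IH].
  - unfold rsum; simpl. rewrite Z.add_0_r; ring.
  - replace (S n) with (n + 1)%nat by lia. rewrite zrange_app, rsum_app, IH.
    unfold zrange at 1; simpl; rewrite rsum_cons; unfold rsum; simpl.
    rewrite Z.add_0_r. replace (a + Z.of_nat (n + 1) - 1)%Z with (a + Z.of_nat n)%Z by lia. ring.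
Qed.

(** A difference of step [L] is a sum of [L] differences of step 1, each telescoping to at most the
    oscillation [D], whatever the length [n]. *)
Lemma rsum_telescope_step (Q : Z -> R) D L a n :
  (forall i j, Q i - Q j <= D) ->
  rsum (fun k => Q (k - Z.of_nat L)%Z - Q k) (zrange a n) <= INR L * D.
Proof.
  intros HD; induction L as [|L IH].
  - rewrite (rsum_ext _ (fun k => 0 * Q k)).
    + rewrite rsum_scal; simpl; lra.
    + intros k _; simpl. rewrite Z.sub_0_r; ring.
  - rewrite (rsum_ext _ (fun k => (Q (k - 1 - Z.of_nat L)%Z - Q (k - Z.of_nat L)%Z) +
                                   (Q (k - Z.of_nat L)%Z - Q k))).
    + rewrite rsum_plus, S_INR, Rmult_plus_distr_r, Rmult_1_l, Rplus_comm.
      apply Rplus_le_compat; [exact IH|].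
      set (G := fun j => Q (j - Z.of_nat L)%Z).
      change (rsum (fun k => G (k - 1)%Z - G k) (zrange a n) <= D).
      rewrite rsum_telescope; apply HD.
    + intros k _. replace (k - Z.of_nat (S L))%Z with (k - 1 - Z.of_nat L)%Z by lia. ring.
Qed.

Lemma summable_inv_sqr : summable_by (fun k : Z => / (1 + IZR k * IZR k)) 8.
Proof.
  (* A bounded sequence whose decrements are of order 1/k^2: 1/(1+k^2) is at most 4 times the
     decrement at k, and the values lie in [-1, 1], whence 8 = 4 . 2. *)
  set (Q := fun k : Z => - (IZR k / (1 + Rabs (IZR k)))).
  assert (HQ : forall k, -1 <= Q k <= 1).
  { intros k; unfold Q; set (y := IZR k / (1 + Rabs (IZR k))).
    assert (A := Rabs_pos (IZR k)).
    assert (E : y * (1 + Rabs (IZR k)) = IZR k) by (unfold y; field; lra).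
    assert (B := Rle_abs (IZR k)). assert (B' := Rle_abs (- IZR k)).
    rewrite Rabs_Ropp in B'. split; nra. }
  apply summable_by_zrange.
  { intros k; left; apply Rinv_0_lt_compat; nra. }
  intros a n; apply Rle_trans with (rsum (fun k => 4 * (Q (k - 1)%Z - Q k)) (zrange a n)).
  - apply rsum_le; intros k _.
    apply Rmult_le_reg_l with (1 + IZR k * IZR k); [nra|]. rewrite Rinv_r by nra.
    unfold Q; rewrite minus_IZR.
    destruct (Z_le_gt_dec 1 k) as [H|H].
    + apply IZR_le in H. rewrite !Rabs_right by lra.
      replace (4 * (- ((IZR k - 1) / (1 + (IZR k - 1))) - - (IZR k / (1 + IZR k))))
        with (4 / (IZR k * (IZR k + 1))) by (field; lra).
      apply Rmult_le_reg_r with (IZR k * (IZR k + 1)); [nra|].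
      replace ((1 + IZR k * IZR k) * (4 / (IZR k * (IZR k + 1))) * (IZR k * (IZR k + 1)))
        with (4 * (1 + IZR k * IZR k)) by (field; lra). nra.
    + assert (IZR k <= 0) by (apply IZR_le; lia). rewrite !Rabs_left1 by lra.
      replace (4 * (- ((IZR k - 1) / (1 + - (IZR k - 1))) - - (IZR k / (1 + - IZR k))))
        with (4 / ((1 - IZR k) * (2 - IZR k))) by (field; lra).
      apply Rmult_le_reg_r with ((1 - IZR k) * (2 - IZR k)); [nra|].
      replace ((1 + IZR k * IZR k) * (4 / ((1 - IZR k) * (2 - IZR k))) * ((1 - IZR k) * (2 - IZR k)))
        with (4 * (1 + IZR k * IZR k)) by (field; lra). nra.
  - rewrite rsum_scal, rsum_telescope.
    generalize (HQ (a - 1)%Z) (HQ (a + Z.of_nat n - 1)%Z); lra.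
Qed.

Lemma exp_neg_le_inv y : 0 <= y -> exp (- y) <= / (1 + y).
Proof.
  intros Hy; rewrite exp_Ropp; apply Rinv_le_contravar; [lra|].
  destruct (Req_dec y 0) as [->|H]; [rewrite exp_0; lra|]. left; apply exp_ineq1; auto.
Qed.

(** * The transformation law for Fourier coefficients in z *)

(** A majorant uniform in t, which serves to justify integrating term by term. Its growth in c is
    harmless, since the estimates themselves come from [summable_gauss_integrals]. *)
Lemma gauss_majorant (m c : Z) (v t : R) (rho : Z) :
  (1 <= m)%Z -> 1 / 2 <= v -> 0 <= t <= 1 ->
  exp (- (2 * PI * m * v * (c * t - rho / (2 * m)) ^ 2)) <=
  exp (c * c) * (8 * m * m) * / (1 + rho * rho).
Proof.
  intros Hm Hv Ht. apply IZR_le in Hm. assert (P := PI2_1).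
  set (y := rho / (2 * m)). set (x := c * t).
  assert (Hy : rho = 2 * m * y :> R) by (unfold y; field; lra).
  assert (Hx : x * x <= c * c).
  { unfold x; replace (c * t * (c * t)) with (c * c * (t * t)) by ring.
    assert (t * t <= 1) by nra. nra. }
  assert (H1 : 1 <= 2 * PI * m * v).
  { assert (1 <= PI * m) by nra.
    assert (0 <= (PI * m - 1) * (v - 1 / 2)) by pos. lra. }
  assert (H2 : (x - y) ^ 2 >= y * y / 2 - x * x)
    by (generalize (pow2_ge_0 (x - y / 2)); lra).
  apply Rle_trans with (exp (c * c + - (y * y / 2))).
  - apply exp_le. assert (H3 : 0 <= (x - y) ^ 2) by pos.
    assert (0 <= (2 * PI * m * v - 1) * (x - y) ^ 2) by pos. lra.
  - rewrite exp_plus, Rmult_assoc; apply Rmult_le_compat_l; [left; apply exp_pos|].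
    eapply Rle_trans; [apply exp_neg_le_inv; nra|].
    apply Rmult_le_reg_l with (1 + y * y / 2); [nra|]. rewrite Rinv_r by nra.
    apply Rmult_le_reg_r with (1 + rho * rho); [nra|].
    replace ((1 + y * y / 2) * (8 * m * m * / (1 + rho * rho)) * (1 + rho * rho))
      with ((1 + y * y / 2) * (8 * m * m)) by (field; nra).
    rewrite Hy. nra.
Qed.

Lemma summable_gauss_majorant (m c : Z) K : 0 <= K ->
  summable_by (fun rho : Z => K * (exp (c * c) * (8 * m * m) * / (1 + rho * rho)))
    (K * (exp (c * c) * (8 * m * m) * 8)).
Proof.
  intros HK l Hl. rewrite !rsum_scal. apply Rmult_le_compat_l; auto.
  apply Rmult_le_compat_l; [|now apply summable_inv_sqr].
  apply Rmult_le_pos; [left; apply exp_pos|]. nra.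
Qed.

(** Replacing rho by rho - 2mc translates t by 1, so the integrals over [0,1] fit together to 2mc
    integrals over R. With exp(-u) <= 1/(1+u) the arctangent gives a primitive, and the c of 2mc
    cancels against the 1/c of the substitution: the bound does not depend on c, and it gains 1/sqrt
    v. *)
Lemma summable_gauss_integrals (m c : Z) (v G : R) (T : Z -> R -> C) (J : Z -> C) :
  (1 <= m)%Z -> (1 <= c)%Z -> 1 / 2 <= v -> 0 <= G ->
  (forall rho t, 0 <= t <= 1 ->
    Cmod (T rho t) <= G * exp (- (2 * PI * m * v * (c * t - rho / (2 * m)) ^ 2))) ->
  (forall rho, is_CInt (T rho) 0 1 (J rho)) ->
  summable_by (fun rho => Cmod (J rho)) (2 * PI * m * G / sqrt v).
Proof.
  intros Hm Hc Hv HG HT HJ.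
  assert (Hm' := IZR_le _ _ Hm). assert (Hc' := IZR_le _ _ Hc). assert (P := PI2_1).
  set (s := sqrt (2 * PI * m * v)).
  assert (HA : v <= 2 * PI * m * v).
  { assert (1 <= PI * m) by nra.
    assert (0 <= (PI * m - 1) * v) by pos. lra. }
  assert (Hs : s * s = 2 * PI * m * v) by (apply sqrt_sqrt; lra).
  assert (Hsv : sqrt v <= s) by (apply sqrt_le_1; lra).
  assert (Hv0 : 0 < sqrt v) by pos.
  set (Q := fun rho : Z => G / (c * s) * atan (- (s * rho / (2 * m)))).
  assert (HQ : forall rho, Cmod (J rho) <= Q (rho - Z.of_nat (Z.to_nat (2 * m * c)))%Z - Q rho).
  { intros rho. rewrite Z2Nat.id by nia.
    apply (Cmod_CInt_le (T rho)
      (fun t => G * / (1 + (s * (c * t - rho / (2 * m))) ^ 2)) 0 1 (J rho)); auto; [lra| |].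
    - intros t Ht. eapply Rle_trans; [now apply HT|]. apply Rmult_le_compat_l; auto.
      replace ((s * (c * t - rho / (2 * m))) ^ 2)
        with (2 * PI * m * v * (c * t - rho / (2 * m)) ^ 2) by (rewrite <- Hs; ring).
      apply exp_neg_le_inv. apply Rmult_le_pos; [lra|apply pow2_ge_0].
    - set (F := fun t => G / (c * s) * atan (s * (c * t - rho / (2 * m)))).
      replace (Q (rho - 2 * m * c)%Z - Q rho) with (minus (F 1) (F 0)).
      + apply (is_RInt_derive (V := R_CompleteNormedModule)); intros t _.
        * unfold F; auto_derive; [exact I|]. unfold Rsqr; field; repeat split; try lra.
          generalize (pow2_ge_0 (s * (c * t - rho / (2 * m)))); intros H E; simpl in H.
          assert (E2 : 1 + (s * (c * t - rho / (2 * m))) ^ 2 = 0); [|lra].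
          apply Rmult_eq_reg_r with ((2 * m) ^ 2); [|nra]. rewrite Rmult_0_l, <- E. field; lra.
        * apply (ex_derive_continuous (K := R_AbsRing) (V := R_NormedModule)).
          auto_derive. generalize (pow2_ge_0 (s * (c * t - rho / (2 * m)))); simpl; intros; lra.
      + unfold F, Q; rewrite minus_IZR, !mult_IZR.
        unfold minus, plus, opp; simpl; eqR.
        replace (s * (c * 1 - rho / (2 * m))) with (- (s * (rho - 2 * m * c) / (2 * m)))
          by (field; lra).
        replace (s * (c * 0 - rho / (2 * m))) with (- (s * rho / (2 * m))) by (field; lra).
        ring. }
  apply summable_by_zrange; [intros; apply Cmod_ge_0|]. intros a n.
  eapply Rle_trans; [apply rsum_le; intros k _; apply HQ|].
  eapply Rle_trans; [apply (rsum_telescope_step Q (G / (c * s) * PI))|].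
  - intros i k; unfold Q.
    assert (B1 := atan_bound (- (s * i / (2 * m)))). assert (B2 := atan_bound (- (s * k / (2 * m)))).
    rewrite <- Rmult_minus_distr_l; apply Rmult_le_compat_l; [|lra].
    apply Rdiv_le_0_compat; [auto|nra].
  - rewrite INR_IZR_INZ, Z2Nat.id, !mult_IZR by nia.
    replace (2 * m * c * (G / (c * s) * PI)) with (2 * PI * m * G / s) by (field; lra).
    unfold Rdiv; apply Rmult_le_compat_l; [|apply Rinv_le_contravar; lra].
    apply Rmult_le_pos; [|lra]. apply Rmult_le_pos; lra.
Qed.

Lemma Im_div_real (k : R) (z : C) : z <> RtoC 0 -> Im (k / z)%C = - (k * Im z / Cmod z ^ 2).
Proof.
  intros Hz.
  assert (Hn : Cmod z ^ 2 = fst z ^ 2 + snd z ^ 2).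
  { unfold Cmod; rewrite pow2_sqrt; [reflexivity|nra]. }
  assert (fst z ^ 2 + snd z ^ 2 <> 0).
  { rewrite <- Hn; apply pow_nonzero; intros E; apply Hz, Cmod_eq_0, E. }
  rewrite Hn. unfold Cdiv, Cinv, Im; simpl. field. intros E; apply H; rewrite <- E; ring.
Qed.

Lemma in_H_cocycle A tau : SL2Z A -> in_H tau -> cocycle A tau <> RtoC 0.
Proof.
  unfold SL2Z, in_H, cocycle; intros HA Ht E.
  assert (E1 := f_equal Re E). assert (E2 := f_equal Im E).
  rewrite Im_plus, Im_scal in E2. rewrite Re_plus, Re_scal in E1. simpl in E1, E2.
  assert (H : IZR (m21 A) = 0) by nra.
  rewrite H, Rmult_0_l, Rplus_0_l in E1.
  apply eq_IZR in H; apply eq_IZR in E1. rewrite H, E1 in HA; lia.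
Qed.

Lemma Im_cocycle A tau : Im (cocycle A tau) = m21 A * Im tau.
Proof. unfold cocycle; rewrite Im_plus, Im_scal; simpl; ring. Qed.

Lemma Im_moebius A tau : SL2Z A -> in_H tau ->
  Im (moebius A tau) = Im tau / Cmod (cocycle A tau) ^ 2.
Proof.
  intros HA Ht. assert (Hj := in_H_cocycle A tau HA Ht).
  assert (Hd : IZR (m11 A) * IZR (m22 A) - IZR (m12 A) * IZR (m21 A) = 1)
    by (rewrite <- !mult_IZR, <- minus_IZR, HA; reflexivity).
  assert (Hn : Cmod (cocycle A tau) ^ 2 = (m21 A * Re tau + m22 A) ^ 2 + (m21 A * Im tau) ^ 2).
  { unfold Cmod; rewrite pow2_sqrt by nra.
    unfold cocycle, Re, Im; simpl; ring. }
  assert (Hp : (m21 A * Re tau + m22 A) ^ 2 + (m21 A * Im tau) ^ 2 <> 0).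
  { rewrite <- Hn; apply pow_nonzero; intros E; apply Hj, Cmod_eq_0, E. }
  rewrite Hn; unfold moebius; fold (cocycle A tau).
  unfold Cdiv; rewrite Im_mult.
  assert (E1 : Re (/ cocycle A tau)%C = (m21 A * Re tau + m22 A) /
     ((m21 A * Re tau + m22 A) ^ 2 + (m21 A * Im tau) ^ 2)).
  { unfold cocycle, Cinv, Re, Im; simpl. unfold Re, Im in Hp. f_equal; [ring|f_equal; ring]. }
  assert (E2 : Im (/ cocycle A tau)%C = - (m21 A * Im tau) /
     ((m21 A * Re tau + m22 A) ^ 2 + (m21 A * Im tau) ^ 2)).
  { unfold cocycle, Cinv, Re, Im; simpl. unfold Re, Im in Hp. f_equal; [ring|f_equal; ring]. }
  rewrite E1, E2, Re_plus, Im_plus, Re_scal, Im_scal.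
  change (Re (RtoC (IZR (m12 A)))) with (IZR (m12 A)).
  change (Im (RtoC (IZR (m12 A)))) with 0.
  set (a := IZR (m11 A)) in *. set (b := IZR (m12 A)) in *.
  set (c := IZR (m21 A)) in *. set (d := IZR (m22 A)) in *.
  set (D := (c * Re tau + d) ^ 2 + (c * Im tau) ^ 2) in *.
  replace (Im tau / D) with ((a * d - b * c) * Im tau / D) by (rewrite Hd; field; exact Hp).
  field; exact Hp.
Qed.

(* Contribution of the term h y^rho of phi(A tau, .) to the integrand of the r-th
   Fourier coefficient of phi(tau, .), after (J1). *)
Definition jterm (m : Z) (A : mat2) (tau : C) (r : Z) (h : C) (rho : Z) (t : R) : C :=
  (/ (cocycle A tau * cocycle A tau) *
   (e2pi (- (m * m21 A * (t * t) / cocycle A tau)) *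
    (h * e2pi (rho * (t / cocycle A tau)))) * e2pi (RtoC (- (IZR r * t))))%C.

(** The decay of h, the size of y^rho at z = t/(c tau + d) and the exponential from (J1) complete to
    a square: a Gaussian in t centred at rho/(2mc). *)
Lemma Cmod_jterm (m : Z) A tau r h (rho : Z) (t G : R) : (1 <= m)%Z -> SL2Z A -> in_H tau ->
  Cmod h <= G * exp (- (2 * PI * Im (moebius A tau) * (rho * rho / (4 * m)))) ->
  Cmod (jterm m A tau r h rho t) <= / Cmod (cocycle A tau) ^ 2 * G *
    exp (- (2 * PI * m * Im (moebius A tau) * (m21 A * t - rho / (2 * m)) ^ 2)).
Proof.
  intros Hm HA Ht Hh. assert (Hj := in_H_cocycle A tau HA Ht).
  apply IZR_le in Hm.
  unfold jterm. set (j := cocycle A tau) in *.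
  rewrite !Cmod_mult, Cmod_e2pi_R, Rmult_1_r, Cmod_inv, Cmod_mult
    by (apply Cmult_neq_0; exact Hj).
  replace (/ (Cmod j * Cmod j)) with (/ Cmod j ^ 2) by (f_equal; ring).
  assert (J0 : 0 < / Cmod j ^ 2) by (apply Rinv_0_lt_compat, pow_lt, Cmod_gt_0, Hj).
  rewrite Rmult_assoc; apply Rmult_le_compat_l; [lra|].
  rewrite !Cmod_e2pi.
  replace (- (m * m21 A * (t * t) / j))%C with (RtoC (- (m * m21 A * (t * t))) / j)%C
    by (rewrite RtoC_opp, !RtoC_mult; field; exact Hj).
  replace (rho * (t / j))%C with (RtoC (rho * t) / j)%C by (rewrite RtoC_mult; field; exact Hj).
  rewrite !Im_div_real by exact Hj.
  assert (Ev : Im (moebius A tau) = Im tau / Cmod j ^ 2) by (apply Im_moebius; auto).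
  set (v := Im (moebius A tau)) in *.
  assert (Ej : forall k, k * Im j / Cmod j ^ 2 = k * m21 A * v).
  { intros k; rewrite Ev; unfold j; rewrite Im_cocycle; fold j. unfold Rdiv; ring. }
  rewrite !Ej.
  eapply Rle_trans.
  { apply Rmult_le_compat_l; [left; apply exp_pos|].
    apply Rmult_le_compat_r; [left; apply exp_pos|exact Hh]. }
  right.
  transitivity (G * (exp (- (2 * PI * - (- (m * m21 A * (t * t)) * m21 A * v))) *
    exp (- (2 * PI * v * (rho * rho / (4 * m))) + - (2 * PI * - (rho * t * m21 A * v)))));
    [rewrite exp_plus; ring|].
  rewrite <- exp_plus. f_equal; f_equal. field; lra.
Qed.

Lemma ccont_jterm m A tau r h rho (t : R) : ccont (jterm m A tau r h rho) t.
Proof.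
  assert (L : forall k : C, cder (fun t : R => (t * k)%C) t (1 * k + t * 0)%C).
  { intros k; apply cder_mult; [|apply cder_const].
    apply (cder_R (fun t => t)), (is_derive_id (K := R_AbsRing)). }
  assert (E : exists l, cder (jterm m A tau r h rho) t l).
  { eexists. unfold jterm. apply cder_mult; [apply cder_scal, cder_mult|].
    - apply (cder_e2pi (fun t : R => (- (m * m21 A * (t * t) / cocycle A tau))%C)).
      eapply cder_ext with (f := fun t : R =>
        ((- (m * m21 A * / cocycle A tau)) * (RtoC t * RtoC t))%C).
      + intros u; unfold Cdiv; ring.
      + apply cder_scal, cder_mult;
          apply (cder_R (fun t => t)), (is_derive_id (K := R_AbsRing)).
    - apply cder_scal, (cder_e2pi (fun t : R => (rho * (t / cocycle A tau))%C)), cder_scal, L.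
    - apply (cder_e2pi (fun t : R => RtoC (- (IZR r * t)))), (cder_R (fun t => - (IZR r * t))).
      auto_derive; [exact I|reflexivity]. }
  destruct E as [l E]; eapply cder_ccont, E.
Qed.

(** Stated for an arbitrary [H] since it has to serve both a form with its q-series and the
    completion of a mock form, whose coefficients are not holomorphic in tau. *)
Definition z_expansion (H : C -> Z -> C) (phi : C -> C -> C) : Prop :=
  forall tau z, in_H tau -> is_Csum (fun rho : Z => H tau rho * e2pi (rho * z))%C (phi tau z).

Lemma is_Csum_single (f : Z -> C) r :
  is_Csum (fun rho => if Z.eq_dec rho r then f rho else RtoC 0) (f r).
Proof.
  intros eps He; exists (r :: nil); intros l Hl Hi.
  replace (lsum _ l) with (f r).
  - replace (f r - f r)%C with (RtoC 0) by ring; now rewrite Cmod_0.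
  - assert (Hr : In r l) by (apply Hi; now left). clear Hi.
    assert (Z0 : forall l, ~ In r l ->
      lsum (fun rho => if Z.eq_dec rho r then f rho else RtoC 0) l = RtoC 0).
    { clear; induction l as [|k l IH]; intros H; [reflexivity|].
      rewrite lsum_cons, IH by (intros K; apply H; now right).
      destruct (Z.eq_dec k r) as [->|]; [exfalso; apply H; now left|ring]. }
    induction l as [|k l IH]; [destruct Hr|]. inversion Hl; subst. rewrite lsum_cons.
    destruct (Z.eq_dec k r) as [->|Hk].
    + rewrite Z0 by assumption; ring.
    + destruct Hr as [->|Hr]; [congruence|]. rewrite <- IH by auto. ring.
Qed.

Lemma z_extraction H phi tau r x0 : z_expansion H phi -> in_H tau ->
  is_CInt (fun t => phi tau t * e2pi (RtoC (- (IZR r * t))))%C x0 (x0 + 1) (H tau r).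
Proof.
  intros HE Ht.
  destruct (fourier_extraction (H tau) (fun k => k) (fun t => phi tau t) x0 r) as [S [S1 S2]].
  - intros t _. eapply is_Csum_ext; [|apply HE, Ht]. intros k; cbv beta. now rewrite RtoC_mult.
  - now rewrite <- (is_Csum_unique _ _ _ S2 (is_Csum_single (H tau) r)).
Qed.

Lemma zcoef_transform m H phi A tau r G :
  (1 <= m)%Z -> J1 m phi -> z_expansion H phi -> SL2Z A -> in_H tau ->
  1 / 2 <= Im (moebius A tau) -> 0 <= G ->
  (forall rho : Z, Cmod (H (moebius A tau) rho) <=
     G * exp (- (2 * PI * Im (moebius A tau) * (rho * rho / (4 * m))))) ->
  exists J, (forall rho, is_CInt (jterm m A tau r (H (moebius A tau) rho) rho) 0 1 (J rho)) /\
    is_Csum J (H tau r).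
Proof.
  intros Hm HJ HE HA Ht Hv HG HH. assert (Hj := in_H_cocycle A tau HA Ht).
  assert (Ex : forall rho, exists S,
    is_CInt (jterm m A tau r (H (moebius A tau) rho) rho) 0 1 S).
  { intros rho; apply ex_CInt_ccont; [lra|]. intros; apply ccont_jterm. }
  set (J := fun rho => proj1_sig (constructive_indefinite_description _ (Ex rho))).
  assert (HJJ : forall rho, is_CInt (jterm m A tau r (H (moebius A tau) rho) rho) 0 1 (J rho)).
  { intros rho; exact (proj2_sig (constructive_indefinite_description _ (Ex rho))). }
  exists J; split; auto.
  set (K := / Cmod (cocycle A tau) ^ 2 * G).
  assert (K0 : 0 <= K).
  { apply Rmult_le_pos; auto. left; apply Rinv_0_lt_compat, pow_lt, Cmod_gt_0, Hj. }
  destruct (is_CInt_is_Csum (fun rho => jterm m A tau r (H (moebius A tau) rho) rho)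
    (fun t => phi tau t * e2pi (RtoC (- (IZR r * t))))%C
    (fun rho => K * (exp (m21 A * m21 A) * (8 * m * m) * / (1 + rho * rho)))
    (K * (exp (m21 A * m21 A) * (8 * m * m) * 8)) J 0 1) as [S [S1 S2]];
    [lra| | |now apply summable_gauss_majorant|auto|].
  - intros t _.
    assert (E : phi tau t = (/ (cocycle A tau * cocycle A tau) *
      (e2pi (- (m * m21 A * (t * t) / cocycle A tau)) *
        phi (moebius A tau) (t / cocycle A tau)))%C).
    { rewrite (HJ A tau t HA Ht).
      transitivity ((e2pi (m * m21 A * (t * t) / cocycle A tau) *
        e2pi (- (m * m21 A * (t * t) / cocycle A tau))) * phi tau t)%C.
      - rewrite e2pi_opp; ring.
      - simpl. field. exact Hj. }
    rewrite E.
    set (k := (/ (cocycle A tau * cocycle A tau) *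
       e2pi (- (m * m21 A * (t * t) / cocycle A tau)) * e2pi (RtoC (- (IZR r * t))))%C).
    replace (_ * e2pi (RtoC (- (IZR r * t))))%C
      with (k * phi (moebius A tau) (t / cocycle A tau))%C by (unfold k; ring).
    eapply is_Csum_ext;
      [|apply is_Csum_scal, (HE (moebius A tau) (t / cocycle A tau)%C)].
    + intros rho; unfold jterm, k; cbv beta. ring.
    + unfold in_H; lra.
  - intros rho t Htt. eapply Rle_trans; [apply Cmod_jterm with (G := G); auto|].
    fold K. apply Rmult_le_compat_l; auto. now apply gauss_majorant.
  - rewrite (is_CInt_unique _ _ _ _ _ (z_extraction H phi tau r 0 HE Ht)
      ltac:(rewrite Rplus_0_l; exact S1)). exact S2.
Qed.

(* H is meant as the coefficients of phi = sum_rho H(tau, rho) y^rho, and P(rho) as the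
   coefficient of Delta = -1, the only polar term. *)
Definition cusp_bound (m : Z) (H : C -> Z -> C) (P : Z -> C) (B : R) : Prop :=
  forall tau (rho : Z), 1 / 2 <= Im tau ->
    Cmod (H tau rho - P rho * qpow ((rho * rho - 1) / (4 * m)) tau)%C <=
    B * exp (- (2 * PI * Im tau * (rho * rho / (4 * m)))).

Lemma Cmod_qpow x tau : Cmod (qpow x tau) = exp (- (2 * PI * (x * Im tau))).
Proof. unfold qpow; rewrite Cmod_e2pi, Im_scal; reflexivity. Qed.

(** The polar terms are kept among the Gaussians at the price of the factor exp(pi v/(2m)), the size
    of q^(-1/4m) at A tau; this is good enough for c >= 2. *)
Lemma zcoef_bound m H phi P B A tau r :
  (1 <= m)%Z -> J1 m phi -> z_expansion H phi -> 0 <= B ->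
  (forall rho, Cmod (P rho) <= B) -> cusp_bound m H P B ->
  SL2Z A -> (1 <= m21 A)%Z -> in_H tau -> 1 / 2 <= Im (moebius A tau) ->
  Cmod (H tau r) <= 4 * PI * m * B * (/ Cmod (cocycle A tau) ^ 2 *
    exp (PI / (2 * m) * Im (moebius A tau)) / sqrt (Im (moebius A tau))).
Proof.
  intros Hm HJ HE HB HP HC HA Hc Ht Hv.
  assert (Hm' := IZR_le _ _ Hm). assert (Pi := PI_RGT_0).
  set (v := Im (moebius A tau)) in *. set (e := exp (PI / (2 * m) * v)).
  assert (He : 1 <= e).
  { unfold e; rewrite <- exp_0; apply exp_le.
    apply Rmult_le_pos; [apply Rdiv_le_0_compat|]; lra. }
  assert (G0 : 0 <= 2 * B * e) by pos.
  assert (HG : forall rho : Z, Cmod (H (moebius A tau) rho) <=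
     2 * B * e * exp (- (2 * PI * v * (rho * rho / (4 * m))))).
  { intros rho.
    replace (H (moebius A tau) rho) with
      ((H (moebius A tau) rho - P rho * qpow ((rho * rho - 1) / (4 * m)) (moebius A tau)) +
       P rho * qpow ((rho * rho - 1) / (4 * m)) (moebius A tau))%C by ring.
    eapply Rle_trans; [apply Cmod_triangle|].
    set (g := exp (- (2 * PI * v * (rho * rho / (4 * m))))).
    assert (Hg : 0 < g) by pos.
    assert (H1 := HC (moebius A tau) rho Hv). fold v g in H1.
    assert (H2 : Cmod (P rho * qpow ((rho * rho - 1) / (4 * m)) (moebius A tau)) <= B * (e * g)).
    { rewrite Cmod_mult, Cmod_qpow; fold v. apply Rmult_le_compat; auto using Cmod_ge_0.
      { left; apply exp_pos. }
      right; unfold e, g; rewrite <- exp_plus; f_equal; field; lra. }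
    assert (B * g <= B * (e * g)) by (apply Rmult_le_compat_l; auto; nra).
    lra. }
  destruct (zcoef_transform m H phi A tau r (2 * B * e) Hm HJ HE HA Ht Hv G0 HG) as [J [J1 J2]].
  assert (Hj : 0 < / Cmod (cocycle A tau) ^ 2)
    by (apply Rinv_0_lt_compat, pow_lt, Cmod_gt_0, in_H_cocycle; auto).
  eapply Rle_trans.
  - apply (Cmod_is_Csum_le J _ (2 * PI * m * (/ Cmod (cocycle A tau) ^ 2 * (2 * B * e)) / sqrt v)); auto.
    apply (summable_gauss_integrals m (m21 A) v _
      (fun rho => jterm m A tau r (H (moebius A tau) rho) rho) J); auto.
    + apply Rmult_le_pos; lra.
    + intros rho t _. apply Cmod_jterm; auto.
  - right; unfold Rdiv; ring.
Qed.

(** The window consists of 2N full periods of [p], so the differences telescope within each class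
    modulo [L] and only the two ends survive. *)
Lemma lsum_blocks (p R : Z -> C) (L N : nat) :
  (forall rho k, p (rho + Z.of_nat L * k)%Z = p rho) ->
  lsum (fun rho => p rho * (R (rho - Z.of_nat L)%Z - R rho))%C
    (zrange (- Z.of_nat (L * N)) (2 * (L * N))) =
  lsum (fun l => p l * (R (l - Z.of_nat L * (Z.of_nat N + 1))%Z -
                        R (l + Z.of_nat L * (Z.of_nat N - 1))%Z))%C (zrange 0 L).
Proof.
  intros Hp; induction N as [|N IH].
  - rewrite Nat.mul_0_r; simpl (zrange _ (2 * 0)).
    transitivity (RtoC 0); [reflexivity|symmetry].
    rewrite (lsum_ext _ (fun l => 0 * p l)%C), lsum_scal; [ring|].
    intros l _.
    replace (l - Z.of_nat L * (Z.of_nat 0 + 1))%Z with (l + Z.of_nat L * (Z.of_nat 0 - 1))%Z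
      by (simpl; lia). ring.
  - replace (2 * (L * S N))%nat with (L + (2 * (L * N) + L))%nat by lia.
    rewrite !zrange_app, !lsum_app.
    replace (- Z.of_nat (L * S N) + Z.of_nat L)%Z with (- Z.of_nat (L * N))%Z by lia.
    rewrite IH.
    rewrite (zrange_shift (- Z.of_nat (L * S N)) L), lsum_map.
    rewrite (zrange_shift (- Z.of_nat (L * N) + Z.of_nat (2 * (L * N))) L), lsum_map.
    rewrite <- !lsum_plus. apply lsum_ext; intros l _.
    replace (- Z.of_nat (L * S N) + l)%Z with (l + Z.of_nat L * (- Z.of_nat (S N)))%Z by lia.
    replace (- Z.of_nat (L * N) + Z.of_nat (2 * (L * N)) + l)%Z
      with (l + Z.of_nat L * Z.of_nat N)%Z by lia.
    rewrite !Hp.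
    replace (l + Z.of_nat L * - Z.of_nat (S N) - Z.of_nat L)%Z
      with (l - Z.of_nat L * (Z.of_nat (S N) + 1))%Z by lia.
    replace (l + Z.of_nat L * - Z.of_nat (S N))%Z
      with (l - Z.of_nat L * (Z.of_nat N + 1))%Z by lia.
    replace (l + Z.of_nat L * Z.of_nat N - Z.of_nat L)%Z
      with (l + Z.of_nat L * (Z.of_nat N - 1))%Z by lia.
    replace (l + Z.of_nat L * (Z.of_nat (S N) - 1))%Z
      with (l + Z.of_nat L * Z.of_nat N)%Z by lia.
    ring.
Qed.

(** Along the line the square tends to minus infinity in real part, quadratically in u, and the
    imaginary part of the argument is eventually positive, so [Cerf_bound] yields the limit. *)
Lemma Cerf_line_lim (sigma b : C) (c0 A : R) : 0 < Im sigma -> 0 < A ->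
  (forall u : R, Re ((sigma * (u + b)) * (sigma * (u + b)))%C <= c0 - A * (u * u)) ->
  forall eps, 0 < eps -> exists U, forall u, U <= u ->
    Cmod (Cerf (sigma * (u + b)) - Ci * (sqrt PI / 2)%R) <= eps.
Proof.
  intros Hs HA Hre eps He.
  set (K := (2 + Cmod sigma * (1 + Cmod b)) * exp c0).
  exists (Rmax (Rmax 1 (- Im (sigma * b)%C / Im sigma)) (K / (A * eps))); intros u Hu.
  assert (U1 : 1 <= u) by (eapply Rle_trans; [|exact Hu]; eapply Rle_trans; [|apply Rmax_l]; apply Rmax_l).
  assert (U2 : - Im (sigma * b)%C / Im sigma <= u)
    by (eapply Rle_trans; [|exact Hu]; eapply Rle_trans; [|apply Rmax_l]; apply Rmax_r).
  assert (U3 : K / (A * eps) <= u) by (eapply Rle_trans; [|exact Hu]; apply Rmax_r).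
  eapply Rle_trans; [apply Cerf_bound|].
  - rewrite Cmult_plus_distr_l, Im_plus, (Cmult_comm sigma u), Im_scal.
    apply Rmult_le_compat_r with (r := Im sigma) in U2; [|lra].
    unfold Rdiv in U2; rewrite Rmult_assoc, Rinv_l in U2; lra.
  - apply Rle_trans with ((2 + Cmod sigma * (1 + Cmod b)) * u * (exp c0 * / (1 + A * (u * u)))).
    + apply Rmult_le_compat.
      * generalize (Cmod_ge_0 (sigma * (u + b))%C); lra.
      * left; apply exp_pos.
      * rewrite Cmod_mult.
        assert (Cmod (u + b)%C <= (1 + Cmod b) * u).
        { eapply Rle_trans; [apply Cmod_triangle|]. rewrite Cmod_R, Rabs_right by lra.
          generalize (Cmod_ge_0 b); nra. }
        assert (S0 := Cmod_ge_0 sigma).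
        assert (Cmod sigma * Cmod (u + b)%C <= Cmod sigma * ((1 + Cmod b) * u)) by pos.
        lra.
      * eapply Rle_trans; [apply exp_le, Hre|]. unfold Rminus; rewrite exp_plus.
        apply Rmult_le_compat_l; [left; apply exp_pos|].
        apply exp_neg_le_inv. apply Rmult_le_pos; nra.
    + replace ((2 + Cmod sigma * (1 + Cmod b)) * u * (exp c0 * / (1 + A * (u * u))))
        with (K * u * / (1 + A * (u * u))) by (unfold K; ring).
      assert (AU : 0 < A * (u * u)) by pos.
      apply Rmult_le_reg_r with (1 + A * (u * u)); [lra|].
      rewrite Rmult_assoc, Rinv_l, Rmult_1_r by lra.
      apply Rmult_le_compat_r with (r := A * eps) in U3; [|nra].
      unfold Rdiv in U3; rewrite Rmult_assoc, Rinv_l in U3 by nra.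
      nra.
Qed.

Lemma Cerf_line_lim_neg (sigma b : C) (c0 A : R) : 0 < Im sigma -> 0 < A ->
  (forall u : R, Re ((sigma * (u + b)) * (sigma * (u + b)))%C <= c0 - A * (u * u)) ->
  forall eps, 0 < eps -> exists U, forall u, u <= U ->
    Cmod (Cerf (sigma * (u + b)) + Ci * (sqrt PI / 2)%R) <= eps.
Proof.
  intros Hs HA Hre eps He.
  destruct (Cerf_line_lim sigma (- b) c0 A Hs HA) with (eps := eps) as [U HU]; auto.
  { intros u. replace (sigma * (u + - b) * (sigma * (u + - b)))%C with
      ((sigma * (RtoC (- u) + b)) * (sigma * (RtoC (- u) + b)))%C by (rewrite RtoC_opp; ring).
    eapply Rle_trans; [apply Hre|]. right; ring. }
  exists (- U); intros u Hu.
  replace (Cerf (sigma * (u + b)) + Ci * (sqrt PI / 2)%R)%C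
    with (- (Cerf (- (sigma * (u + b))) - Ci * (sqrt PI / 2)%R))%C by (rewrite Cerf_opp; ring).
  rewrite Cmod_opp.
  replace (- (sigma * (u + b)))%C with (sigma * (RtoC (- u) + - b))%C by (rewrite RtoC_opp; ring).
  apply HU; lra.
Qed.

(** * The polar part at the cusp 0 *)

Definition S_matrix : mat2 := Mat2 0 (-1) 1 0.

Lemma SL2Z_S_matrix : SL2Z S_matrix.
Proof. reflexivity. Qed.

Lemma cocycle_S_matrix tau : cocycle S_matrix tau = tau.
Proof. unfold cocycle; simpl; ring. Qed.

Lemma moebius_S_matrix tau : tau <> RtoC 0 -> moebius S_matrix tau = (- / tau)%C.
Proof. intros H; unfold moebius; simpl. replace (-1) with (- (1)) by ring. rewrite RtoC_opp; field; auto. Qed.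

Lemma rsum_le_const {I} (f : I -> R) K l : (forall i, In i l -> f i <= K) ->
  rsum f l <= INR (length l) * K.
Proof.
  induction l as [|i l IH]; intros H; [unfold rsum; simpl; lra|].
  rewrite rsum_cons; simpl (length _); rewrite S_INR.
  assert (f i <= K) by (apply H; now left).
  assert (rsum f l <= INR (length l) * K) by (apply IH; intros; apply H; now right). lra.
Qed.

Definition main_sum (m : Z) (P : Z -> C) (r : Z) : C :=
  lsum (fun l => P l * e2pi (RtoC (- (r * l / (2 * m)))))%C (residues (2 * m)).

(* The exact value of the terms with Delta = -1 of phi(-1/tau, .), summed over all
   frequencies: the sum over each class mod 2m unfolds to a Gaussian integral over R. *)
Definition polar_main (m : Z) (P : Z -> C) (r : Z) (tau w : C) : C :=
  (/ (tau * tau) * e2pi (/ (RtoC (4 * m) * tau)) *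
   (e2pi (RtoC (r * r / (4 * m)) * tau) * (w / RtoC (sqrt (2 * m)))) * main_sum m P r)%C.

Lemma in_H_neq_0 tau : in_H tau -> tau <> RtoC 0.
Proof. unfold in_H; intros H E; rewrite E in H; simpl in H; lra. Qed.

Lemma RtoC_neq_0 x : x <> 0 -> RtoC x <> RtoC 0.
Proof. intros H E; apply H, RtoC_inj, E. Qed.

(* With w^2 = -i tau, sigma is the factor making -2 pi i m u^2 / tau the square of sigma u. *)
Lemma sigma_sqr (m : Z) tau w : (1 <= m)%Z -> in_H tau -> (w * w = - Ci * tau)%C ->
  let sigma := (Ci * RtoC (sqrt (2 * PI * m)) / w)%C in
  (sigma * sigma = RtoC 2 * PI * Ci * (- m / tau))%C.
Proof.
  intros Hm Ht Hw sigma. assert (Hm' := IZR_le _ _ Hm). assert (Pi := PI_RGT_0).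
  assert (T0 := in_H_neq_0 tau Ht).
  assert (I0 : Ci <> RtoC 0) by (intros E; apply (f_equal Im) in E; simpl in E; lra).
  assert (I2 : (Ci * Ci = - RtoC 1)%C) by (apply Ceq; simpl; ring).
  assert (W0 : w <> RtoC 0).
  { intros E; rewrite E in Hw; apply T0.
    replace tau with (- (Ci * Ci) * tau)%C by (rewrite I2; ring).
    replace (- (Ci * Ci) * tau)%C with (Ci * (- Ci * tau))%C by ring. rewrite <- Hw; ring. }
  unfold sigma. set (q := sqrt (2 * PI * m)).
  assert (Hq : (RtoC q * RtoC q = RtoC 2 * PI * m)%C).
  { rewrite <- !RtoC_mult; f_equal; apply sqrt_sqrt.
    apply Rmult_le_pos; lra. }
  transitivity ((Ci * Ci) * (RtoC q * RtoC q) / (w * w))%C; [field; auto|].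
  rewrite Hq, Hw, I2. transitivity (RtoC 2 * PI * m * (/ Ci) / tau)%C; [field; auto|].
  replace (/ Ci)%C with (- Ci)%C; [field; auto|]. symmetry; apply Ci_inv.
Qed.

(** Completing the square with the complex centre (rho - r tau)/(2m) makes the integrand a constant
    times exp(zeta^2) with zeta affine in t, so that [Cerf] integrates it. *)
Lemma jterm_polar (m : Z) (P : Z -> C) (r rho : Z) (t : R) tau w :
  (1 <= m)%Z -> in_H tau -> (w * w = - Ci * tau)%C ->
  let sigma := (Ci * RtoC (sqrt (2 * PI * m)) / w)%C in
  let zeta := (sigma * (RtoC (t - rho / (2 * m)) + RtoC (r / (2 * m)) * tau))%C in
  jterm m S_matrix tau r (P rho * qpow ((rho * rho - 1) / (4 * m)) (- / tau)) rho t =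
  ((/ (tau * tau) * e2pi (/ (RtoC (4 * m) * tau)) * e2pi (RtoC (r * r / (4 * m)) * tau) *
   (P rho * e2pi (RtoC (- (r * rho / (2 * m)))))) * Cexp (zeta * zeta))%C.
Proof.
  intros Hm Ht Hw sigma zeta. assert (Hm' := IZR_le _ _ Hm). assert (Pi := PI_RGT_0).
  assert (T0 := in_H_neq_0 tau Ht).
  assert (M0 : RtoC m <> RtoC 0) by (apply RtoC_neq_0; lra).
  assert (Hs := sigma_sqr m tau w Hm Ht Hw). fold sigma in Hs.
  assert (Hz : Cexp (zeta * zeta) =
    e2pi (- (m / tau) * ((RtoC (t - rho / (2 * m)) + RtoC (r / (2 * m)) * tau) *
      (RtoC (t - rho / (2 * m)) + RtoC (r / (2 * m)) * tau)))).
  { unfold e2pi; f_equal. unfold zeta.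
    set (y := (RtoC (t - rho / (2 * m)) + RtoC (r / (2 * m)) * tau)%C).
    transitivity ((sigma * sigma) * (y * y))%C; [ring|]. rewrite Hs. field; auto. }
  rewrite Hz. unfold jterm, qpow; rewrite cocycle_S_matrix.
  transitivity (/ (tau * tau) * P rho * (e2pi (- (m * m21 S_matrix * (t * t) / tau)) *
     e2pi (RtoC ((rho * rho - 1) / (4 * m)) * - / tau) * e2pi (rho * (t / tau)) *
     e2pi (RtoC (- (IZR r * t)))))%C; [ring|].
  transitivity (/ (tau * tau) * P rho * (e2pi (/ (RtoC (4 * m) * tau)) *
     e2pi (RtoC (r * r / (4 * m)) * tau) * e2pi (RtoC (- (r * rho / (2 * m)))) *
     e2pi (- (m / tau) * ((RtoC (t - rho / (2 * m)) + RtoC (r / (2 * m)) * tau) *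
      (RtoC (t - rho / (2 * m)) + RtoC (r / (2 * m)) * tau)))))%C; [|ring].
  f_equal. rewrite <- !e2pi_plus. f_equal. simpl (m21 S_matrix).
  unfold Rdiv, Rminus. rewrite !RtoC_plus, !RtoC_opp, !RtoC_mult.
  rewrite !RtoC_plus, !RtoC_opp, !RtoC_mult, !RtoC_inv by lra. rewrite !RtoC_mult.
  field. auto.
Qed.

(** The polar integrals [Jp] are summed exactly and subtracted term by term. What is left obeys the
    Gaussian bound with the constant [B] alone, without the exponential factor [e] of the polar
    terms. *)
Lemma zcoef_polar_bound (m : Z) H phi P B tau w (r : Z) :
  (1 <= m)%Z -> J1 m phi -> z_expansion H phi -> 0 <= B ->
  (forall rho, Cmod (P rho) <= B) -> (forall rho k, P (rho + 2 * m * k)%Z = P rho) ->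
  cusp_bound m H P B -> in_H tau -> 1 / 2 <= Im (moebius S_matrix tau) ->
  (w * w = - Ci * tau)%C -> 0 < Re w ->
  Cmod (H tau r - polar_main m P r tau w)%C <= 4 * PI * m * B * / Cmod tau ^ 2.
Proof.
  intros Hm HJ HE HB HP Hper HC Ht Hv Hw Hw0.
  assert (Hm' := IZR_le _ _ Hm). assert (Pi := PI_RGT_0).
  assert (T0 := in_H_neq_0 tau Ht).
  assert (Htau : 0 < / Cmod tau ^ 2) by (apply Rinv_0_lt_compat, pow_lt, Cmod_gt_0, T0).
  rewrite moebius_S_matrix in Hv by auto. set (t' := (- / tau)%C) in *.
  set (v := Im t') in *.
  set (e := exp (PI / (2 * m) * v)).
  set (hp := fun rho : Z => (P rho * qpow ((rho * rho - 1) / (4 * m)) t')%C).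
  assert (Hhp : forall rho, Cmod (hp rho) <= B * e * exp (- (2 * PI * v * (rho * rho / (4 * m))))).
  { intros rho; unfold hp; rewrite Cmod_mult, Cmod_qpow; fold v.
    rewrite (Rmult_assoc B e); apply Rmult_le_compat; auto using Cmod_ge_0.
    { left; apply exp_pos. }
    right; unfold e; rewrite <- exp_plus; f_equal; field; lra. }
  set (sigma := (Ci * RtoC (sqrt (2 * PI * m)) / w)%C).
  set (b := (RtoC (r / (2 * m)) * tau)%C).
  set (k0 := (e2pi (RtoC (r * r / (4 * m)) * tau) / sigma)%C).
  set (k1 := (/ (tau * tau) * e2pi (/ (RtoC (4 * m) * tau)))%C).
  set (p := fun rho : Z => (P rho * e2pi (RtoC (- (r * rho / (2 * m)))))%C).
  set (R0 := fun rho : Z => (k1 * k0 * Cerf (sigma * (RtoC (- (rho / (2 * m))) + b)))%C).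
  set (Jp := fun rho : Z => (p rho * (R0 (rho - 2 * m)%Z - R0 rho))%C).
  assert (W0 : w <> RtoC 0) by (intros E; rewrite E in Hw0; simpl in Hw0; lra).
  assert (Q0 : 0 < sqrt (2 * PI * m)) by pos.
  assert (S0 : sigma <> RtoC 0).
  { unfold sigma; intros E. apply Cmult_neq_0 with (z1 := (Ci * RtoC (sqrt (2 * PI * m)))%C) (z2 := (/ w)%C); auto.
    - apply Cmult_neq_0; [|apply RtoC_neq_0; lra].
      intros E1; apply (f_equal Im) in E1; simpl in E1; lra.
    - intros E1. apply C1_nz. rewrite <- (Cinv_r w W0), E1; ring. }
  assert (HJp : forall rho, is_CInt (jterm m S_matrix tau r (hp rho) rho) 0 1 (Jp rho)).
  { intros rho.
    set (F := fun t : R => (k1 * k0 * p rho * Cerf (sigma * (RtoC (t - rho / (2 * m)) + b)))%C).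
    assert (D : forall t, cder F t (jterm m S_matrix tau r (hp rho) rho t)).
    { intros t. eapply cder_eq.
      - apply cder_scal, cder_Cerf, cder_scal, cder_plus; [|apply cder_const].
        apply (cder_R (fun t => t - rho / (2 * m))). auto_derive; [exact I|reflexivity].
      - unfold hp, t'; rewrite (jterm_polar m P r rho t tau w) by auto.
        fold sigma b. fold k1 (p rho). unfold k0. field; auto. }
    replace (Jp rho) with (F 1 - F 0)%C.
    - apply is_CInt_derive; [lra|auto|]. intros; apply ccont_jterm.
    - unfold F, Jp, R0. rewrite minus_IZR, mult_IZR.
      replace (- ((rho - 2 * m) / (2 * m))) with (1 - rho / (2 * m)) by (field; lra).
      replace (- (rho / (2 * m))) with (0 - rho / (2 * m)) by ring. ring. }
  assert (Sp : summable_by (fun rho => Cmod (Jp rho))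
     (2 * PI * m * (/ Cmod tau ^ 2 * (B * e)) / sqrt v)).
  { apply (summable_gauss_integrals m 1 v _
      (fun rho => jterm m S_matrix tau r (hp rho) rho) Jp); auto; [lia| |].
    - apply Rmult_le_pos; [lra|]. apply Rmult_le_pos; [auto|left; apply exp_pos].
    - intros rho t _.
      assert (Hjt := Cmod_jterm m S_matrix tau r (hp rho) rho t (B * e) Hm SL2Z_S_matrix Ht).
      rewrite cocycle_S_matrix, moebius_S_matrix in Hjt by auto. apply Hjt, Hhp. }
  (* Unfolding: [Jp rho] is a difference of step 2m of values of [Cerf], weighted by the 2m-periodic
     [p]. Over windows of whole periods only values far out on the line remain; they tend to i
     sqrt(pi)/2 and to its negative, and each class contributes the difference of these limits. *)
  assert (Hpoly : is_Csum Jp (polar_main m P r tau w)).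
  { destruct (is_Csum_exists Jp _ Sp) as [S HS]. replace (polar_main m P r tau w) with S; auto.
    enough (E : (S - polar_main m P r tau w)%C = RtoC 0)
      by (rewrite <- (Cplus_0_l (polar_main m P r tau w)), <- E; ring).
    set (L := Z.to_nat (2 * m)). assert (HL : Z.of_nat L = (2 * m)%Z) by (unfold L; lia).
    assert (IL : INR L = 2 * m) by (rewrite INR_IZR_INZ, HL, mult_IZR; reflexivity).
    set (q := (Ci * RtoC (sqrt PI / 2))%C).
    assert (Hpol : polar_main m P r tau w = lsum (fun l => p l * (k1 * k0 * (q + q)))%C (zrange 0 L)).
    { rewrite (lsum_ext _ (fun l => k1 * k0 * (q + q) * p l)%C) by (intros; ring).
      rewrite lsum_scal. unfold polar_main, main_sum, L, p; rewrite <- residues_zrange.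
      f_equal. unfold k1, k0, q, sigma.
      replace (2 * PI * m) with (PI * (2 * m)) by ring.
      rewrite (sqrt_mult PI (2 * m)), (RtoC_mult (sqrt PI)), (RtoC_div (sqrt PI)) by lra.
      assert (sqrt PI <> 0) by (intros E; apply sqrt_eq_0 in E; lra).
      assert (sqrt (2 * m) <> 0) by (intros E; apply sqrt_eq_0 in E; lra).
      field. repeat split; try (apply RtoC_neq_0; lra); auto.
      intros E; apply (f_equal Im) in E; simpl in E; lra. }
    assert (Ssq := sigma_sqr m tau w Hm Ht Hw). fold sigma in Ssq.
    assert (Sim : 0 < Im sigma).
    { unfold sigma, Cdiv.
      replace (Im _) with (sqrt (2 * PI * m) * Re (/ w)%C) by (unfold Im, Re; simpl; ring).
      apply Rmult_lt_0_compat; [lra|]. unfold Cinv, Re; simpl. unfold Re in Hw0.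
      apply Rdiv_lt_0_compat; nra. }
    (* The cross term has no real part, because sigma^2 b = - pi i r with r real. *)
    assert (Hre : forall u : R, Re ((sigma * (u + b)) * (sigma * (u + b)))%C <=
       Re ((sigma * sigma) * (b * b))%C - 2 * PI * m * v * (u * u)).
    { intros u. replace (sigma * (u + b) * (sigma * (u + b)))%C
        with (RtoC (u * u) * (sigma * sigma) + RtoC (2 * u) * (sigma * sigma * b) +
              sigma * sigma * (b * b))%C by (rewrite !RtoC_mult; ring).
      rewrite !Re_plus, !Re_scal.
      replace (sigma * sigma * b)%C with (RtoC 2 * PI * Ci * RtoC (- (r / 2)))%C.
      - rewrite Ssq at 1. rewrite !Re_2piI.
        replace (- m / tau)%C with (m * t')%C by (unfold t'; field; auto).
        rewrite Im_scal; fold v. simpl; right; ring.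
      - rewrite Ssq; unfold b. rewrite RtoC_opp, !RtoC_div, RtoC_mult by lra.
        field; repeat split; auto; apply RtoC_neq_0; lra. }
    assert (A0 : 0 < 2 * PI * m * v) by pos.
    apply Cmod_le_eps_eq; intros eps He.
    set (Kc := Cmod (k1 * k0)%C). assert (Kc0 : 0 <= Kc) by pos.
    assert (LK : 0 <= 2 * m * (B * Kc)) by pos.
    (* Each of the 2m classes errs by at most [B] times [Kc] times 2[d]; the + 1 keeps the
       denominator positive. *)
    set (d := eps / (4 * (2 * m * (B * Kc) + 1))).
    assert (Hd : 0 < d) by pos.
    destruct (Cerf_line_lim sigma b _ _ Sim A0 Hre d Hd) as [U1 HU1].
    destruct (Cerf_line_lim_neg sigma b _ _ Sim A0 Hre d Hd) as [U2 HU2].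
    destruct (is_Csum_zrange_lim Jp S L ltac:(lia) HS (eps / 2) ltac:(lra)) as [N0 HN0].
    destruct (nfloor_ex (Rabs U1 + Rabs U2 + 1)) as [N1 HN1].
    { generalize (Rabs_pos U1) (Rabs_pos U2); lra. }
    set (N := (N0 + N1 + 1)%nat).
    specialize (HN0 N ltac:(lia)).
    assert (HN : Rabs U1 + Rabs U2 + 1 <= INR N).
    { unfold N; rewrite !plus_INR; simpl; generalize (pos_INR N0); lra. }
    assert (HB2 : lsum Jp (zrange (- Z.of_nat (L * N)) (2 * (L * N))) =
      lsum (fun l => p l * (R0 (l - Z.of_nat L * (Z.of_nat N + 1))%Z -
                        R0 (l + Z.of_nat L * (Z.of_nat N - 1))%Z))%C (zrange 0 L)).
    { rewrite <- lsum_blocks.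
      - apply lsum_ext; intros; unfold Jp; now rewrite HL.
      - intros rho k; unfold p. rewrite HL, Hper. f_equal.
        rewrite plus_IZR, !mult_IZR.
        replace (- (r * (rho + 2 * m * k) / (2 * m))) with (- (r * rho / (2 * m)) + IZR (- (r * k)))
          by (rewrite opp_IZR, mult_IZR; field; lra).
        rewrite RtoC_plus; apply e2pi_add_Z. }
    rewrite HB2 in HN0.
    replace (S - polar_main m P r tau w)%C with
      (- (lsum (fun l => p l * (R0 (l - Z.of_nat L * (Z.of_nat N + 1))%Z -
          R0 (l + Z.of_nat L * (Z.of_nat N - 1))%Z))%C (zrange 0 L) - S) +
       lsum (fun l => p l * (R0 (l - Z.of_nat L * (Z.of_nat N + 1))%Z -
          R0 (l + Z.of_nat L * (Z.of_nat N - 1))%Z) + (-1) * (p l * (k1 * k0 * (q + q))))%C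
         (zrange 0 L))%C.
    2: { rewrite lsum_plus, lsum_scal, Hpol. ring. }
    eapply Rle_trans; [apply Cmod_triangle|]. rewrite Cmod_opp.
    enough (Cmod (lsum (fun l => p l * (R0 (l - Z.of_nat L * (Z.of_nat N + 1))%Z -
          R0 (l + Z.of_nat L * (Z.of_nat N - 1))%Z) + (-1) * (p l * (k1 * k0 * (q + q))))%C
         (zrange 0 L)) <= eps / 2) by lra.
    eapply Rle_trans; [apply Cmod_lsum_le|].
    apply Rle_trans with (INR (length (zrange 0 L)) * (B * (Kc * (2 * d)))).
    { apply rsum_le_const. intros l Hl. apply in_zrange in Hl.
      assert (Hl1 : 0 <= l) by (apply IZR_le; lia).
      assert (Hl2 : l <= 2 * m) by (rewrite <- mult_IZR; apply IZR_le; lia).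
      assert (Hl3 : 0 <= l / (2 * m) <= 1).
      { split; [apply Rdiv_le_0_compat; lra|].
        apply Rmult_le_reg_r with (2 * m); [lra|]. unfold Rdiv; rewrite Rmult_assoc, Rinv_l; lra. }
      replace (p l * _ + _)%C with (p l * ((k1 * k0) *
        ((Cerf (sigma * (RtoC (- ((l - Z.of_nat L * (Z.of_nat N + 1))%Z / (2 * m))) + b)) - q) +
         - (Cerf (sigma * (RtoC (- ((l + Z.of_nat L * (Z.of_nat N - 1))%Z / (2 * m))) + b)) + q))))%C
        by (unfold R0; ring).
      rewrite (Cmod_mult (p l)). apply Rmult_le_compat; auto using Cmod_ge_0.
      { unfold p; rewrite Cmod_mult, Cmod_e2pi_R, Rmult_1_r; auto. }
      rewrite (Cmod_mult (k1 * k0)). fold Kc. apply Rmult_le_compat_l; auto.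
      eapply Rle_trans; [apply Cmod_triangle|]. rewrite Cmod_opp.
      replace (2 * d) with (d + d) by ring. apply Rplus_le_compat.
      - apply HU1. rewrite HL, minus_IZR, !mult_IZR, plus_IZR, <- INR_IZR_INZ.
        replace (- ((l - 2 * m * (INR N + 1)) / (2 * m))) with (INR N + 1 - l / (2 * m))
          by (field; lra).
        generalize (Rle_abs U1) (Rabs_pos U2); lra.
      - apply HU2. rewrite HL, plus_IZR, !mult_IZR, minus_IZR, <- INR_IZR_INZ.
        replace (- ((l + 2 * m * (INR N - 1)) / (2 * m))) with (- (INR N - 1 + l / (2 * m)))
          by (field; lra).
        generalize (Rle_abs (- U2)) (Rabs_pos U1); rewrite Rabs_Ropp; lra. }
    unfold zrange; rewrite length_map, length_seq, IL.
    apply Rle_trans with (2 * d * (2 * m * (B * Kc) + 1)).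
    - replace (2 * m * (B * (Kc * (2 * d)))) with (2 * d * (2 * m * (B * Kc))) by ring.
      apply Rmult_le_compat_l; lra.
    - right; unfold d; field; lra. }
  assert (He1 : 1 <= e).
  { unfold e; rewrite <- exp_0; apply exp_le.
    apply Rmult_le_pos; [apply Rdiv_le_0_compat|]; lra. }
  assert (G0 : 0 <= 2 * B * e) by pos.
  assert (Hm0 : moebius S_matrix tau = t') by (apply moebius_S_matrix; auto).
  assert (HC' : forall rho : Z, Cmod (H t' rho - hp rho)%C <=
     B * exp (- (2 * PI * v * (rho * rho / (4 * m))))).
  { intros rho; apply HC; exact Hv. }
  destruct (zcoef_transform m H phi S_matrix tau r (2 * B * e) Hm HJ HE SL2Z_S_matrix Ht) as [J [J1 J2]].
  { rewrite Hm0; exact Hv. }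
  { exact G0. }
  { intros rho; rewrite Hm0; fold v.
    replace (H t' rho) with ((H t' rho - hp rho) + hp rho)%C by ring.
    eapply Rle_trans; [apply Cmod_triangle|].
    set (g := exp (- (2 * PI * v * (rho * rho / (4 * m))))) in *.
    assert (Hg : 0 < g) by pos.
    generalize (HC' rho) (Hhp rho). fold g.
    assert (B * g <= B * (e * g)) by (apply Rmult_le_compat_l; auto; nra). lra. }
  rewrite Hm0 in J1.
  assert (Sv : 1 / 2 <= sqrt v) by (apply half_le_sqrt; lra).
  eapply Rle_trans.
  - apply (Cmod_is_Csum_le (fun rho => J rho + (-1) * Jp rho)%C _
      (2 * PI * m * (/ Cmod tau ^ 2 * B) / sqrt v)).
    + replace (H tau r - polar_main m P r tau w)%C
        with (H tau r + (-1) * polar_main m P r tau w)%C by ring.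
      apply is_Csum_plus; [exact J2|apply is_Csum_scal, Hpoly].
    + apply (summable_gauss_integrals m 1 v _
        (fun rho => jterm m S_matrix tau r (H t' rho - hp rho) rho)
        (fun rho => J rho + (-1) * Jp rho)%C); auto; [lia| | |].
      * apply Rmult_le_pos; lra.
      * intros rho t _.
        assert (Hjt := Cmod_jterm m S_matrix tau r (H t' rho - hp rho) rho t B Hm SL2Z_S_matrix Ht).
        rewrite cocycle_S_matrix, Hm0 in Hjt. apply Hjt, HC'.
      * intros rho.
        apply (is_CInt_ext (fun t => jterm m S_matrix tau r (H t' rho) rho t +
           (-1) * jterm m S_matrix tau r (hp rho) rho t)%C); [lra| |].
        -- intros t _; unfold jterm; eqC; ring.
        -- apply is_CInt_plus; [apply J1|apply is_CInt_scal, HJp].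
  - unfold Rdiv. assert (Hi : / sqrt v <= 2).
    { replace 2 with (/ (1 / 2)) by field. apply Rinv_le_contravar; lra. }
    replace (2 * PI * m * (/ Cmod tau ^ 2 * B) * / sqrt v)
      with (2 * PI * m * B * / Cmod tau ^ 2 * / sqrt v) by ring.
    replace (4 * PI * m * B * / Cmod tau ^ 2) with (2 * PI * m * B * / Cmod tau ^ 2 * 2) by ring.
    apply Rmult_le_compat_l; auto.
    apply Rmult_le_pos; [|lra]. apply Rmult_le_pos; [|auto]. apply Rmult_le_pos; lra.
Qed.

(** * Pointwise estimates on a horizontal line *)

Lemma Cmod_sqr (z : C) : Cmod z ^ 2 = Re z ^ 2 + Im z ^ 2.
Proof. unfold Cmod; rewrite pow2_sqrt; [reflexivity|nra]. Qed.

Lemma Cmod_main_sum m P r B : (1 <= m)%Z -> (forall rho, Cmod (P rho) <= B) ->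
  Cmod (main_sum m P r) <= 2 * m * B.
Proof.
  intros Hm HP; unfold main_sum; eapply Rle_trans; [apply Cmod_lsum_le|].
  eapply Rle_trans; [apply rsum_le_const with (K := B)|].
  - intros l _; rewrite Cmod_mult, Cmod_e2pi_R, Rmult_1_r; auto.
  - rewrite residues_zrange; unfold zrange.
    rewrite length_map, length_seq, INR_IZR_INZ, Z2Nat.id, mult_IZR by lia; lra.
Qed.

(** [polar_main] is subtracted along the whole period, hence also where another denominator
    dominates. There it has to be small by itself, which is read off from the quotient of Im tau by
    |tau|^2. *)
Lemma Cmod_polar_main_le (m : Z) P (r : Z) B tau w : (1 <= m)%Z -> (forall rho, Cmod (P rho) <= B) ->
  in_H tau -> (w * w = - Ci * tau)%C -> Cmod tau <= 1 ->
  Cmod (polar_main m P r tau w) <=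
    / Cmod tau ^ 2 * exp (PI / (2 * m) * (Im tau / Cmod tau ^ 2)) * (2 * m * B).
Proof.
  intros Hm HP Ht Hw H1. assert (Hm' := IZR_le _ _ Hm). assert (Pi := PI_RGT_0).
  assert (T0 := in_H_neq_0 tau Ht). unfold in_H in Ht.
  assert (Htau : 0 < Cmod tau) by apply Cmod_gt_0, T0.
  assert (Hq : 1 <= sqrt (2 * m)) by (rewrite <- sqrt_1 at 1; apply sqrt_le_1; lra).
  assert (Hw1 : Cmod w <= 1).
  { assert (E : Cmod w * Cmod w = Cmod tau).
    { rewrite <- Cmod_mult, Hw. replace (- Ci * tau)%C with (- (Ci * tau))%C by ring.
      rewrite Cmod_opp, Cmod_mult. replace (Cmod Ci) with 1; [ring|].
      unfold Cmod, Ci; simpl. rewrite <- sqrt_1 at 1; f_equal; ring. }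
    generalize (Cmod_ge_0 w); nra. }
  unfold polar_main, Cdiv.
  rewrite !Cmod_mult, !Cmod_inv, Cmod_mult, !Cmod_e2pi, Cmod_R
    by (try apply Cmult_neq_0; auto; apply RtoC_neq_0; lra).
  replace (/ (RtoC (4 * m) * tau))%C with (RtoC (/ (4 * m)) / tau)%C
    by (rewrite RtoC_inv by lra; field; split; auto; apply RtoC_neq_0; lra).
  rewrite Im_div_real, Im_scal, (Rabs_right (sqrt (2 * m))) by (auto; lra).
  rewrite !Rmult_assoc. replace (/ (Cmod tau * Cmod tau)) with (/ Cmod tau ^ 2) by (f_equal; ring).
  apply Rmult_le_compat_l.
  { left; apply Rinv_0_lt_compat, pow_lt, Htau. }
  apply Rmult_le_compat.
  { left; apply exp_pos. }
  { repeat apply Rmult_le_pos; try apply Cmod_ge_0; try (left; apply exp_pos).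
    left; apply Rinv_0_lt_compat; lra. }
  { right; f_equal. field. split; lra. }
  replace (2 * (m * B)) with (1 * (1 * (2 * m * B))) by ring.
  apply Rmult_le_compat; [left; apply exp_pos| | |].
  { repeat apply Rmult_le_pos; try apply Cmod_ge_0.
    left; apply Rinv_0_lt_compat; lra. }
  { rewrite <- exp_0; apply exp_le.
    assert (0 <= r * r / (4 * m)) by (apply Rdiv_le_0_compat; nra).
    assert (0 <= PI * (r * r / (4 * m) * Im tau)) by pos. lra. }
  rewrite <- Rmult_assoc. apply Rmult_le_compat.
  { apply Rmult_le_pos; [apply Cmod_ge_0|left; apply Rinv_0_lt_compat; lra]. }
  { apply Cmod_ge_0. }
  { replace 1 with (1 * 1) at 1 by ring. apply Rmult_le_compat; auto using Cmod_ge_0.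
    - left; apply Rinv_0_lt_compat; lra.
    - rewrite <- Rinv_1; apply Rinv_le_contravar; lra. }
  now apply Cmod_main_sum.
Qed.

(* Majorant on the arc where the denominator 2 dominates, X = 2x + d: unlike the pointwise
   bound v^(-3/2), its integral over x is O(1), so no power of Delta is lost. *)
Definition arc (v X : R) : R := v * sqrt v / (v ^ 3 + X ^ 2).

Lemma arc_nonneg v X : 0 < v -> 0 <= arc v X.
Proof.
  intros Hv; unfold arc. assert (0 < sqrt v) by pos.
  assert (0 < v ^ 3) by pos. assert (0 <= X ^ 2) by pos.
  apply Rdiv_le_0_compat; [apply Rmult_le_pos|]; lra.
Qed.

Lemma Rdiv_le_cross a b c d : 0 < b -> 0 < d -> a * d <= c * b -> a / b <= c / d.
Proof.
  intros Hb Hd H. apply Rmult_le_reg_r with (b * d); [nra|].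
  replace (a / b * (b * d)) with (a * d) by (field; lra).
  replace (c / d * (b * d)) with (c * b) by (field; lra). exact H.
Qed.

(** N is |2 tau + d|^2. If X^2 >= 4 v^2 the exponent is at most a/(8v) and crude bounds do.
    Otherwise v/N = 1/(4v) - X^2/(4vN) with N < 8 v^2; the loss a X^2/(32 v^3) in the exponent,
    turned into a rational factor by exp(-u) <= 1/(1+u), produces v^3/(v^3 + X^2), and the factor
    sqrt v of [arc] is what the division by sqrt(v/N) gains. *)
Lemma denominator_two_bound (a v X : R) : 0 < a <= 2 -> 0 < v ->
  let N := X ^ 2 + (2 * v) ^ 2 in 1 / 2 <= v / N ->
  / N * exp (a * (v / N)) / sqrt (v / N) <=
  2 * (/ v ^ 2 * exp (a / (8 * v))) + 24 / a * (exp (a / (4 * v)) * arc v X).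
Proof.
  intros Ha Hv N HN. assert (X0 := pow2_ge_0 X).
  assert (Nd : N = X ^ 2 + 4 * v ^ 2) by (unfold N; ring).
  assert (V2 : 0 < v ^ 2) by pos. assert (V3 : 0 < v ^ 3) by pos.
  assert (N0 : 0 < N) by lra.
  assert (A0 := arc_nonneg v X Hv).
  assert (T2 : 0 <= 24 / a * (exp (a / (4 * v)) * arc v X)) by pos.
  assert (T1 : 0 <= 2 * (/ v ^ 2 * exp (a / (8 * v)))) by pos.
  destruct (Rle_lt_dec (4 * v ^ 2) (X ^ 2)) as [H|H].
  - enough (/ N * exp (a * (v / N)) / sqrt (v / N) <= 2 * (/ v ^ 2 * exp (a / (8 * v)))) by lra.
    assert (S : 1 / 2 <= sqrt (v / N)) by (apply half_le_sqrt; lra).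
    unfold Rdiv at 1. rewrite Rmult_comm. apply Rmult_le_compat.
    + left; apply Rinv_0_lt_compat; lra.
    + apply Rmult_le_pos; [left; now apply Rinv_0_lt_compat|left; apply exp_pos].
    + replace 2 with (/ (1 / 2)) by field. apply Rinv_le_contravar; lra.
    + apply Rmult_le_compat; [left; now apply Rinv_0_lt_compat|left; apply exp_pos| |].
      * apply Rinv_le_contravar; lra.
      * apply exp_le. replace (a * (v / N)) with ((a * v) / N) by (unfold Rdiv; ring).
        apply Rdiv_le_cross; [auto|lra|]. rewrite Nd.
        replace (a * v * (8 * v)) with (a * (8 * v ^ 2)) by ring. apply Rmult_le_compat_l; lra.
  - enough (/ N * exp (a * (v / N)) / sqrt (v / N) <= 24 / a * (exp (a / (4 * v)) * arc v X)) by lra.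
    assert (S0 : 0 < sqrt v) by pos.
    assert (SS : sqrt v * sqrt v = v) by (apply sqrt_sqrt; lra).
    assert (S : / (3 * sqrt v) <= sqrt (v / N)).
    { replace (/ (3 * sqrt v)) with (sqrt (/ (9 * v))).
      - apply sqrt_le_1; [left; apply Rinv_0_lt_compat; lra|apply Rdiv_le_0_compat; lra|].
        replace (/ (9 * v)) with (1 / (9 * v)) by (field; lra).
        apply Rdiv_le_cross; [lra|auto|]. rewrite Nd. replace (v * (9 * v)) with (9 * v ^ 2) by ring.
        lra.
      - replace (/ (9 * v)) with (/ (3 * sqrt v) * / (3 * sqrt v)).
        + apply sqrt_square; left; apply Rinv_0_lt_compat; lra.
        + rewrite <- SS at 3. field; lra. }
    assert (Hs : / sqrt (v / N) <= 3 * sqrt v).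
    { replace (3 * sqrt v) with (/ / (3 * sqrt v)) by (field; lra).
      apply Rinv_le_contravar; [apply Rinv_0_lt_compat; lra|auto]. }
    assert (He : exp (a * (v / N)) <= exp (a / (4 * v)) * (32 * v ^ 3 / (a * (v ^ 3 + X ^ 2)))).
    { apply Rle_trans with (exp (a / (4 * v) + - (a * X ^ 2 / (32 * v ^ 3)))).
      - apply exp_le.
        replace (a * (v / N)) with (a / (4 * v) + - (a * X ^ 2 / (4 * v * N)))
          by (rewrite Nd; field; split; [rewrite <- Nd|]; lra).
        apply Rplus_le_compat_l, Ropp_le_contravar. unfold Rdiv; apply Rmult_le_compat_l; [nra|].
        apply Rinv_le_contravar; [nra|]. rewrite Nd. simpl in *. nra.
      - rewrite exp_plus; apply Rmult_le_compat_l; [left; apply exp_pos|].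
        eapply Rle_trans; [apply exp_neg_le_inv; apply Rdiv_le_0_compat; nra|].
        replace (/ (1 + a * X ^ 2 / (32 * v ^ 3))) with (32 * v ^ 3 * / (32 * v ^ 3 + a * X ^ 2))
          by (field; repeat split; nra).
        unfold Rdiv; apply Rmult_le_compat_l; [lra|]. apply Rinv_le_contravar; nra. }
    unfold Rdiv at 1. apply Rle_trans with
      (/ (4 * v ^ 2) * (exp (a / (4 * v)) * (32 * v ^ 3 / (a * (v ^ 3 + X ^ 2)))) * (3 * sqrt v)).
    + apply Rmult_le_compat; auto.
      * apply Rmult_le_pos; [left; now apply Rinv_0_lt_compat|left; apply exp_pos].
      * left; apply Rinv_0_lt_compat, sqrt_lt_R0, Rdiv_lt_0_compat; lra.
      * apply Rmult_le_compat; [left; now apply Rinv_0_lt_compat|left; apply exp_pos| |auto].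
        apply Rinv_le_contravar; lra.
    + right; unfold arc; field. repeat split; try lra.
Qed.

(** The matrix from [SL2_high] varies with the point, but [K] is uniform since the bounds for c = 1,
    c = 2 and c >= 3 do not depend on it. On the period centred at 0 with v <= 1/9 the lower row
    with c = 1 is that of [S_matrix]. *)
Lemma zcoef_remainder_bound (m : Z) H phi P B (r : Z) :
  (1 <= m)%Z -> J1 m phi -> z_expansion H phi -> 0 <= B ->
  (forall rho, Cmod (P rho) <= B) -> (forall rho k, P (rho + 2 * m * k)%Z = P rho) ->
  cusp_bound m H P B ->
  exists K, 0 <= K /\ forall x v w, -1 / 2 <= x <= 1 / 2 -> 0 < v <= 1 / 9 ->
    (w * w = - Ci * (x, v))%C -> 0 < Re w ->
    Cmod (H (x, v) r - polar_main m P r (x, v) w)%C <=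
      K * (/ v ^ 2 * exp (PI / (2 * m) / (8 * v)) +
           exp (PI / (2 * m) / (4 * v)) * (arc v (2 * x + 1) + arc v (2 * x - 1))).
Proof.
  intros Hm HJ HE HB HP Hper HC.
  assert (Hm' := IZR_le _ _ Hm). assert (Pi := PI_RGT_0). assert (Pi4 := PI_4).
  set (a := PI / (2 * m)).
  assert (Ha : 0 < a <= 2).
  { unfold a; split; [apply Rdiv_lt_0_compat; lra|].
    apply Rmult_le_reg_r with (2 * m); [lra|]. unfold Rdiv; rewrite Rmult_assoc, Rinv_l; lra. }
  set (CH := 4 * PI * m * B).
  assert (CH0 : 0 <= CH) by pos.
  (* 8 bounds v/|tau|^2 when c >= 2, by [Hx2] below. *)
  set (CP := 2 * m * B * exp (8 * a)).
  assert (CP0 : 0 <= CP) by pos.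
  assert (Ca : 0 <= CH * (24 / a)) by pos.
  exists (2 * CH + CH * (24 / a) + CP). split; [lra|].
  intros x v w Hx Hv Hw Hw0.
  set (tau := ((x, v) : C)) in *.
  assert (Ht : in_H tau) by (unfold in_H; simpl; lra).
  set (E1 := / v ^ 2 * exp (a / (8 * v))).
  set (E2 := exp (a / (4 * v)) * (arc v (2 * x + 1) + arc v (2 * x - 1))).
  assert (V2 : 0 < v ^ 2) by pos.
  assert (Iv2 : 0 < / v ^ 2) by pos.
  assert (Hexp : 1 <= exp (a / (8 * v))).
  { rewrite <- exp_0; apply exp_le, Rdiv_le_0_compat; lra. }
  assert (Iv2E : / v ^ 2 <= E1) by (unfold E1; nra).
  assert (E10 : 0 <= E1) by lra.
  assert (A1 := arc_nonneg v (2 * x + 1) ltac:(lra)).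
  assert (A2 := arc_nonneg v (2 * x - 1) ltac:(lra)).
  assert (Ex4 := exp_pos (a / (4 * v))).
  assert (E20 : 0 <= E2) by pos.
  destruct (SL2_high x v ltac:(lra)) as [A [HA [Hc HN]]].
  assert (Hj : Cmod (cocycle A tau) ^ 2 = (m21 A * x + m22 A) ^ 2 + (m21 A * v) ^ 2).
  { rewrite Cmod_sqr, Im_cocycle. unfold cocycle; rewrite Re_plus, Re_scal; reflexivity. }
  set (N := (m21 A * x + m22 A) ^ 2 + (m21 A * v) ^ 2) in *.
  assert (Hc' := IZR_le _ _ Hc).
  assert (HcN : (m21 A * v) ^ 2 <= N) by (unfold N; generalize (pow2_ge_0 (m21 A * x + m22 A)); lra).
  assert (N0 : 0 < N).
  { eapply Rlt_le_trans; [|exact HcN]. apply pow_lt, Rmult_lt_0_compat; lra. }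
  assert (Hmo : Im (moebius A tau) = v / N) by (rewrite Im_moebius, Hj by auto; reflexivity).
  assert (HvN : 1 / 2 <= v / N).
  { apply Rdiv_le_cross; lra. }
  destruct (Z.eq_dec (m21 A) 1) as [C1|C1].
  - (* c = 1, hence d = 0 *)
    assert (D0 : m22 A = 0%Z).
    { assert (Hd : (x + m22 A) ^ 2 < (1 / 2) ^ 2).
      { unfold N in HN; rewrite C1 in HN.
        replace (x + m22 A) with (1 * x + m22 A) by ring. lra. }
      assert (Hd2 : -1 < m22 A < 1) by nra.
      destruct Hd2 as [h1 h2]. apply lt_IZR in h1; apply lt_IZR in h2; lia. }
    assert (HN2 : N = Cmod tau ^ 2).
    { rewrite Cmod_sqr; unfold N; rewrite C1, D0; simpl; ring. }
    assert (HS : 1 / 2 <= Im (moebius S_matrix tau)).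
    { rewrite Im_moebius, cocycle_S_matrix, <- HN2 by (auto; reflexivity). exact HvN. }
    eapply Rle_trans; [apply (zcoef_polar_bound m H phi P B tau w r); auto|].
    fold CH. rewrite <- HN2.
    assert (/ N <= / v ^ 2).
    { apply Rinv_le_contravar; auto. rewrite C1 in HcN. lra. }
    assert (CH * / N <= CH * E1) by pos.
    assert (0 <= CH * (24 / a) * (E1 + E2)) by pos.
    assert (0 <= CP * (E1 + E2)) by pos.
    assert (0 <= CH * E1) by pos.
    assert (0 <= CH * E2) by pos. lra.
  - assert (C2 : (2 <= m21 A)%Z) by lia. assert (C2' := IZR_le _ _ C2).
    (* d = 0 would make c a divisor of 1. Hence |cx| >= |d| - |cx + d| >= 1/2, and with c^2 v <= 2
       this keeps x away from the cusp 0: x^2 >= v/8. *)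
    assert (D1 : m22 A <> 0%Z).
    { intros E; red in HA; rewrite E in HA.
      assert (HH : (m21 A * (- m12 A) = 1)%Z) by lia.
      apply Z.eq_mul_1_nonneg in HH; lia. }
    assert (Hd : 1 <= Rabs (m22 A)) by (rewrite <- abs_IZR; apply IZR_le; lia).
    assert (Hcx : Rabs (m21 A * x + m22 A) <= 1 / 2).
    { apply Rabs_le. assert ((m21 A * x + m22 A) ^ 2 <= (1 / 2) ^ 2).
      { unfold N in HN. generalize (pow2_ge_0 (m21 A * v)); lra. }
      split; nra. }
    assert (Hcx2 : 1 / 2 <= Rabs (m21 A * x)).
    { assert (Rabs (m22 A) <= Rabs (m21 A * x + m22 A) + Rabs (m21 A * x)).
      { replace (IZR (m22 A)) with ((m21 A * x + m22 A) + - (m21 A * x)) at 1 by ring.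
        eapply Rle_trans; [apply Rabs_triang|]. rewrite Rabs_Ropp; lra. }
      lra. }
    assert (Hcv : m21 A ^ 2 * v <= 2) by pos.
    assert (Hx2 : v / 8 <= x ^ 2).
    { assert (1 / 4 <= (m21 A * x) ^ 2).
      { rewrite <- pow2_abs. nra. }
      assert (0 < m21 A ^ 2) by pos.
      apply Rmult_le_reg_l with (m21 A ^ 2); [auto|].
      replace (m21 A ^ 2 * x ^ 2) with ((m21 A * x) ^ 2) by ring. lra. }
    assert (Htau2 : Cmod tau ^ 2 = x ^ 2 + v ^ 2) by (rewrite Cmod_sqr; reflexivity).
    assert (HHp : Cmod (polar_main m P r tau w) <= CP * E1).
    { eapply Rle_trans; [apply (Cmod_polar_main_le m P r B tau w); auto|].
      - apply Rsqr_incr_0; [|apply Cmod_ge_0|lra]. unfold Rsqr.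
        replace (Cmod tau * Cmod tau) with (Cmod tau ^ 2) by ring.
        rewrite Htau2. nra.
      - fold a; rewrite Htau2; simpl (Im tau).
        replace (CP * E1) with (E1 * exp (8 * a) * (2 * m * B)) by (unfold CP; ring).
        apply Rmult_le_compat_r; [apply Rmult_le_pos; lra|].
        apply Rmult_le_compat; [left; apply Rinv_0_lt_compat; lra|left; apply exp_pos| |].
        + apply Rle_trans with (/ v ^ 2); [apply Rinv_le_contravar; lra|auto].
        + apply exp_le. rewrite (Rmult_comm 8 a). apply Rmult_le_compat_l; [lra|].
          replace 8 with (8 / 1) by field. apply Rdiv_le_cross; lra. }
    assert (HHb : Cmod (H tau r) <= CH * (2 * E1 + 24 / a * E2)).
    { eapply Rle_trans; [apply (zcoef_bound m H phi P B A tau r); auto; rewrite Hmo; auto|].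
      fold CH a. rewrite Hmo, Hj. apply Rmult_le_compat_l; auto.
      destruct (Z.eq_dec (m21 A) 2) as [E|E].
      - (* c = 2, hence d = 1 or d = -1 *)
        assert (EN : N = (2 * x + m22 A) ^ 2 + (2 * v) ^ 2) by (unfold N; now rewrite E).
        assert (Hd2 : m22 A = 1%Z \/ m22 A = (-1)%Z).
        { rewrite E in Hcx. apply Rabs_le_between in Hcx.
          assert (-2 < m22 A < 2) by lra. destruct H0 as [h1 h2].
          apply lt_IZR in h1; apply lt_IZR in h2; lia. }
        assert (HD := denominator_two_bound a v (2 * x + m22 A) Ha ltac:(lra)).
        cbv zeta in HD; rewrite <- EN in HD. specialize (HD HvN).
        eapply Rle_trans; [exact HD|]. fold E1. apply Rplus_le_compat_l.
        apply Rmult_le_compat_l; [apply Rdiv_le_0_compat; lra|].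
        unfold E2; apply Rmult_le_compat_l; [lra|].
        destruct Hd2 as [-> | ->].
        + lra.
        + replace (2 * x + -1) with (2 * x - 1) by ring; lra.
      - assert (C3 : 3 <= m21 A) by (apply IZR_le; lia).
        assert (HN9 : 9 * v ^ 2 <= N).
        { eapply Rle_trans; [|exact HcN]. replace ((m21 A * v) ^ 2) with (m21 A ^ 2 * v ^ 2) by ring.
          apply Rmult_le_compat_r; [lra|]. nra. }
        assert (S : 1 / 2 <= sqrt (v / N)) by (apply half_le_sqrt; lra).
        assert (0 <= 24 / a * E2) by pos.
        enough (/ N * exp (a * (v / N)) / sqrt (v / N) <= 2 * E1) by lra.
        unfold Rdiv at 1. rewrite (Rmult_comm 2). apply Rmult_le_compat.
        + apply Rmult_le_pos; [left; now apply Rinv_0_lt_compat|left; apply exp_pos].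
        + left; apply Rinv_0_lt_compat; lra.
        + unfold E1; apply Rmult_le_compat; [left; now apply Rinv_0_lt_compat|left; apply exp_pos| |].
          * apply Rinv_le_contravar; lra.
          * apply exp_le. replace (a * (v / N)) with ((a * v) / N) by (unfold Rdiv; ring).
            apply Rdiv_le_cross; [auto|lra|].
            replace (a * v * (8 * v)) with (a * (8 * v ^ 2)) by ring. apply Rmult_le_compat_l; lra.
        + replace 2 with (/ (1 / 2)) by field. apply Rinv_le_contravar; lra. }
    unfold Cminus. eapply Rle_trans; [apply Cmod_triangle|]. rewrite Cmod_opp.
    assert (0 <= CH * (24 / a) * E1) by pos.
    assert (0 <= CP * E2) by pos.
    assert (0 <= CH * E2) by pos. lra.
Qed.

(** * The main term *)

(* The square root of v - i x with positive real part. *)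
Definition sqrt_line (v x : R) : C :=
  (sqrt ((sqrt (v ^ 2 + x ^ 2) + v) / 2), - x / (2 * sqrt ((sqrt (v ^ 2 + x ^ 2) + v) / 2))).

Lemma sqrt_line_pos v x : 0 < v ->
  0 < sqrt (v ^ 2 + x ^ 2) /\ 0 < sqrt ((sqrt (v ^ 2 + x ^ 2) + v) / 2).
Proof.
  intros Hv. assert (0 < v ^ 2) by pos. assert (0 <= x ^ 2) by pos.
  assert (0 < sqrt (v ^ 2 + x ^ 2)) by pos.
  split; auto. apply sqrt_lt_R0; lra.
Qed.

Lemma sqrt_line_sqr_parts v x : 0 < v ->
  let n := sqrt (v ^ 2 + x ^ 2) in let p := sqrt ((n + v) / 2) in
  n * n = v ^ 2 + x ^ 2 /\ p * p = (n + v) / 2.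
Proof.
  intros Hv n p. destruct (sqrt_line_pos v x Hv) as [H1 H2].
  assert (0 <= v ^ 2) by pos. assert (0 <= x ^ 2) by pos.
  split; apply sqrt_sqrt; [lra|]. fold n in H1; lra.
Qed.

Lemma sqrt_line_sqr v x : 0 < v -> (sqrt_line v x * sqrt_line v x = - Ci * (x, v))%C.
Proof.
  intros Hv. destruct (sqrt_line_pos v x Hv) as [Hn Hp].
  destruct (sqrt_line_sqr_parts v x Hv) as [En Ep]. unfold sqrt_line.
  set (n := sqrt (v ^ 2 + x ^ 2)) in *. set (p := sqrt ((n + v) / 2)) in *.
  apply Ceq.
  - transitivity (p * p - x ^ 2 / (4 * (p * p))); [simpl; field; lra|].
    rewrite Ep. transitivity (v : R); [|simpl; ring].
    replace (x ^ 2) with (n * n - v ^ 2) by (rewrite En; ring). field; lra.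
  - simpl; field; lra.
Qed.

Lemma Re_sqrt_line v x : 0 < v -> 0 < Re (sqrt_line v x).
Proof. intros Hv; exact (proj2 (sqrt_line_pos v x Hv)). Qed.

Lemma sqrt_line_neq_0 v x : 0 < v -> sqrt_line v x <> RtoC 0.
Proof. intros Hv E; generalize (Re_sqrt_line v x Hv); rewrite E; simpl; lra. Qed.

(** The value comes from differentiating w^2 = v - i x; as the root is given by its components, the
    proof verifies it on both. *)
Lemma cder_sqrt_line v x : 0 < v -> cder (sqrt_line v) x (- Ci / (RtoC 2 * sqrt_line v x))%C.
Proof.
  intros Hv. destruct (sqrt_line_pos v x Hv) as [Hn Hp].
  destruct (sqrt_line_sqr_parts v x Hv) as [En Ep]. cbv zeta in En, Ep.
  assert (V2 : 0 < v ^ 2) by pos. assert (X2 : 0 <= x ^ 2) by pos.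
  assert (V2' : 0 < v * (v * 1) + x * (x * 1)) by lra.
  assert (D1 : is_derive (fun x => sqrt ((sqrt (v ^ 2 + x ^ 2) + v) / 2)) x
    (x / (4 * sqrt ((sqrt (v ^ 2 + x ^ 2) + v) / 2) * sqrt (v ^ 2 + x ^ 2)))).
  { auto_derive.
    - repeat split; auto. change (0 < (sqrt (v ^ 2 + x ^ 2) + v) * / 2). lra.
    - change (v * (v * 1) + x * (x * 1)) with (v ^ 2 + x ^ 2).
      unfold Rdiv in *. field. lra. }
  set (pf := fun x => sqrt ((sqrt (v ^ 2 + x ^ 2) + v) / 2)) in *.
  assert (D2 : is_derive (fun x => - x / (2 * pf x)) x
    (- / (2 * pf x) + x * (x / (4 * pf x * sqrt (v ^ 2 + x ^ 2))) / (2 * (pf x * pf x)))).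
  { assert (G : forall (f : R -> R) l, f x <> 0 -> is_derive f x l ->
      is_derive (fun x => - x / (2 * f x)) x (- / (2 * f x) + x * l / (2 * (f x * f x)))).
    { intros f l H0 Hf; auto_derive.
      - split; [eexists; exact Hf|lra].
      - rewrite (is_derive_unique (fun x : R => f x) _ _ Hf). field; auto. }
    apply G; [unfold pf; lra|exact D1]. }
  change (fun x => sqrt_line v x) with (fun x => ((pf x, - x / (2 * pf x)) : C)).
  assert (E : (- Ci / (RtoC 2 * sqrt_line v x))%C =
    (x / (4 * pf x * sqrt (v ^ 2 + x ^ 2)), - pf x / (2 * sqrt (v ^ 2 + x ^ 2)))).
  { assert (W := sqrt_line_neq_0 v x Hv).
    assert (Hm : (- Ci)%C = ((x / (4 * pf x * sqrt (v ^ 2 + x ^ 2)),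
       - pf x / (2 * sqrt (v ^ 2 + x ^ 2)))%R * (RtoC 2 * sqrt_line v x))%C).
    { unfold sqrt_line. fold (pf x). change (sqrt ((sqrt (v ^ 2 + x ^ 2) + v) / 2)) with (pf x) in Ep, Hp.
      change (sqrt ((sqrt (v ^ 2 + x ^ 2) + v) / 2)) with (pf x).
      set (n := sqrt (v ^ 2 + x ^ 2)) in *. set (p := pf x) in *.
      apply Ceq.
      - simpl; field; lra.
      - transitivity (- (x ^ 2 / (4 * (p * p) * n) + p * p / n)); [|simpl; field; lra].
        rewrite Ep. replace (x ^ 2) with (n * n - v ^ 2) by (rewrite En; ring).
        simpl; field; lra. }
    rewrite Hm. field. auto. }
  eapply cder_eq; [|symmetry; exact E]. split; [exact D1|].
  evar_last; [exact D2|].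
  change (Im _) with (- pf x / (2 * sqrt (v ^ 2 + x ^ 2))).
  change (sqrt ((sqrt (v ^ 2 + x ^ 2) + v) / 2)) with (pf x) in Ep, Hp.
  set (n := sqrt (v ^ 2 + x ^ 2)) in *. set (p := pf x) in *.
  assert (E4 : x * x = 4 * (p * p) * n - 4 * (p * p) * (p * p)) by pos.
  eqR. transitivity (- / (2 * p) + (x * x) / (8 * (p * (p * p)) * n)); [field; lra|].
  rewrite E4. field. lra.
Qed.

(** With a = pi/(2m) and y^2 = Delta this is [polar_main] times q^(-n) up to a constant factor
    ([polar_main_peak]). Over an infinite line its integral would be the one that defines the Bessel
    function I_(1/2). *)
Definition peak (a y v x : R) : C :=
  (/ (sqrt_line v x * sqrt_line v x * sqrt_line v x) *
   Cexp (RtoC a / (sqrt_line v x * sqrt_line v x) + RtoC (a * y ^ 2) * (sqrt_line v x * sqrt_line v x)))%C.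

(* With U = sqrt(a) (y w - 1/w) and V = sqrt(a) (y w + 1/w) one has
   U^2 + 2ay = V^2 - 2ay = a/w^2 + a y^2 w^2, which makes the integral elementary in Cerf. *)
Definition peak_prim (a y v x : R) : C :=
  (RtoC (exp (2 * a * y)) *
     Cerf (RtoC (sqrt a * y) * sqrt_line v x + RtoC (- sqrt a) / sqrt_line v x) +
   RtoC (- exp (- (2 * a * y))) *
     Cerf (RtoC (sqrt a * y) * sqrt_line v x + RtoC (sqrt a) / sqrt_line v x))%C.

Lemma cder_peak_prim a y v x : 0 < a -> 0 < v ->
  cder (peak_prim a y v) x (- Ci * RtoC (sqrt a) * peak a y v x)%C.
Proof.
  intros Ha Hv. assert (W := sqrt_line_neq_0 v x Hv).
  assert (Sa : (RtoC (sqrt a) * RtoC (sqrt a) = RtoC a)%C)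
    by (rewrite <- RtoC_mult; f_equal; apply sqrt_sqrt; lra).
  assert (D : forall k, cder (fun x => RtoC (sqrt a * y) * sqrt_line v x + RtoC k / sqrt_line v x)%C x
    ((- Ci / (RtoC 2 * sqrt_line v x)) * (RtoC (sqrt a * y) - RtoC k / (sqrt_line v x * sqrt_line v x)))%C).
  { intros k. eapply cder_eq.
    - apply cder_plus; [apply cder_scal, cder_sqrt_line, Hv|].
      apply cder_scal, cder_inv; [exact W|apply cder_sqrt_line, Hv].
    - field; auto. }
  eapply cder_eq.
  - apply cder_plus; apply cder_scal, cder_Cerf, D.
  - cbv beta. set (w := sqrt_line v x) in *.
    set (X := (RtoC a / (w * w) + RtoC (a * y ^ 2) * (w * w))%C).
    assert (E1 : Cexp ((RtoC (sqrt a * y) * w + RtoC (- sqrt a) / w) *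
      (RtoC (sqrt a * y) * w + RtoC (- sqrt a) / w)) = (Cexp X * RtoC (exp (- (2 * a * y))))%C).
    { rewrite <- Cexp_R, <- Cexp_plus; f_equal. unfold X.
      rewrite !RtoC_opp, !RtoC_mult, !RtoC_pow, <- Sa. field; auto. }
    assert (E2 : Cexp ((RtoC (sqrt a * y) * w + RtoC (sqrt a) / w) *
      (RtoC (sqrt a * y) * w + RtoC (sqrt a) / w)) = (Cexp X * RtoC (exp (2 * a * y)))%C).
    { rewrite <- Cexp_R, <- Cexp_plus; f_equal. unfold X.
      rewrite !RtoC_mult, !RtoC_pow, <- Sa. field; auto. }
    rewrite E1, E2. unfold peak; fold w; fold X.
    assert (E3 : (RtoC (exp (2 * a * y)) * RtoC (exp (- (2 * a * y))) = RtoC 1)%C).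
    { rewrite <- RtoC_mult, <- exp_plus, Rplus_opp_r, exp_0; reflexivity. }
    set (e1 := RtoC (exp (2 * a * y))) in *.
    rewrite !RtoC_opp. set (e2 := RtoC (exp (- (2 * a * y)))) in *.
    transitivity (e1 * e2 * (- Ci * RtoC (sqrt a) * (/ (w * w * w) * Cexp X)))%C.
    + field; auto.
    + rewrite E3; ring.
Qed.

Lemma is_CInt_peak a y v : 0 < a -> 0 < v ->
  is_CInt (peak a y v) (-1 / 2) (1 / 2)
    (Ci / RtoC (sqrt a) * (peak_prim a y v (1 / 2) - peak_prim a y v (-1 / 2)))%C.
Proof.
  intros Ha Hv.
  assert (Sa : 0 < sqrt a) by pos.
  assert (Sa' : RtoC (sqrt a) <> RtoC 0) by (apply RtoC_neq_0; lra).
  assert (II : (Ci * Ci = - RtoC 1)%C) by (apply Ceq; simpl; ring).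
  replace (Ci / RtoC (sqrt a) * (peak_prim a y v (1 / 2) - peak_prim a y v (-1 / 2)))%C
    with (Ci / RtoC (sqrt a) * peak_prim a y v (1 / 2) -
          Ci / RtoC (sqrt a) * peak_prim a y v (-1 / 2))%C by ring.
  apply (is_CInt_derive (fun x => Ci / RtoC (sqrt a) * peak_prim a y v x)%C); [lra| |].
  - intros x _. eapply cder_eq; [apply cder_scal, cder_peak_prim; auto|].
    transitivity (- (Ci * Ci) * peak a y v x)%C; [field; auto|rewrite II; ring].
  - intros x _. assert (W := sqrt_line_neq_0 v x Hv).
    eapply cder_ccont. unfold peak. apply cder_mult.
    + apply cder_inv; [repeat apply Cmult_neq_0; auto|].
      apply cder_mult; [apply cder_mult|]; apply cder_sqrt_line; auto.
    + apply cder_Cexp, cder_plus.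
      * apply cder_scal, cder_inv; [repeat apply Cmult_neq_0; auto|].
        apply cder_mult; apply cder_sqrt_line; auto.
      * apply cder_scal, cder_mult; apply cder_sqrt_line; auto.
Qed.

Lemma Cmod_Ci : Cmod Ci = 1.
Proof. unfold Cmod, Ci; simpl. transitivity (sqrt 1); [f_equal; ring|apply sqrt_1]. Qed.

Lemma Cmod_sqrt_line_sqr v x : 0 < v -> Cmod (sqrt_line v x) ^ 2 = sqrt (x ^ 2 + v ^ 2).
Proof.
  intros Hv. replace (Cmod (sqrt_line v x) ^ 2) with (Cmod (sqrt_line v x * sqrt_line v x))
    by (rewrite Cmod_mult; ring).
  rewrite (sqrt_line_sqr v x Hv), Cmod_mult, Cmod_opp, Cmod_Ci, Rmult_1_l. reflexivity.
Qed.

(** The two signs of [k] cover the two arguments of [Cerf] in [peak_prim]. At the ends |w|^2 >= 1/2,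
    so a/w^2 has real part at most 2a, while a y^2 w^2 has real part a y^2 v = a y/2 by the choice
    of v. The cross term of U^2 cancels the exponential weight in front, and the sign of Im w
    selects the limit of [Cerf]. *)
Lemma peak_end a y v x k : 0 < a -> 4 <= y -> v = / (2 * y) -> x ^ 2 = 1 / 4 -> k ^ 2 = a ->
  let U := (RtoC (sqrt a * y) * sqrt_line v x + RtoC k / sqrt_line v x)%C in
  let M := (2 + sqrt a * y + 2 * sqrt a) * (exp (2 * a) * exp (a * y / 2)) in
  (0 <= Im (sqrt_line v x) ->
    exp (- (2 * (sqrt a * y) * k)) * Cmod (Cerf U - Ci * (sqrt PI / 2)%R) <= M) /\
  (Im (sqrt_line v x) <= 0 ->
    exp (- (2 * (sqrt a * y) * k)) * Cmod (Cerf U + Ci * (sqrt PI / 2)%R) <= M).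
Proof.
  intros Ha Hy Hvy Hx Hk U M.
  assert (Hv : 0 < v) by (rewrite Hvy; apply Rinv_0_lt_compat; lra).
  assert (Hv8 : v <= 1 / 8).
  { rewrite Hvy. replace (1 / 8) with (/ 8) by field. apply Rinv_le_contravar; lra. }
  assert (Sa : 0 < sqrt a) by pos.
  assert (SS : sqrt a * sqrt a = a) by (apply sqrt_sqrt; lra).
  assert (Ka : Rabs k = sqrt a) by (rewrite <- Hk, <- sqrt_Rsqr_abs; f_equal; unfold Rsqr; ring).
  set (w := sqrt_line v x) in *. assert (W : w <> RtoC 0) by now apply sqrt_line_neq_0.
  assert (Wm : 0 < Cmod w) by now apply Cmod_gt_0.
  assert (Wn : Cmod w ^ 2 = sqrt (x ^ 2 + v ^ 2)) by now apply Cmod_sqrt_line_sqr.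
  assert (W1 : 1 / 2 <= Cmod w ^ 2).
  { rewrite Wn. apply half_le_sqrt; nra. }
  assert (W2 : Cmod w ^ 2 <= 1).
  { rewrite Wn. rewrite <- sqrt_1. apply sqrt_le_1; nra. }
  assert (W3 : 1 / 2 <= Cmod w <= 1) by nra.
  assert (Ew : (w * w = - Ci * (x, v))%C) by now apply sqrt_line_sqr.
  assert (HU : Cmod U <= sqrt a * y + 2 * sqrt a).
  { unfold U, Cdiv. eapply Rle_trans; [apply Cmod_triangle|].
    rewrite !Cmod_mult, Cmod_inv, !Cmod_R, Ka by auto.
    rewrite (Rabs_right (sqrt a * y)) by nra.
    assert (/ Cmod w <= 2).
    { replace 2 with (/ (1 / 2)) by field. apply Rinv_le_contravar; lra. }
    assert (0 <= sqrt a * y) by nra.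
    apply Rplus_le_compat; [nra|]. rewrite (Rmult_comm 2). apply Rmult_le_compat_l; lra. }
  assert (HI : Im U = Im w * (sqrt a * y - k / Cmod w ^ 2)).
  { unfold U; rewrite Im_plus, Im_scal, Im_div_real by auto. unfold Rdiv; ring. }
  assert (HI0 : 0 <= sqrt a * y - k / Cmod w ^ 2).
  { assert (k <= sqrt a) by pos.
    assert (k / Cmod w ^ 2 <= (sqrt a * 2) / 1).
    { apply Rdiv_le_cross; [lra|lra|]. nra. }
    nra. }
  set (X := (RtoC a / (w * w) + RtoC (a * y ^ 2) * (w * w))%C).
  assert (HUU : (U * U = X + RtoC (2 * (sqrt a * y) * k))%C).
  { unfold U, X. rewrite !RtoC_mult, RtoC_pow.
    replace (RtoC a) with (RtoC (sqrt a) * RtoC (sqrt a))%C by (rewrite <- RtoC_mult, SS; auto).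
    assert (Kk : (RtoC k * RtoC k = RtoC (sqrt a) * RtoC (sqrt a))%C).
    { rewrite <- !RtoC_mult, SS, <- Hk; f_equal; ring. }
    transitivity ((RtoC k * RtoC k) / (w * w) + RtoC (sqrt a) * RtoC (sqrt a) * RtoC y ^ 2 * (w * w) +
      RtoC 2 * (RtoC (sqrt a) * RtoC y) * RtoC k)%C; [field; auto|]. rewrite Kk; ring. }
  assert (HX : Re X <= 2 * a + a * y / 2).
  { unfold X; rewrite Re_plus, Re_scal. apply Rplus_le_compat.
    - eapply Rle_trans; [apply Rle_abs|]. eapply Rle_trans; [apply abs_Re_le|].
      unfold Cdiv; rewrite Cmod_mult, Cmod_inv, Cmod_mult, Cmod_R, Rabs_right
        by (try apply Cmult_neq_0; auto; lra).
      rewrite (Rmult_comm 2). apply Rmult_le_compat_l; [lra|].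
      replace 2 with (/ (1 / 2)) by field. apply Rinv_le_contravar; nra.
    - rewrite Ew. replace (Re (- Ci * (x, v))%C) with v by (simpl; ring).
      rewrite Hvy. right; field; lra. }
  assert (G : forall T, T <= (2 + Cmod U) * exp (Re (U * U)%C) ->
    exp (- (2 * (sqrt a * y) * k)) * T <= M).
  { intros T HT.
    apply Rle_trans with (exp (- (2 * (sqrt a * y) * k)) * ((2 + Cmod U) * exp (Re (U * U)%C))).
    - apply Rmult_le_compat_l; [left; apply exp_pos|exact HT].
    - rewrite HUU, Re_plus. change (Re (RtoC (2 * (sqrt a * y) * k))) with (2 * (sqrt a * y) * k).
      replace (exp (- (2 * (sqrt a * y) * k)) * ((2 + Cmod U) * exp (Re X + 2 * (sqrt a * y) * k)))
        with ((2 + Cmod U) * (exp (Re X + 2 * (sqrt a * y) * k) * exp (- (2 * (sqrt a * y) * k)))) by ring.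
      rewrite <- exp_plus. unfold M. apply Rmult_le_compat.
      + generalize (Cmod_ge_0 U); lra.
      + left; apply exp_pos.
      + lra.
      + rewrite <- exp_plus; apply exp_le; lra. }
  split; intros Hs; apply G; [apply Cerf_bound|apply Cerf_bound_neg]; rewrite HI; nra.
Qed.

(** The values of [Cerf] approach - i sqrt(pi)/2 at x = 1/2 and i sqrt(pi)/2 at x = -1/2; the jump
    yields sqrt(pi/a) (exp(2ay) - exp(-2ay)), whose second exponential is at most 1. The 5 accounts
    for four end point errors [M] and for this last term. *)
Lemma peak_integral_bound a : 0 < a -> exists K, 0 <= K /\ forall y v S, 4 <= y -> v = / (2 * y) ->
  is_CInt (peak a y v) (-1 / 2) (1 / 2) S ->
  Cmod (S - RtoC (sqrt PI / sqrt a * exp (2 * a * y)))%C <= K * ((1 + y) * exp (a * y / 2)).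
Proof.
  intros Ha. assert (Sa : 0 < sqrt a) by pos.
  assert (SS : sqrt a * sqrt a = a) by (apply sqrt_sqrt; lra).
  assert (Pi4 := PI_4). assert (Pi0 := PI_RGT_0).
  set (K := 5 / sqrt a * ((2 + 3 * sqrt a) * exp (2 * a))).
  exists K. split.
  { apply Rmult_le_pos; [apply Rdiv_le_0_compat; lra|].
    apply Rmult_le_pos; [lra|left; apply exp_pos]. }
  intros y v S Hy Hvy HS.
  assert (Hv : 0 < v) by (rewrite Hvy; apply Rinv_0_lt_compat; lra).
  rewrite (is_CInt_unique _ _ _ _ _ HS (is_CInt_peak a y v Ha Hv)).
  set (M := (2 + sqrt a * y + 2 * sqrt a) * (exp (2 * a) * exp (a * y / 2))).
  assert (E : exp (2 * (sqrt a * y) * sqrt a) = exp (2 * a * y)).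
  { f_equal. transitivity (2 * (sqrt a * sqrt a) * y); [ring|rewrite SS; ring]. }
  destruct (peak_end a y v (1 / 2) (- sqrt a) Ha Hy Hvy) as [_ B1]; [field|etransitivity; [|exact SS]; ring|].
  destruct (peak_end a y v (1 / 2) (sqrt a) Ha Hy Hvy) as [_ B2]; [field|etransitivity; [|exact SS]; ring|].
  destruct (peak_end a y v (-1 / 2) (- sqrt a) Ha Hy Hvy) as [B3 _]; [field|etransitivity; [|exact SS]; ring|].
  destruct (peak_end a y v (-1 / 2) (sqrt a) Ha Hy Hvy) as [B4 _]; [field|etransitivity; [|exact SS]; ring|].
  assert (I1 : Im (sqrt_line v (1 / 2)) <= 0).
  { destruct (sqrt_line_pos v (1 / 2) Hv) as [_ Hp]. unfold sqrt_line.
    change (- (1 / 2) / (2 * sqrt ((sqrt (v ^ 2 + (1 / 2) ^ 2) + v) / 2)) <= 0).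
    set (p := sqrt ((sqrt (v ^ 2 + (1 / 2) ^ 2) + v) / 2)) in *.
    assert (0 < / (2 * p)) by pos. unfold Rdiv; nra. }
  assert (I2 : 0 <= Im (sqrt_line v (-1 / 2))).
  { destruct (sqrt_line_pos v (-1 / 2) Hv) as [_ Hp]. unfold sqrt_line.
    change (0 <= - (-1 / 2) / (2 * sqrt ((sqrt (v ^ 2 + (-1 / 2) ^ 2) + v) / 2))).
    apply Rdiv_le_0_compat; lra. }
  specialize (B1 I1). specialize (B2 I1). specialize (B3 I2). specialize (B4 I2). fold M in B1, B2, B3, B4.
  replace (- (2 * (sqrt a * y) * - sqrt a)) with (2 * (sqrt a * y) * sqrt a) in B1, B3 by ring.
  rewrite E in B1, B3.
  assert (E' : exp (- (2 * (sqrt a * y) * sqrt a)) = exp (- (2 * a * y))).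
  { f_equal. transitivity (- (2 * (sqrt a * sqrt a) * y)); [ring|rewrite SS; ring]. }
  rewrite E' in B2, B4.
  unfold peak_prim.
  set (e1 := exp (2 * a * y)) in *. set (e2 := exp (- (2 * a * y))) in *.
  set (q := (Ci * RtoC (sqrt PI / 2))%C) in *.
  set (F1 := Cerf (RtoC (sqrt a * y) * sqrt_line v (1 / 2) + RtoC (- sqrt a) / sqrt_line v (1 / 2))) in *.
  set (F2 := Cerf (RtoC (sqrt a * y) * sqrt_line v (1 / 2) + RtoC (sqrt a) / sqrt_line v (1 / 2))) in *.
  set (F3 := Cerf (RtoC (sqrt a * y) * sqrt_line v (-1 / 2) + RtoC (- sqrt a) / sqrt_line v (-1 / 2))) in *.
  set (F4 := Cerf (RtoC (sqrt a * y) * sqrt_line v (-1 / 2) + RtoC (sqrt a) / sqrt_line v (-1 / 2))) in *.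
  assert (e1p : 0 < e1) by pos. assert (e2p : 0 < e2) by pos.
  assert (e2l : e2 <= 1) by (unfold e2; rewrite <- exp_0; apply exp_le; nra).
  assert (SP : 0 < sqrt PI <= 2).
  { split; [now apply sqrt_lt_R0|]. replace 2 with (sqrt (2 * 2)) by (apply sqrt_square; lra).
    apply sqrt_le_1; lra. }
  assert (Sa' : RtoC (sqrt a) <> RtoC 0) by (apply RtoC_neq_0; lra).
  assert (II : (Ci * Ci = - RtoC 1)%C) by (apply Ceq; simpl; ring).
  replace (Ci / RtoC (sqrt a) * (RtoC e1 * F1 + RtoC (- e2) * F2 - (RtoC e1 * F3 + RtoC (- e2) * F4)) -
    RtoC (sqrt PI / sqrt a * e1))%C
   with (Ci * RtoC (/ sqrt a) * ((RtoC e1 * (F1 + q) + - (RtoC e2 * (F2 + q))) +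
     (- (RtoC e1 * (F3 - q)) + RtoC e2 * (F4 - q))) + RtoC (- (sqrt PI / sqrt a * e2)))%C.
  2: { unfold q. rewrite !RtoC_opp, !RtoC_mult, !RtoC_div, RtoC_inv by lra.
       transitivity (Ci / RtoC (sqrt a) * (RtoC e1 * F1 - RtoC e2 * F2 - RtoC e1 * F3 + RtoC e2 * F4)
         + (Ci * Ci) * RtoC (sqrt PI) / RtoC (sqrt a) * (RtoC e1 - RtoC e2) -
           RtoC (sqrt PI) / RtoC (sqrt a) * RtoC e2)%C.
       - field; repeat split; auto; apply RtoC_neq_0; lra.
       - rewrite II. field; auto. }
  eapply Rle_trans; [apply Cmod_triangle|].
  assert (T1 : Cmod (RtoC (- (sqrt PI / sqrt a * e2))) <= / sqrt a * 2).
  { assert (0 < / sqrt a) by pos.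
    rewrite Cmod_R, Rabs_Ropp, Rabs_right.
    - unfold Rdiv. rewrite (Rmult_comm (sqrt PI)), Rmult_assoc. apply Rmult_le_compat_l; nra.
    - apply Rle_ge, Rmult_le_pos; [apply Rdiv_le_0_compat|]; lra. }
  assert (T2 : Cmod (Ci * RtoC (/ sqrt a) * ((RtoC e1 * (F1 + q) + - (RtoC e2 * (F2 + q))) +
     (- (RtoC e1 * (F3 - q)) + RtoC e2 * (F4 - q))))%C <= / sqrt a * (4 * M)).
  { assert (0 < / sqrt a) by pos.
    rewrite !Cmod_mult, Cmod_Ci, Cmod_R, Rmult_1_l, Rabs_right by lra.
    apply Rmult_le_compat_l; [lra|].
    eapply Rle_trans; [apply Cmod_triangle|].
    eapply Rle_trans; [apply Rplus_le_compat; apply Cmod_triangle|].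
    rewrite !Cmod_opp, !Cmod_mult, !Cmod_R, !Rabs_right by lra. lra. }
  assert (X1 : 1 <= exp (2 * a)) by (rewrite <- exp_0; apply exp_le; lra).
  assert (X2 : 1 <= exp (a * y / 2)) by (rewrite <- exp_0; apply exp_le; nra).
  assert (X3 : 1 <= exp (2 * a) * exp (a * y / 2)) by nra.
  assert (M2 : 2 <= M) by (unfold M; assert (0 <= sqrt a * y) by nra; nra).
  apply Rle_trans with (/ sqrt a * (5 * M)).
  { assert (0 < / sqrt a) by pos. nra. }
  unfold K, M, Rdiv.
  replace (5 * / sqrt a * ((2 + 3 * sqrt a) * exp (2 * a)) * ((1 + y) * exp (a * y * / 2)))
    with (/ sqrt a * (5 * ((2 + 3 * sqrt a) * (1 + y) * (exp (2 * a) * exp (a * y * / 2))))) by ring.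
  apply Rmult_le_compat_l; [left; now apply Rinv_0_lt_compat|].
  apply Rmult_le_compat_l; [lra|]. apply Rmult_le_compat_r; [unfold Rdiv in X3; lra|]. nra.
Qed.

(** Everything is expressed through w by tau = i w^2; the sign comes from 1/i^2. *)
Lemma polar_main_peak (m : Z) P (r n : Z) y v x : (1 <= m)%Z -> 0 < v ->
  y ^ 2 = IZR (4 * m * n - r * r) ->
  (polar_main m P r (x, v) (sqrt_line v x) * e2pi (- (n * (x, v))))%C =
  (- main_sum m P r / RtoC (sqrt (2 * m)) * peak (PI / (2 * m)) y v x)%C.
Proof.
  intros Hm Hv Hy. assert (Hm' := IZR_le _ _ Hm).
  assert (W := sqrt_line_neq_0 v x Hv). assert (Ew := sqrt_line_sqr v x Hv).
  set (w := sqrt_line v x) in *. set (tau := ((x, v) : C)) in *.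
  assert (II : (Ci * Ci = - RtoC 1)%C) by (apply Ceq; simpl; ring).
  assert (I0 : Ci <> RtoC 0) by (intros E; apply (f_equal Im) in E; simpl in E; lra).
  assert (Et : tau = (Ci * (w * w))%C).
  { rewrite Ew. replace (Ci * (- Ci * tau))%C with (- (Ci * Ci) * tau)%C by ring. rewrite II; ring. }
  assert (M0 : RtoC m <> RtoC 0) by (apply RtoC_neq_0; lra).
  assert (Sm : RtoC (sqrt (2 * m)) <> RtoC 0).
  { apply RtoC_neq_0. assert (0 < sqrt (2 * m)) by pos. lra. }
  assert (Hy' : (RtoC y * RtoC y = RtoC 4 * m * n - r * r)%C).
  { rewrite <- !RtoC_mult, <- RtoC_minus. f_equal.
    replace (y * y) with (y ^ 2) by ring. rewrite Hy, minus_IZR, !mult_IZR. ring. }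
  unfold polar_main, peak. fold w.
  transitivity (/ (tau * tau) * (w / RtoC (sqrt (2 * m))) * main_sum m P r *
    (e2pi (/ (RtoC (4 * m) * tau)) * e2pi (RtoC (r * r / (4 * m)) * tau) * e2pi (- (n * tau))))%C;
    [ring|].
  rewrite <- !e2pi_plus.
  assert (EX : e2pi (/ (RtoC (4 * m) * tau) + RtoC (r * r / (4 * m)) * tau + - (n * tau)) =
    Cexp (RtoC (PI / (2 * m)) / (w * w) + RtoC (PI / (2 * m) * y ^ 2) * (w * w))).
  { unfold e2pi; f_equal. rewrite Et.
    replace (y ^ 2) with (y * y) by ring.
    unfold Rdiv. rewrite !RtoC_mult, !RtoC_inv, !RtoC_mult, Hy' by lra.
    transitivity (RtoC PI / (RtoC 2 * m) / (w * w) +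
      (Ci * Ci) * (RtoC 2 * PI * ((r * r / (RtoC 4 * m)) - n) * (w * w)))%C.
    - field; repeat split; auto.
    - rewrite II. field; repeat split; auto. }
  rewrite EX, Et.
  transitivity (/ (Ci * Ci) * (/ (w * w * w) * / RtoC (sqrt (2 * m))) * main_sum m P r *
    Cexp (RtoC (PI / (2 * m)) / (w * w) + RtoC (PI / (2 * m) * y ^ 2) * (w * w)))%C.
  - field; repeat split; auto.
  - rewrite II. field; repeat split; auto.
Qed.

Lemma is_RInt_arc v e : 0 < v -> exists S, S <= 2 /\
  is_RInt (fun x => arc v (2 * x + e)) (-1 / 2) (1 / 2) S.
Proof.
  intros Hv. assert (S0 : 0 < sqrt v) by pos.
  assert (SS : sqrt v * sqrt v = v) by (apply sqrt_sqrt; lra).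
  assert (Pi4 := PI_4).
  set (F := fun x => / 2 * atan ((2 * x + e) / (v * sqrt v))).
  exists (minus (F (1 / 2)) (F (-1 / 2))). split.
  - unfold F, minus, plus, opp; simpl.
    assert (B1 := atan_bound ((2 * (1 / 2) + e) / (v * sqrt v))).
    assert (B2 := atan_bound ((2 * (-1 / 2) + e) / (v * sqrt v))). lra.
  - assert (V3 : v ^ 3 = (v * sqrt v) * (v * sqrt v)) by pos.
    assert (N : 0 < v * sqrt v) by pos.
    assert (Nz : forall x, v * sqrt v * (v * sqrt v) + (2 * x + e) ^ 2 <> 0).
    { intros x. generalize (pow2_ge_0 (2 * x + e)); nra. }
    apply (is_RInt_derive (V := R_CompleteNormedModule)); intros x _.
    + unfold F, arc. rewrite V3. specialize (Nz x). auto_derive; [exact I|].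
      unfold Rsqr. field. repeat split; try lra;
        intros E; apply Nz; rewrite <- E; ring.
    + apply (ex_derive_continuous (K := R_AbsRing) (V := R_NormedModule)).
      unfold arc. rewrite V3. specialize (Nz x). auto_derive.
      intros E; apply Nz; rewrite <- E; ring.
Qed.

Lemma sqr_le_exp t : 0 <= t -> t ^ 2 <= 4 * exp t.
Proof.
  intros Ht. assert (H := exp_ineq1_le (t / 2)).
  assert (E : exp t = exp (t / 2) * exp (t / 2)) by (rewrite <- exp_plus; f_equal; field).
  rewrite E. nra.
Qed.

(** [c] enters only through mean values of [H] with Delta > 0, so that weak forms and completions of
    mock forms are treated alike. *)
Lemma circle_asymptotics (m : Z) H phi P B (c : Z -> Z -> C) (r : Z) :
  (1 <= m)%Z -> J1 m phi -> z_expansion H phi -> 0 <= B ->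
  (forall rho, Cmod (P rho) <= B) -> (forall rho k, P (rho + 2 * m * k)%Z = P rho) ->
  cusp_bound m H P B ->
  (forall n v, (0 < 4 * m * n - r * r)%Z -> 0 < v ->
    is_CInt (fun x => H (x, v) r * e2pi (- (n * (x, v))))%C (-1 / 2) (1 / 2) (c n r)) ->
  exists K, forall n : Z, (100 <= 4 * m * n - r * r)%Z ->
    Cmod (c n r + main_sum m P r * RtoC (exp (PI * sqrt (IZR (4 * m * n - r * r)) / m)))%C <=
    K * exp (PI * sqrt (IZR (4 * m * n - r * r)) / (2 * m)).
Proof.
  intros Hm HJ HE HB HP Hper HC Hc. assert (Hm' := IZR_le _ _ Hm).
  assert (Pi0 := PI_RGT_0).
  set (a := PI / (2 * m)). assert (Ha : 0 < a) by pos.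
  destruct (zcoef_remainder_bound m H phi P B r Hm HJ HE HB HP Hper HC) as [K1 [K10 HK1]]. fold a in HK1.
  destruct (peak_integral_bound a Ha) as [K2 [K20 HK2]].
  set (kap := (- main_sum m P r / RtoC (sqrt (2 * m)))%C).
  (* The excess of |q^(-n)| over exp(a y/2), due to the r^2 in n = (Delta + r^2)/(4m), for v <=
     1. *)
  set (R0 := exp (PI * (r * r) / (2 * m))).
  assert (R00 : 0 < R0) by pos.
  set (L := K1 * R0 * (256 / a ^ 2 + 4)).
  exists (L + Cmod kap * (K2 * (1 + 2 / a))).
  intros n Hn. set (D := IZR (4 * m * n - r * r)). set (y := sqrt D).
  assert (HD : 100 <= D) by (apply IZR_le; exact Hn).
  assert (Hyy : y * y = D) by (apply sqrt_sqrt; lra).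
  (* The threshold 100 is chosen for y >= 10, which implies v <= 1/9 and y >= 4 as the two estimates
     require. *)
  assert (Hy : 10 <= y).
  { unfold y; replace 10 with (sqrt (10 * 10)) by (apply sqrt_square; lra). apply sqrt_le_1; lra. }
  set (v := / (2 * y)).
  assert (Hv : 0 < v <= 1 / 9).
  { unfold v; split; [apply Rinv_0_lt_compat; lra|].
    replace (1 / 9) with (/ 9) by field. apply Rinv_le_contravar; lra. }
  replace (PI * y / m) with (2 * a * y) by (unfold a; field; lra).
  replace (PI * y / (2 * m)) with (a * y) by (unfold a; field; lra).
  assert (Hcn := Hc n v ltac:(lia) (proj1 Hv)).
  assert (Hpk := is_CInt_peak a y v Ha (proj1 Hv)).
  set (S := (Ci / RtoC (sqrt a) * (peak_prim a y v (1 / 2) - peak_prim a y v (-1 / 2)))%C) in Hpk.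
  assert (HS := HK2 y v S ltac:(lra) eq_refl Hpk).
  assert (Sa : sqrt PI / sqrt a = sqrt (2 * m)).
  { rewrite <- sqrt_div by lra. f_equal. unfold a; field; lra. }
  rewrite Sa in HS.
  assert (Sm : 0 < sqrt (2 * m)) by pos.
  assert (Hkap : (kap * RtoC (sqrt (2 * m) * exp (2 * a * y)) =
     - (main_sum m P r * RtoC (exp (2 * a * y))))%C).
  { unfold kap; rewrite RtoC_mult. field. apply RtoC_neq_0; lra. }
  replace (c n r + main_sum m P r * RtoC (exp (2 * a * y)))%C
    with ((c n r + - (kap * S)) + kap * (S - RtoC (sqrt (2 * m) * exp (2 * a * y))))%C
    by (transitivity (c n r + - (kap * RtoC (sqrt (2 * m) * exp (2 * a * y))))%C;
        [ring|rewrite Hkap; ring]).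
  eapply Rle_trans; [apply Cmod_triangle|]. rewrite Rmult_plus_distr_r.
  (* [E] is at once the size of q^(-n), the exponential size on the arcs of denominator 2 and that
     of the end point error. The target exp(a y) is the square of [E], so the end point error has a
     factor [E] to spare for 1 + y. *)
  set (E := exp (a * y / 2)).
  assert (EE : exp (a * y) = E * E) by (unfold E; rewrite <- exp_plus; f_equal; field).
  assert (E0 : 0 < E) by pos.
  assert (Hy2 : 1 + y <= (1 + 2 / a) * E).
  { assert (HE1 := exp_ineq1_le (a * y / 2)). fold E in HE1.
    assert (0 < / a) by pos.
    assert (y = 2 / a * (a * y / 2)) by (field; lra).
    assert (y <= 2 / a * E) by pos.
    assert (1 <= E) by nra. lra. }
  apply Rplus_le_compat.
  2: { rewrite Cmod_mult, EE.
       replace (Cmod kap * (K2 * (1 + 2 / a)) * (E * E))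
         with (Cmod kap * (K2 * (((1 + 2 / a) * E) * E))) by ring.
       apply Rmult_le_compat_l; [apply Cmod_ge_0|].
       eapply Rle_trans; [exact HS|]. fold E.
       apply Rmult_le_compat_l; [auto|]. apply Rmult_le_compat_r; lra. }
  destruct (is_RInt_arc v 1 (proj1 Hv)) as [S1 [HS1 IS1]].
  destruct (is_RInt_arc v (-1) (proj1 Hv)) as [S2 [HS2 IS2]].
  set (q1 := / v ^ 2 * exp (a / (8 * v))). set (q2 := exp (a / (4 * v))).
  assert (Q2 : q2 = E) by (unfold q2, E, v; f_equal; field; lra).
  assert (HB1 : Cmod (c n r + - (kap * S))%C <= K1 * (E * R0) * (q1 + q2 * (S1 + S2))).
  { apply (Cmod_CInt_le (fun x => H (x, v) r * e2pi (- (n * (x, v))) + - (kap * peak a y v x))%C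
      (fun x => K1 * (E * R0) * (q1 + q2 * (arc v (2 * x + 1) + arc v (2 * x - 1)))) (-1 / 2) (1 / 2)).
    - lra.
    - intros x Hx.
      assert (Hpp := polar_main_peak m P r n y v x Hm (proj1 Hv)
        ltac:(replace (y ^ 2) with (y * y) by ring; exact Hyy)).
      fold a kap in Hpp. rewrite <- Hpp.
      replace (H (x, v) r * e2pi (- (n * (x, v))) +
        - (polar_main m P r (x, v) (sqrt_line v x) * e2pi (- (n * (x, v)))))%C
        with ((H (x, v) r - polar_main m P r (x, v) (sqrt_line v x)) * e2pi (- (n * (x, v))))%C by ring.
      rewrite Cmod_mult. rewrite Rmult_assoc, (Rmult_comm (E * R0)), <- Rmult_assoc.
      apply Rmult_le_compat; [apply Cmod_ge_0|apply Cmod_ge_0| |].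
      + apply HK1; auto; [apply sqrt_line_sqr|apply Re_sqrt_line]; lra.
      + rewrite Cmod_e2pi, Im_opp, Im_scal. simpl (Im (x, v)).
        unfold E, R0; rewrite <- exp_plus. apply exp_le.
        replace (IZR n) with ((D + r * r) / (4 * m))
          by (unfold D; rewrite minus_IZR, !mult_IZR; field; lra).
        rewrite <- Hyy. unfold a.
        replace (- (2 * PI * - ((y * y + r * r) / (4 * m) * v)))
          with (PI / (2 * m) * (y * y) * v + PI * (r * r) / (2 * m) * v) by (field; lra).
        apply Rplus_le_compat.
        * right; unfold v; field; lra.
        * rewrite <- (Rmult_1_r (PI * (r * r) / (2 * m))) at 2.
          apply Rmult_le_compat_l; [|lra]. apply Rdiv_le_0_compat; nra.
    - apply is_CInt_plus; [exact Hcn|].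
      replace (- (kap * S))%C with ((- kap) * S)%C by ring.
      apply (is_CInt_ext (fun x => (- kap) * peak a y v x)%C); [lra| |].
      + intros x _. eqC; ring.
      + apply is_CInt_scal, Hpk.
    - assert (HI : is_RInt (fun x => plus q1 (scal q2 (plus (arc v (2 * x + 1)) (arc v (2 * x + -1)))))
        (-1 / 2) (1 / 2) (plus (scal (1 / 2 - -1 / 2) q1) (scal q2 (plus S1 S2)))).
      { apply (is_RInt_plus (V := R_NormedModule)); [apply (is_RInt_const (V := R_NormedModule))|].
        apply (is_RInt_scal (V := R_NormedModule)), (is_RInt_plus (V := R_NormedModule)); auto. }
      apply (is_RInt_scal (V := R_NormedModule) _ _ _ (K1 * (E * R0))) in HI.
      replace (K1 * (E * R0) * (q1 + q2 * (S1 + S2))) with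
        (scal (K1 * (E * R0)) (plus (scal (1 / 2 - -1 / 2) q1) (scal q2 (plus S1 S2)))).
      + exact HI.
      + unfold scal, plus; simpl; unfold mult; simpl; eqR. field. }
  eapply Rle_trans; [exact HB1|]. unfold L. rewrite EE.
  (* 1/v^2 is of order y^2 but comes with exp(a y/4) only; the other half of the exponent of [E]
     absorbs it. *)
  assert (Q1 : q1 <= 256 / a ^ 2 * E).
  { unfold q1. replace (/ v ^ 2) with (4 * y ^ 2) by (unfold v; field; lra).
    replace (a / (8 * v)) with (a * y / 4) by (unfold v; field; lra).
    assert (X := sqr_le_exp (a * y / 4) ltac:(apply Rdiv_le_0_compat; nra)).
    assert (E' : E = exp (a * y / 4) * exp (a * y / 4)) by (unfold E; rewrite <- exp_plus; f_equal; field).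
    rewrite E', <- Rmult_assoc. apply Rmult_le_compat_r; [left; apply exp_pos|].
    replace (4 * y ^ 2) with (64 / a ^ 2 * (a * y / 4) ^ 2) by (field; lra).
    replace (256 / a ^ 2 * exp (a * y / 4)) with (64 / a ^ 2 * (4 * exp (a * y / 4))) by (field; lra).
    apply Rmult_le_compat_l; [apply Rdiv_le_0_compat; [lra|apply pow_lt; lra]|exact X]. }
  replace (K1 * R0 * (256 / a ^ 2 + 4) * (E * E)) with (K1 * (E * R0) * (256 / a ^ 2 * E + E * 4)) by ring.
  apply Rmult_le_compat_l.
  - apply Rmult_le_pos; [auto|]. apply Rmult_le_pos; lra.
  - rewrite Q2. apply Rplus_le_compat; [exact Q1|]. apply Rmult_le_compat_l; lra.
Qed.

(** * Weak elliptic forms of optimal growth *)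

Definition zcoef (c : Z -> Z -> C) (tau : C) (rho : Z) : C :=
  Csum (fun n : Z => c n rho * qpow n tau)%C.

Lemma is_Csum_zcoef phi c tau rho : fourier_expansion phi c -> in_H tau ->
  is_Csum (fun n : Z => c n rho * qpow n tau)%C (zcoef c tau rho).
Proof.
  intros [_ He] Ht.
  destruct (is_Csum_fst_fiber _ _ (He tau 0 Ht) rho) as [t Hs].
  apply Csum_correct with t. eapply is_Csum_ext; [|exact Hs].
  intros n; simpl. rewrite Cmult_0_r, e2pi_0; ring.
Qed.

Lemma z_expansion_zcoef phi c : fourier_expansion phi c -> z_expansion (zcoef c) phi.
Proof.
  intros He tau z Ht.
  apply (is_Csum_fibers _ _ (fun rho => zcoef c tau rho * e2pi (rho * z))%C (proj2 He tau z Ht)).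
  intros rho; simpl. rewrite (Cmult_comm (zcoef _ _ _)).
  eapply is_Csum_ext; [|apply is_Csum_scal, (is_Csum_zcoef phi c tau rho He Ht)].
  intros n; cbv beta; ring.
Qed.

Lemma z_expansion_unique H H' phi tau rho :
  z_expansion H phi -> z_expansion H' phi -> in_H tau -> H tau rho = H' tau rho.
Proof.
  intros E E' Ht.
  exact (is_CInt_unique _ _ _ _ _ (z_extraction H phi tau rho 0 E Ht)
           (z_extraction H' phi tau rho 0 E' Ht)).
Qed.

Lemma qpow_plus x y tau : qpow (x + y) tau = (qpow x tau * qpow y tau)%C.
Proof. unfold qpow; rewrite <- e2pi_plus, RtoC_plus; f_equal; ring. Qed.

Lemma qpow_0 tau : qpow 0 tau = RtoC 1.
Proof. unfold qpow; rewrite Cmult_0_l; apply e2pi_0. Qed.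

(** phi(tau, t + k tau) is expanded in t both directly and by the elliptic law, where the
    frequencies are shifted by 2mk; the coefficients of frequency [rho] are compared. *)
Lemma zcoef_quasi_period m phi c tau rho k : fourier_expansion phi c -> elliptic m phi -> in_H tau ->
  zcoef c tau (rho + 2 * m * k)%Z = (qpow (rho * k + m * (k * k))%Z tau * zcoef c tau rho)%C.
Proof.
  intros He Hel Ht. assert (HE := z_expansion_zcoef phi c He).
  destruct (fourier_extraction (fun j : Z => zcoef c tau j * qpow (j * k)%Z tau)%C (fun j => j)
    (fun t => phi tau (t + k * tau + 0%Z)%C) 0 rho) as [S [S1 S2]].
  { intros t _. eapply is_Csum_ext; [|apply HE, Ht]. intros j; cbv beta.
    unfold qpow. rewrite <- Cmult_assoc, <- e2pi_plus. do 2 f_equal.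
    rewrite mult_IZR, !RtoC_mult. ring. }
  destruct (fourier_extraction (fun j : Z => zcoef c tau j * qpow (- (m * (k * k)))%Z tau)%C
    (fun j => (j - 2 * m * k)%Z)
    (fun t => phi tau (t + k * tau + 0%Z)%C) 0 rho) as [T [T1 T2]].
  { intros t _. rewrite (Hel k 0%Z tau t Ht).
    eapply is_Csum_ext; [|apply is_Csum_scal, HE, Ht]. intros j; cbv beta.
    unfold qpow.
    transitivity (zcoef c tau j * (e2pi (- (m * ((k * k)%Z * tau + RtoC 2 * k * t))) * e2pi (j * t)))%C;
      [ring|].
    transitivity (zcoef c tau j * (e2pi ((- (m * (k * k)))%Z * tau) *
      e2pi (RtoC (IZR (j - 2 * m * k) * t))))%C; [|ring].
    rewrite <- !e2pi_plus. do 2 f_equal.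
    rewrite opp_IZR, minus_IZR, !mult_IZR.
    rewrite !RtoC_mult, RtoC_opp, RtoC_minus, !RtoC_mult. ring. }
  assert (E1 := is_Csum_unique _ _ _ S2
    (is_Csum_single (fun j : Z => zcoef c tau j * qpow (j * k)%Z tau)%C rho)).
  assert (E2 : T = (zcoef c tau (rho + 2 * m * k)%Z * qpow (- (m * (k * k)))%Z tau)%C).
  { refine (is_Csum_unique _ _ _ T2 _).
    eapply is_Csum_ext; [|exact (is_Csum_single
      (fun j : Z => zcoef c tau j * qpow (- (m * (k * k)))%Z tau)%C (rho + 2 * m * k)%Z)].
    intros j; cbv beta. destruct (Z.eq_dec j (rho + 2 * m * k)), (Z.eq_dec (j - 2 * m * k) rho);
      auto; lia. }
  rewrite (is_CInt_unique _ _ _ _ _ S1 T1), E2 in E1.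
  rewrite plus_IZR, qpow_plus.
  transitivity (qpow (m * (k * k))%Z tau * (zcoef c tau rho * qpow (rho * k)%Z tau))%C; [|ring].
  rewrite <- E1. rewrite (Cmult_comm (zcoef _ _ _)), Cmult_assoc, <- qpow_plus, <- plus_IZR.
  replace (m * (k * k) + - (m * (k * k)))%Z with 0%Z by ring. rewrite qpow_0; ring.
Qed.

Lemma tau_extraction phi c (rho n : Z) v x0 : fourier_expansion phi c -> 0 < v ->
  is_CInt (fun x => zcoef c (x, v) rho * e2pi (- (n * (x, v))))%C x0 (x0 + 1) (c n rho).
Proof.
  intros He Hv.
  assert (Ex : forall (k : Z) x, qpow k (x, v) = (qpow k (0, v) * e2pi (RtoC (k * x)))%C).
  { intros k x; unfold qpow; rewrite <- e2pi_plus; f_equal. apply Ceq; simpl; ring. }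
  destruct (fourier_extraction (fun k : Z => c k rho * qpow k (0, v))%C (fun k => k)
    (fun x => zcoef c (x, v) rho) x0 n) as [S [S1 S2]].
  { intros x _. eapply is_Csum_ext; [|apply (is_Csum_zcoef phi)]; auto.
    intros k; cbv beta. rewrite Ex; ring. }
  rewrite (is_Csum_unique _ _ _ S2 (is_Csum_single (fun k : Z => c k rho * qpow k (0, v))%C n)) in S1.
  apply (is_CInt_scal (e2pi (- (n * (0, v))))) in S1.
  replace (e2pi (- (n * (0, v))) * (c n rho * qpow n (0, v)))%C with (c n rho) in S1.
  - revert S1; apply is_CInt_ext; [lra|]. intros x _.
    eqC.
    transitivity (zcoef c (x, v) rho * (e2pi (RtoC (- (n * x))) * e2pi (- (n * (0, v)))))%C; [ring|].
    rewrite <- e2pi_plus. do 2 f_equal. apply Ceq; simpl; ring.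
  - unfold qpow. transitivity (c n rho * (e2pi (n * (0, v)) * e2pi (- (n * (0, v)))))%C; [|ring].
    rewrite e2pi_opp; ring.
Qed.

(** Both index pairs have the same Delta = 4mn - rho^2: this is the dependence of C_phi on Delta and
    on r modulo 2m alone. *)
Lemma coefficient_period (m : Z) phi c (n rho k : Z) : fourier_expansion phi c -> elliptic m phi ->
  c (n + rho * k + m * (k * k))%Z (rho + 2 * m * k)%Z = c n rho.
Proof.
  intros He Hel.
  refine (is_CInt_unique _ _ _ _ _ (tau_extraction phi c _ _ 1 0 He Rlt_0_1) _).
  generalize (tau_extraction phi c rho n 1 0 He Rlt_0_1).
  apply is_CInt_ext; [lra|]. intros x _.
  rewrite (zcoef_quasi_period m phi c (x, 1) rho k He Hel) by (unfold in_H; simpl; lra).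
  unfold qpow. eqC.
  transitivity (zcoef c (x, 1%R) rho * (e2pi ((rho * k + m * (k * k))%Z * (x, 1%R)) *
    e2pi (- ((n + rho * k + m * (k * k))%Z * (x, 1%R)))))%C; [|ring].
  rewrite <- e2pi_plus. do 2 f_equal. rewrite !plus_IZR, !RtoC_plus; ring.
Qed.

(** Extended by 0 to the classes where Delta = -1 is not admissible, so as to be a 2m-periodic
    function on all of Z. *)
Definition polar (m : Z) (c : Z -> Z -> C) (rho : Z) : C :=
  if ((rho * rho - 1) mod (4 * m) =? 0)%Z then Ccoef m c (-1) rho else RtoC 0.

Lemma polar_period m phi c rho k : (1 <= m)%Z -> fourier_expansion phi c -> elliptic m phi ->
  polar m c (rho + 2 * m * k)%Z = polar m c rho.
Proof.
  intros Hm He Hel; unfold polar, Ccoef.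
  replace ((rho + 2 * m * k) * (rho + 2 * m * k) - 1)%Z
    with (rho * rho - 1 + (rho * k + m * (k * k)) * (4 * m))%Z by ring.
  rewrite Z.mod_add by lia. destruct (_ =? 0)%Z; auto.
  replace (-1 + (rho + 2 * m * k) * (rho + 2 * m * k))%Z
    with (-1 + rho * rho + (rho * k + m * (k * k)) * (4 * m))%Z by ring.
  rewrite Z.div_add by lia. rewrite Z.add_assoc. now apply (coefficient_period m phi).
Qed.

Lemma residue_decomp m rho : (1 <= m)%Z ->
  exists l k, (rho = l + 2 * m * k)%Z /\ l = (rho mod (2 * m))%Z /\ In l (residues (2 * m)).
Proof.
  intros Hm. exists (rho mod (2 * m))%Z, (rho / (2 * m))%Z.
  split; [|split; auto].
  - generalize (Z.div_mod rho (2 * m) ltac:(lia)); lia.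
  - rewrite residues_zrange, in_zrange. generalize (Z.mod_pos_bound rho (2 * m) ltac:(lia)); lia.
Qed.

Lemma list_bound {I} (Q : I -> R -> Prop) (l : list I) :
  (forall i K K', K <= K' -> Q i K -> Q i K') -> (forall i, In i l -> exists K, Q i K) ->
  exists K, 0 <= K /\ forall i, In i l -> Q i K.
Proof.
  intros Hm; induction l as [|i l IH]; intros H; [exists 0; split; [lra|intros i []]|].
  destruct IH as [K [K0 HK]]; [intros; apply H; now right|].
  destruct (H i (or_introl eq_refl)) as [K' HK'].
  exists (Rmax K K'); split; [eapply Rle_trans; [exact K0|apply Rmax_l]|].
  intros j [<-|Hj]; eapply Hm; eauto; [apply Rmax_r|apply Rmax_l].
Qed.

Lemma polar_bound m phi c : (1 <= m)%Z -> fourier_expansion phi c -> elliptic m phi ->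
  exists B, 0 <= B /\ forall rho, Cmod (polar m c rho) <= B.
Proof.
  intros Hm He Hel.
  destruct (list_bound (fun l K => Cmod (polar m c l) <= K) (residues (2 * m))) as [B [B0 HB]].
  - intros; lra.
  - intros l _; exists (Cmod (polar m c l)); lra.
  - exists B; split; auto. intros rho.
    destruct (residue_decomp m rho Hm) as [l [k [-> [_ Hl]]]].
    rewrite (polar_period m phi) by auto. auto.
Qed.

Lemma coefficient_vanish m c n l : (1 <= m)%Z -> optimal_growth m c ->
  (4 * m * n - l * l < -1)%Z -> c n l = RtoC 0.
Proof.
  intros Hm Ho H. rewrite <- (Ho (4 * m * n - l * l)%Z l); auto.
  - unfold Ccoef. f_equal. replace (4 * m * n - l * l + l * l)%Z with (n * (4 * m))%Z by ring.
    rewrite Z.div_mul; lia.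
  - exists n; ring.
Qed.

(** Comparison with the absolutely convergent series at i/2: once |q^(l^2/4m)| is split off, a term
    with Delta >= 0 can only decrease as Im tau grows. The term with Delta = -1 is subtracted and
    those below vanish. *)
Lemma cusp_bound_residue m phi c l : (1 <= m)%Z -> fourier_expansion phi c -> optimal_growth m c ->
  exists B, forall tau, 1 / 2 <= Im tau ->
    Cmod (zcoef c tau l - polar m c l * qpow ((l * l - 1) / (4 * m)) tau)%C <=
    B * exp (- (2 * PI * Im tau * (l * l / (4 * m)))).
Proof.
  intros Hm He Ho. assert (Hm' := IZR_le _ _ Hm). assert (Pi := PI_RGT_0).
  assert (Ht0 : in_H (0, 1 / 2)) by pos.
  destruct (is_Csum_abs _ _ (is_Csum_zcoef phi c (0, 1 / 2) l He Ht0)) as [B HB].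
  exists (B * exp (PI * (l * l / (4 * m)))). intros tau Hv.
  assert (Ht : in_H tau) by (unfold in_H; lra).
  (* The only n that can have Delta = -1. If 4m does not divide l^2 - 1 the quotient is rounded, but
     then [polar] is 0. *)
  set (n0 := ((-1 + l * l) / (4 * m))%Z).
  assert (Hs : is_Csum (fun n : Z => c n l * qpow n tau + (-1) *
     (if Z.eq_dec n n0 then polar m c l * qpow ((l * l - 1) / (4 * m)) tau else RtoC 0))%C
     (zcoef c tau l + (-1) * (polar m c l * qpow ((l * l - 1) / (4 * m)) tau))%C).
  { apply is_Csum_plus; [apply (is_Csum_zcoef phi); auto|apply is_Csum_scal].
    apply (is_Csum_single (fun _ => polar m c l * qpow ((l * l - 1) / (4 * m)) tau)%C n0). }
  replace (zcoef c tau l - polar m c l * qpow ((l * l - 1) / (4 * m)) tau)%C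
    with (zcoef c tau l + (-1) * (polar m c l * qpow ((l * l - 1) / (4 * m)) tau))%C by ring.
  apply (Cmod_is_Csum_le _ _ _ Hs).
  set (e := exp (PI * (l * l / (4 * m))) * exp (- (2 * PI * Im tau * (l * l / (4 * m))))).
  assert (He0 : 0 < e) by pos.
  assert (G : forall n : Z, Cmod (c n l * qpow n tau + (-1) *
     (if Z.eq_dec n n0 then polar m c l * qpow ((l * l - 1) / (4 * m)) tau else RtoC 0))%C <=
     e * Cmod (c n l * qpow n (0, 1 / 2)%R)%C).
  { intros n.
    assert (N0 : 0 <= e * Cmod (c n l * qpow n (0, 1 / 2)%R)%C) by pos.
    assert (Hlarge : (0 <= 4 * m * n - l * l)%Z -> Cmod (c n l * qpow n tau) <=
       e * Cmod (c n l * qpow n (0, 1 / 2)%R)%C).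
    { intros HD. rewrite !Cmod_mult, !Cmod_qpow. simpl (Im (0, 1 / 2)).
      rewrite <- (Rmult_assoc e), (Rmult_comm e), (Rmult_assoc (Cmod (c n l)) e).
      apply Rmult_le_compat_l; [apply Cmod_ge_0|].
      unfold e. rewrite <- !exp_plus. apply exp_le.
      set (v := Im tau) in *.
      assert (HD' : 0 <= n - l * l / (4 * m)).
      { apply IZR_le in HD. rewrite minus_IZR, !mult_IZR in HD.
        apply Rmult_le_reg_r with (4 * m); [lra|].
        replace ((n - l * l / (4 * m)) * (4 * m)) with (4 * m * n - l * l) by (field; lra). lra. }
      assert (0 <= 2 * PI * ((v - 1 / 2) * (n - l * l / (4 * m)))) by pos.
      lra. }
    destruct (Z.eq_dec n n0) as [E|E].
    - unfold polar. destruct (((l * l - 1) mod (4 * m) =? 0)%Z) eqn:Em.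
      + apply Z.eqb_eq in Em. apply Z.mod_divide in Em; [|lia]. destruct Em as [q Hq].
        assert (En : n0 = q).
        { unfold n0. replace (-1 + l * l)%Z with (q * (4 * m))%Z by lia. apply Z.div_mul; lia. }
        unfold Ccoef. fold n0. rewrite E.
        replace (qpow n0 tau) with (qpow ((l * l - 1) / (4 * m)) tau).
        * replace (_ + _)%C with (RtoC 0) by ring. rewrite Cmod_0.
          rewrite E in N0. exact N0.
        * f_equal. rewrite En. replace (l * l - 1) with (IZR (l * l - 1)) by (rewrite minus_IZR, mult_IZR; reflexivity).
          rewrite Hq, !mult_IZR. field; lra.
      + replace (_ + _)%C with (c n l * qpow n tau)%C by ring.
        destruct (Z_lt_ge_dec (4 * m * n - l * l) (-1)) as [H1|H1].
        * rewrite (coefficient_vanish m c n l Hm Ho H1), !Cmult_0_l, Cmod_0, Rmult_0_r; lra.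
        * apply Hlarge. apply Z.eqb_neq in Em.
          assert (4 * m * n - l * l <> -1)%Z; [|lia]. intros H2. apply Em.
          replace (l * l - 1)%Z with (n * (4 * m))%Z by lia. apply Z.mod_mul; lia.
    - replace (_ + _)%C with (c n l * qpow n tau)%C by ring.
      destruct (Z_lt_ge_dec (4 * m * n - l * l) (-1)) as [H1|H1].
      + rewrite (coefficient_vanish m c n l Hm Ho H1), !Cmult_0_l, Cmod_0, Rmult_0_r; lra.
      + apply Hlarge. assert (4 * m * n - l * l <> -1)%Z; [|lia]. intros H2. apply E.
        unfold n0. replace (-1 + l * l)%Z with (n * (4 * m))%Z by lia. rewrite Z.div_mul; lia. }
  intros L HL. eapply Rle_trans; [apply rsum_le; intros n _; apply G|].
  rewrite rsum_scal.
  replace (B * exp (PI * (l * l / (4 * m))) * exp (- (2 * PI * Im tau * (l * l / (4 * m)))))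
    with (e * B) by (unfold e; ring).
  apply Rmult_le_compat_l; [lra|]. apply HB, HL.
Qed.

(** Within a class modulo 2m the quasi-period factor multiplies coefficient, polar term and Gaussian
    alike, so finitely many constants suffice. *)
Lemma cusp_bound_zcoef m phi c : (1 <= m)%Z -> fourier_expansion phi c -> elliptic m phi ->
  optimal_growth m c -> exists B, 0 <= B /\ cusp_bound m (zcoef c) (polar m c) B.
Proof.
  intros Hm He Hel Ho. assert (Hm' := IZR_le _ _ Hm).
  destruct (list_bound (fun (l : Z) B => forall tau, 1 / 2 <= Im tau ->
    Cmod (zcoef c tau l - polar m c l * qpow ((l * l - 1) / (4 * m)) tau)%C <=
    B * exp (- (2 * PI * Im tau * (l * l / (4 * m))))) (residues (2 * m))) as [B [B0 HB]].
  - intros l K K' HK H tau Hv. eapply Rle_trans; [now apply H|].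
    apply Rmult_le_compat_r; [left; apply exp_pos|auto].
  - intros l _; now apply (cusp_bound_residue m phi).
  - exists B; split; auto. intros tau rho Hv.
    assert (Ht : in_H tau) by (unfold in_H; lra).
    destruct (residue_decomp m rho Hm) as [l [k [-> [_ Hl]]]].
    rewrite (zcoef_quasi_period m phi), (polar_period m phi) by auto.
    replace ((IZR (l + 2 * m * k) * IZR (l + 2 * m * k) - 1) / (4 * m))
      with (IZR (l * k + m * (k * k)) + (l * l - 1) / (4 * m))
      by (rewrite !plus_IZR, !mult_IZR; field; lra).
    rewrite qpow_plus.
    replace (_ - _)%C with (qpow (IZR (l * k + m * (k * k))) tau *
      (zcoef c tau l - polar m c l * qpow ((l * l - 1) / (4 * m)) tau))%C by ring.
    rewrite Cmod_mult, Cmod_qpow.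
    eapply Rle_trans; [apply Rmult_le_compat_l; [left; apply exp_pos|now apply HB]|].
    right. rewrite (Rmult_comm B), <- Rmult_assoc, <- exp_plus, Rmult_comm. f_equal. f_equal.
    rewrite !plus_IZR, !mult_IZR. field; lra.
Qed.

(** * The non-holomorphic part of a mock Jacobi form *)

(** The integral of a nonnegative function increases with its upper limit and so converges to its
    supremum; convergence is what gives [inc_gamma] a determined value. *)
Lemma is_RInt_gen_of_bounded (f : R -> R) x K :
  (forall t, x <= t -> 0 <= f t) -> (forall t, x <= t -> continuous f t) ->
  (forall y, x <= y -> RInt f x y <= K) ->
  exists L, 0 <= L <= K /\ is_RInt_gen f (at_point x) (Rbar_locally p_infty) L.
Proof.
  intros Hf Hc HK.
  assert (Ex : forall y z, x <= y -> y <= z -> ex_RInt f y z).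
  { intros y z Hy Hz; apply (ex_RInt_continuous (V := R_CompleteNormedModule)).
    rewrite Rmin_left, Rmax_right by auto. intros t Ht; apply Hc; lra. }
  assert (Hmon : forall y z, x <= y -> y <= z -> RInt f x y <= RInt f x z).
  { intros y z Hy Hz. rewrite <- (RInt_Chasles f x y z) by (apply Ex; lra).
    assert (0 <= RInt f y z).
    { apply RInt_ge_0; auto. intros t Ht; apply Hf; lra. }
    unfold plus; simpl; lra. }
  destruct (completeness (fun I => exists y, x <= y /\ I = RInt f x y)) as [L [U1 U2]].
  - exists K; intros I [y [Hy ->]]; auto.
  - exists (RInt f x x), x; split; [lra|reflexivity].
  - exists L. split.
    + split.
      * apply U1. exists x; split; [lra|]. now rewrite RInt_point.
      * apply U2. intros I [y [Hy ->]]; auto.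
    + intros P [eps HP].
      destruct (classic (exists y, x <= y /\ L - eps < RInt f x y)) as [[y0 [Hy0 Hl]]|Hn].
      * apply (Filter_prod _ _ _ (fun a => a = x) (fun b => y0 < b)).
        -- reflexivity.
        -- exists y0; auto.
        -- intros a b -> Hb. exists (RInt f x b). split.
           ++ apply (RInt_correct (V := R_CompleteNormedModule)), Ex; simpl; lra.
           ++ apply HP. change (Rabs (RInt f x b + - L) < eps).
              assert (RInt f x b <= L) by (apply U1; exists b; split; [lra|reflexivity]).
              assert (RInt f x y0 <= RInt f x b) by (apply Hmon; lra).
              apply Rabs_def1; generalize (cond_pos eps); lra.
      * exfalso. assert (L <= L - eps); [|generalize (cond_pos eps); lra].
        apply U2. intros I [y [Hy ->]]. destruct (Rle_lt_dec (RInt f x y) (L - eps)); auto.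
        exfalso; apply Hn; exists y; auto.
Qed.

(** For t >= x the power t^(-3/2) is at most x^(-3/2), and the exponential integrates to exp(-x). *)
Lemma inc_gamma_bound x : 0 < x -> Rabs (inc_gamma (- (1 / 2)) x) <= / (x * sqrt x) * exp (- x).
Proof.
  intros Hx.
  set (f := fun t => Rpower t (- (1 / 2) - 1) * exp (- t)).
  assert (Hf0 : forall t, 0 <= f t).
  { intros t; apply Rmult_le_pos; left; [unfold Rpower|]; apply exp_pos. }
  assert (Hp : Rpower x (- (1 / 2) - 1) = / (x * sqrt x)).
  { replace (- (1 / 2) - 1) with (- (1 + / 2)) by field.
    rewrite Rpower_Ropp, Rpower_plus, Rpower_1, Rpower_sqrt by auto. reflexivity. }
  assert (Hc : forall t, x <= t -> continuous f t).
  { intros t Ht. apply (ex_derive_continuous (K := R_AbsRing) (V := R_NormedModule)).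
    unfold f, Rpower. auto_derive. lra. }
  destruct (is_RInt_gen_of_bounded f x (/ (x * sqrt x) * exp (- x))) as [L [HL1 HL2]]; auto.
  - intros y Hy.
    assert (D : is_RInt (fun t => Rpower x (- (1 / 2) - 1) * exp (- t)) x y
      (minus (- (Rpower x (- (1 / 2) - 1) * exp (- y))) (- (Rpower x (- (1 / 2) - 1) * exp (- x))))).
    { apply (is_RInt_derive (V := R_CompleteNormedModule)
        (fun t => - (Rpower x (- (1 / 2) - 1) * exp (- t)))); intros t _.
      - auto_derive; [exact I|ring].
      - apply (ex_derive_continuous (K := R_AbsRing) (V := R_NormedModule)). auto_derive; exact I. }
    apply Rle_trans with (RInt (fun t => Rpower x (- (1 / 2) - 1) * exp (- t)) x y).
    + apply RInt_le; auto.
      * apply (ex_RInt_continuous (V := R_CompleteNormedModule)).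
        rewrite Rmin_left, Rmax_right by auto. intros t Ht; apply Hc; lra.
      * eexists; exact D.
      * intros t Ht; unfold f. apply Rmult_le_compat_r; [left; apply exp_pos|].
        unfold Rpower. apply exp_le.
        assert (ln x <= ln t) by (apply ln_le; lra). nra.
    + rewrite (is_RInt_unique _ _ _ _ D). rewrite Hp. unfold minus, plus, opp; simpl.
      assert (0 <= / (x * sqrt x) * exp (- y)) by pos.
      lra.
  - unfold inc_gamma. fold f. rewrite (is_RInt_gen_unique _ _ HL2).
    rewrite Rabs_right; lra.
Qed.

Definition star_term (w : nat) (b : nat -> C) (tau : C) (j : nat) : C :=
  let n := (INR (S j) / INR w)%R in
  (RtoC (sqrt n) * Cconj (b (S j)) *
   RtoC (inc_gamma (- (1 / 2)) (4 * PI * n * Im tau)) * qpow (- n) tau)%C.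

(** The factor exp(-4 pi n v) of the incomplete Gamma function outweighs |q^(-n)| = exp(2 pi n v)
    and leaves exp(-2 pi n v), so the series is dominated by that of g at i [v0]. The powers of n
    combine to 1/n <= w. *)
Lemma Cmod_star_term w b tau j v0 : (1 <= w)%nat -> 0 < v0 -> v0 <= Im tau ->
  Cmod (star_term w b tau j) <= INR w / (4 * PI * v0 * sqrt (4 * PI * v0)) *
     Cmod (b (S j) * qpow (INR (S j) / INR w) (0, v0))%C.
Proof.
  intros Hw Hv0 Hv. assert (Pi := PI_RGT_0).
  assert (Hw' : 1 <= INR w) by (apply (le_INR 1); exact Hw).
  assert (Hj : 1 <= INR (S j)) by (rewrite S_INR; generalize (pos_INR j); lra).
  unfold star_term. set (n := INR (S j) / INR w).
  assert (Hn : / INR w <= n).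
  { unfold n, Rdiv. assert (0 < / INR w) by pos. nra. }
  assert (Hw0 : 0 < / INR w) by pos.
  set (v := Im tau) in *.
  set (x := 4 * PI * n * v).
  assert (Hk0 : 0 < 4 * PI * v0) by pos.
  assert (Hk : 4 * PI * v0 <= 4 * PI * v) by pos.
  assert (Hx : 0 < x) by pos.
  rewrite !Cmod_mult, !Cmod_R, Cmod_conj, !Cmod_qpow. fold v. simpl (Im (0, v0)).
  rewrite (Rabs_right (sqrt n)) by (apply Rle_ge, sqrt_pos).
  assert (Sn : 0 < sqrt n) by pos.
  assert (Sk : 0 < sqrt (4 * PI * v0)) by pos.
  assert (Skk : sqrt (4 * PI * v0) <= sqrt (4 * PI * v)) by (apply sqrt_le_1; lra).
  assert (Sx : sqrt x = sqrt (4 * PI * v) * sqrt n).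
  { unfold x. rewrite <- sqrt_mult by lra. f_equal; ring. }
  assert (HG := inc_gamma_bound x Hx).
  apply Rle_trans with (sqrt n * Cmod (b (S j)) * (/ (x * sqrt x) * exp (- x)) *
    exp (- (2 * PI * (- n * v)))).
  { apply Rmult_le_compat_r; [left; apply exp_pos|].
    apply Rmult_le_compat_l; [apply Rmult_le_pos; [lra|apply Cmod_ge_0]|exact HG]. }
  replace (sqrt n * Cmod (b (S j)) * (/ (x * sqrt x) * exp (- x)) * exp (- (2 * PI * (- n * v))))
    with ((sqrt n * / (x * sqrt x)) * (Cmod (b (S j)) * (exp (- x) * exp (- (2 * PI * (- n * v))))))
    by ring.
  apply Rmult_le_compat.
  - apply Rmult_le_pos; [lra|]. left; apply Rinv_0_lt_compat, Rmult_lt_0_compat; auto.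
    now apply sqrt_lt_R0.
  - apply Rmult_le_pos; [apply Cmod_ge_0|]. apply Rmult_le_pos; left; apply exp_pos.
  - rewrite Sx. unfold x.
    replace (sqrt n * / (4 * PI * n * v * (sqrt (4 * PI * v) * sqrt n)))
      with (/ n * / (4 * PI * v * sqrt (4 * PI * v))) by (field; repeat split; lra).
    unfold Rdiv. apply Rmult_le_compat.
    + left; apply Rinv_0_lt_compat; lra.
    + left; apply Rinv_0_lt_compat, Rmult_lt_0_compat; lra.
    + rewrite <- (Rinv_inv (INR w)). apply Rinv_le_contravar; auto.
    + apply Rinv_le_contravar; [apply Rmult_lt_0_compat; lra|].
      apply Rmult_le_compat; lra.
  - apply Rmult_le_compat_l; [apply Cmod_ge_0|]. rewrite <- exp_plus. apply exp_le.
    unfold x. assert (0 <= PI * n * (v - v0)) by pos.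
    lra.
Qed.

Lemma summable_star_terms g w b v0 : (1 <= w)%nat -> q_expansion g w b -> 0 < v0 ->
  exists B, 0 <= B /\ forall tau, v0 <= Im tau -> summable_by (fun j => Cmod (star_term w b tau j)) B.
Proof.
  intros Hw Hq Hv. assert (Pi := PI_RGT_0).
  destruct (is_Csum_abs _ _ (Hq (0, v0) Hv)) as [B HB].
  set (K := INR w / (4 * PI * v0 * sqrt (4 * PI * v0))).
  assert (K0 : 0 <= K).
  { apply Rdiv_le_0_compat; [apply pos_INR|].
    assert (0 < 4 * PI * v0) by pos.
    apply Rmult_lt_0_compat; [auto|now apply sqrt_lt_R0]. }
  assert (B0 : 0 <= B) by (apply (HB nil); constructor).
  exists (K * B). split; [now apply Rmult_le_pos|].
  intros tau Ht l Hl. eapply Rle_trans.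
  - apply rsum_le. intros j _. apply (Cmod_star_term w b tau j v0); auto.
  - fold K. rewrite rsum_scal. apply Rmult_le_compat_l; auto.
    rewrite <- (rsum_map S (fun k => Cmod (b k * qpow (INR k / INR w) (0%R, v0))%C)).
    apply HB. apply Injective_map_NoDup; auto. intros i j E; now inversion E.
Qed.

Lemma is_Csum_star g w b tau : (1 <= w)%nat -> q_expansion g w b -> in_H tau ->
  is_Csum (star_term w b tau) (star w b tau - RtoC 2 * Cconj (b O) * RtoC (/ sqrt (4 * PI * Im tau)))%C.
Proof.
  intros Hw Hq Ht. destruct (summable_star_terms g w b (Im tau) Hw Hq Ht) as [B [_ HB]].
  destruct (is_Csum_exists _ B (HB tau ltac:(lra))) as [s Hs].
  replace (star w b tau - _)%C with (Csum (star_term w b tau)).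
  - now apply Csum_correct with s.
  - unfold star. fold (star_term w b tau). unfold star_term at 2.
    match goal with |- ?X = _ => set (A := X) end. unfold star_term in A; fold A. ring.
Qed.

Lemma star_bound g w b : (1 <= w)%nat -> q_expansion g w b ->
  exists B, forall tau, 1 / 2 <= Im tau -> Cmod (star w b tau) <= B.
Proof.
  intros Hw Hq. destruct (summable_star_terms g w b (1 / 2) Hw Hq ltac:(lra)) as [B [B0 HB]].
  exists (2 * Cmod (b O) + B). intros tau Hv.
  assert (Ht : in_H tau) by (unfold in_H; lra).
  assert (H := Cmod_is_Csum_le _ _ B (is_Csum_star g w b tau Hw Hq Ht) (HB tau Hv)).
  replace (star w b tau) with (RtoC 2 * Cconj (b O) * RtoC (/ sqrt (4 * PI * Im tau)) +
    (star w b tau - RtoC 2 * Cconj (b O) * RtoC (/ sqrt (4 * PI * Im tau))))%C by ring.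
  eapply Rle_trans; [apply Cmod_triangle|]. apply Rplus_le_compat; auto.
  rewrite !Cmod_mult, Cmod_conj, !Cmod_R, (Rabs_right 2) by lra.
  rewrite <- (Rmult_1_r (2 * Cmod (b O))) at 2.
  apply Rmult_le_compat_l; [generalize (Cmod_ge_0 (b O)); lra|].
  assert (1 <= sqrt (4 * PI * Im tau)).
  { rewrite <- sqrt_1 at 1. assert (P := PI2_1). apply sqrt_le_1; nra. }
  rewrite Rabs_right.
  - rewrite <- Rinv_1; apply Rinv_le_contravar; lra.
  - apply Rle_ge; left; apply Rinv_0_lt_compat; lra.
Qed.

Lemma summable_theta al be : 0 < al ->
  exists B, summable_by (fun rho : Z => exp (- (al * (rho * rho)) + be * rho)) B.
Proof.
  intros Ha. set (K := exp (be ^ 2 / (2 * al)) * (1 + 2 / al)).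
  assert (A2 : 0 < 2 / al) by pos.
  assert (K0 : 0 <= K) by pos.
  exists (K * 8). intros l Hl.
  apply Rle_trans with (rsum (fun rho : Z => K * / (1 + rho * rho)) l).
  - apply rsum_le; intros rho _.
    apply Rle_trans with (exp (be ^ 2 / (2 * al) + - (al * (rho * rho) / 2))).
    + apply exp_le.
      assert (0 <= (al * rho - be) ^ 2 / (2 * al)) by pos.
      replace (be ^ 2 / (2 * al) + - (al * (rho * rho) / 2)) with
        (- (al * (rho * rho)) + be * rho + (al * rho - be) ^ 2 / (2 * al)) by (field; lra).
      lra.
    + rewrite exp_plus; unfold K; rewrite Rmult_assoc.
      apply Rmult_le_compat_l; [left; apply exp_pos|].
      eapply Rle_trans; [apply exp_neg_le_inv; apply Rdiv_le_0_compat; nra|].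
      replace (/ (1 + al * (rho * rho) / 2)) with (1 / (1 + al * (rho * rho) / 2)) by (field; nra).
      change ((1 + 2 / al) * / (1 + rho * rho)) with ((1 + 2 / al) / (1 + rho * rho)).
      apply Rdiv_le_cross; [nra|nra|].
      replace ((1 + 2 / al) * (1 + al * (rho * rho) / 2))
        with (1 + rho * rho + (2 / al + al * (rho * rho) / 2)) by (field; lra). nra.
  - rewrite rsum_scal. apply Rmult_le_compat_l; auto. now apply summable_inv_sqr.
Qed.

Lemma is_Csum_vartheta m l tau z : (1 <= m)%Z -> in_H tau ->
  is_Csum (fun k : Z => qpow (((l + 2 * m * k) * (l + 2 * m * k))%Z / (4 * m)%Z) tau *
     e2pi ((l + 2 * m * k)%Z * z))%C (vartheta m l tau z).
Proof.
  intros Hm Ht. assert (Hm' := IZR_le _ _ Hm). assert (Pi := PI_RGT_0). unfold in_H in Ht.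
  destruct (summable_theta (2 * PI * Im tau / (4 * m)) (- (2 * PI * Im z))) as [B HB].
  { apply Rdiv_lt_0_compat; [|lra]. apply Rmult_lt_0_compat; lra. }
  destruct (is_Csum_exists (fun k : Z =>
     qpow (((l + 2 * m * k) * (l + 2 * m * k))%Z / (4 * m)%Z) tau *
     e2pi ((l + 2 * m * k)%Z * z))%C B) as [s Hs].
  - intros L HL. eapply Rle_trans.
    + apply rsum_le with (g := fun k : Z => (fun rho : Z => exp (- (2 * PI * Im tau / (4 * m) *
        (rho * rho)) + - (2 * PI * Im z) * rho)) (l + 2 * m * k)%Z).
      intros k _. rewrite Cmod_mult, Cmod_qpow, Cmod_e2pi, Im_scal, <- exp_plus.
      apply exp_le. right. rewrite !mult_IZR. field. lra.
    + rewrite <- (rsum_map (fun k => (l + 2 * m * k)%Z) (fun rho : Z =>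
        exp (- (2 * PI * Im tau / (4 * m) * (rho * rho)) + - (2 * PI * Im z) * rho))).
      apply HB.
      apply Injective_map_NoDup; auto. intros i j E. nia.
  - unfold vartheta. now apply Csum_correct with s.
Qed.

Lemma lsum_indicator (f : Z -> C) a l : NoDup l -> In a l ->
  lsum (fun i => if Z.eq_dec a i then f i else RtoC 0) l = f a.
Proof.
  assert (Z0 : forall l, ~ In a l -> lsum (fun i => if Z.eq_dec a i then f i else RtoC 0) l = RtoC 0).
  { clear; induction l as [|k l IH]; intros H; [reflexivity|].
    rewrite lsum_cons, IH by (intros K; apply H; now right).
    destruct (Z.eq_dec a k) as [->|]; [exfalso; apply H; now left|ring]. }
  induction l as [|k l IH]; intros Hl Hr; [destruct Hr|]. inversion Hl; subst. rewrite lsum_cons.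
  destruct (Z.eq_dec a k) as [->|Hk].
  - rewrite Z0 by assumption; ring.
  - destruct Hr as [->|Hr]; [congruence|]. rewrite IH by auto. ring.
Qed.

Lemma theta_expansion m (g : Z -> C) tau z : (1 <= m)%Z -> in_H tau ->
  is_Csum (fun rho : Z => g (rho mod (2 * m))%Z * qpow ((rho * rho)%Z / (4 * m)%Z) tau *
     e2pi (rho * z))%C
    (lsum (fun l => g l * vartheta m l tau z) (residues (2 * m)))%C.
Proof.
  intros Hm Ht.
  apply (is_Csum_ext (fun rho : Z => lsum (fun l => if Z.eq_dec (rho mod (2 * m)) l then
    g l * qpow ((rho * rho)%Z / (4 * m)%Z) tau * e2pi (rho * z) else RtoC 0)
    (residues (2 * m)))%C).
  { intros rho. rewrite lsum_indicator; auto.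
    - rewrite residues_zrange; apply NoDup_zrange.
    - destruct (residue_decomp m rho Hm) as [l [k [_ [<- Hl]]]]. exact Hl. }
  apply (is_Csum_lsum (fun l (rho : Z) => if Z.eq_dec (rho mod (2 * m)) l then
    g l * qpow ((rho * rho)%Z / (4 * m)%Z) tau * e2pi (rho * z) else RtoC 0)%C).
  intros l Hl. rewrite residues_zrange, in_zrange in Hl.
  apply (is_Csum_inj (fun k => (l + 2 * m * k)%Z)).
  - intros i j E. nia.
  - intros rho Hn. destruct (Z.eq_dec (rho mod (2 * m)) l) as [E|E]; auto.
    exfalso. apply (Hn (rho / (2 * m))%Z).
    generalize (Z.div_mod rho (2 * m) ltac:(lia)); lia.
  - eapply is_Csum_ext; [|apply is_Csum_scal, (is_Csum_vartheta m l tau z Hm Ht)].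
    intros k; cbv beta.
    replace ((l + 2 * m * k) mod (2 * m))%Z with l.
    + destruct (Z.eq_dec l l); [ring|congruence].
    + rewrite Z.mul_comm, Z.mod_add by lia. symmetry; apply Z.mod_small. lia.
Qed.

Lemma is_CInt_shift F a b c I : is_CInt F a b I ->
  is_CInt (fun x => F (x - c)%R) (a + c) (b + c) I.
Proof.
  intros H.
  assert (H1 := is_RInt_comp_lin (V := C_R_NormedModule) F 1 (- c) (a + c) (b + c) I).
  replace (1 * (a + c) + - c) with a in H1 by ring.
  replace (1 * (b + c) + - c) with b in H1 by ring. specialize (H1 H).
  revert H1; apply (is_RInt_ext (V := C_R_NormedModule)). intros x _.
  transitivity (F (1 * x + - c)); [apply (scal_one (V := C_R_NormedModule))|f_equal; ring].
Qed.

Lemma is_CInt_periodic F I : (forall x, F (x + 1) = F x) -> is_CInt F (-1 / 2) (1 / 2) I ->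
  forall N, is_CInt F (-1 / 2) (-1 / 2 + INR N) (INR N * I)%C.
Proof.
  intros Hp HI.
  assert (Hp' : forall N x, F (x - INR N)%R = F x).
  { induction N as [|N IH]; intros x; [simpl; f_equal; ring|].
    rewrite S_INR, <- (Hp (x - (INR N + 1))), <- (IH x). f_equal. ring. }
  induction N as [|N IH].
  - simpl INR. rewrite Rplus_0_r, Cmult_0_l. apply (is_RInt_point (V := C_R_NormedModule)).
  - rewrite S_INR, RtoC_plus.
    replace ((INR N + RtoC 1) * I)%C with (INR N * I + I)%C by ring.
    apply (is_RInt_Chasles (V := C_R_NormedModule) F _ (-1 / 2 + INR N)); [exact IH|].
    assert (H1 := is_CInt_shift F (-1 / 2) (1 / 2) (INR N) I HI).
    replace (1 / 2 + INR N) with (-1 / 2 + (INR N + 1)) in H1 by field.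
    revert H1; apply (is_RInt_ext (V := C_R_NormedModule)). intros x _. apply Hp'.
Qed.

(** The single terms have period [W] only, and over that length each has mean 0. As [F] itself has
    period 1, its integral over length [W] is [W] times the one wanted. *)
Lemma is_CInt_no_zero_frequency {I} (a : I -> C) (k : I -> Z) F (W : Z) : (1 <= W)%Z ->
  (forall i, k i <> 0%Z) ->
  (forall x : R, is_Csum (fun i => a i * e2pi (RtoC (k i * x / W)))%C (F x)) ->
  (forall x, F (x + 1) = F x) -> is_CInt F (-1 / 2) (1 / 2) (RtoC 0).
Proof.
  intros HW Hk HF Hp. assert (HW' := IZR_le _ _ HW).
  destruct (fourier_extraction a k (fun t => F (W * t)) (- / (2 * W)) 0) as [S [S1 S2]].
  { intros t _. eapply is_Csum_ext; [|apply HF]. intros i; cbv beta. do 3 f_equal. field; lra. }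
  assert (ES : S = RtoC 0).
  { refine (is_Csum_unique _ _ _ S2 _). eapply is_Csum_ext; [|apply is_Csum_zero].
    intros i; cbv beta. destruct (Z.eq_dec (k i) 0); auto. exfalso; now apply (Hk i). }
  assert (H1 := is_RInt_comp_lin (V := C_R_NormedModule)
    (fun t => F (W * t)%R * e2pi (RtoC (- (0%Z * t))))%C (/ W) 0 (-1 / 2) (-1 / 2 + W) S).
  replace (/ W * (-1 / 2) + 0) with (- / (2 * W)) in H1 by (field; lra).
  replace (/ W * (-1 / 2 + W) + 0) with (- / (2 * W) + 1) in H1 by (field; lra).
  specialize (H1 S1).
  apply (is_RInt_scal (V := C_R_NormedModule) _ _ _ W) in H1.
  assert (H2 : is_CInt F (-1 / 2) (-1 / 2 + W) (scal (W : R) (S : C_R_NormedModule))).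
  { revert H1; apply (is_RInt_ext (V := C_R_NormedModule)). intros x _.
    rewrite (scal_assoc (V := C_R_NormedModule)). replace (mult (W : R_AbsRing) (/ W)) with (one : R_AbsRing).
    - rewrite (scal_one (V := C_R_NormedModule)).
      rewrite Rmult_0_l, Ropp_0, e2pi_0, Cmult_1_r. f_equal. field; lra.
    - unfold mult, one; simpl. eqR. field; lra. }
  replace (scal (W : R) (S : C_R_NormedModule)) with (RtoC 0) in H2.
  2: { rewrite ES. symmetry. apply (scal_zero_r (V := C_R_ModuleSpace)). }
  assert (Ex : exists J : C, is_CInt F (-1 / 2) (1 / 2) J).
  { apply (ex_RInt_Chasles_1 (V := C_R_CompleteNormedModule) F (-1 / 2) (1 / 2) (-1 / 2 + W)); [lra|].
    exists (RtoC 0); exact H2. }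
  destruct Ex as [J HJ].
  assert (H3 := is_CInt_periodic F J Hp HJ (Z.to_nat W)).
  rewrite INR_IZR_INZ, Z2Nat.id in H3 by lia.
  assert (E := is_CInt_unique _ _ _ _ _ H3 H2).
  replace (RtoC 0) with J; auto.
  change (@eq C J (RtoC 0)). change (@eq C (RtoC W * J)%C (RtoC 0)) in E.
  transitivity (/ W * (W * J))%C; [field; apply RtoC_neq_0; lra|rewrite E; ring].
Qed.

Lemma is_Csum_nat_cons (f : nat -> C) s : is_Csum (fun j => f (S j)) s -> is_Csum f (f O + s)%C.
Proof.
  intros H.
  apply (is_Csum_ext (fun j => (if Nat.eq_dec j 0 then f O else RtoC 0) +
    (if Nat.eq_dec j 0 then RtoC 0 else f j))%C).
  { intros [|j]; simpl; ring. }
  apply is_Csum_plus.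
  - apply (is_Csum_inj (fun _ : unit => O)).
    + intros [] []; auto.
    + intros i Hi. destruct (Nat.eq_dec i 0) as [->|]; auto. exfalso; now apply (Hi tt).
    + intros eps He; exists (tt :: nil). intros l Hl Hi.
      replace l with (tt :: nil).
      * unfold lsum; simpl. replace (f O + 0 - f O)%C with (RtoC 0) by ring. now rewrite Cmod_0.
      * destruct l as [|[] l]; [destruct (Hi tt (or_introl eq_refl))|].
        inversion Hl as [|? ? N1 N2]; subst. destruct l as [|[] l]; auto. exfalso; apply N1; now left.
  - apply (is_Csum_inj S).
    + intros i j E; now inversion E.
    + intros i Hi. destruct (Nat.eq_dec i 0) as [->|]; auto.
      exfalso. apply (Hi (Nat.pred i)). lia.
    + exact H.
Qed.

(* The non-holomorphic part only involves exponents q^(-n), n >= 0, hence it does not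
   contribute to the Fourier coefficients with Delta > 0. *)
Lemma star_mean_zero g (w : nat) b (m D : Z) v F : (1 <= w)%nat -> q_expansion g w b ->
  (1 <= m)%Z -> (0 < D)%Z -> 0 < v ->
  (forall x : R, F x = star w b (x, v) * qpow (- (D / (4 * m))) (x, v))%C ->
  (forall x, F (x + 1) = F x) -> is_CInt F (-1 / 2) (1 / 2) (RtoC 0).
Proof.
  intros Hw Hq Hm HD Hv HF Hp. assert (Hm' := IZR_le _ _ Hm).
  assert (Hw' : 1 <= INR w) by (apply (le_INR 1); exact Hw).
  set (A := fun j : nat => match j with
    | O => (RtoC 2 * Cconj (b O) * RtoC (/ sqrt (4 * PI * v)))%C
    | S i => star_term w b (0, v) i end).
  (* The exponents are - j/w - D/(4m) = - (4mj + wD)/(4mw): common denominator 4mw, and a numerator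
     that never vanishes because D > 0. *)
  apply (is_CInt_no_zero_frequency (fun j => A j * qpow (- (D / (4 * m))) (0, v))%C
    (fun j => (- (4 * m * Z.of_nat j + Z.of_nat w * D))%Z) F (4 * m * Z.of_nat w)%Z);
    [nia|intros j; nia| |exact Hp].
  intros x. rewrite HF.
  assert (Ht : in_H (x, v)) by pos.
  assert (H1 := is_Csum_star g w b (x, v) Hw Hq Ht). simpl (Im (x, v)) in H1.
  set (f := fun j : nat => match j with
    | O => (RtoC 2 * Cconj (b O) * RtoC (/ sqrt (4 * PI * v)))%C
    | S i => star_term w b (x, v) i end).
  apply (is_Csum_nat_cons f) in H1. unfold f at 2 in H1.
  replace (_ + _)%C with (star w b (x, v)) in H1 by ring.
  rewrite Cmult_comm.
  eapply is_Csum_ext; [|apply is_Csum_scal, H1].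
  assert (Ex : forall u, qpow u (x, v) = (qpow u (0%R, v) * e2pi (RtoC (u * x)))%C).
  { intros u; unfold qpow; rewrite <- e2pi_plus; f_equal. apply Ceq; simpl; ring. }
  intros j. cbv beta.
  assert (Ef : f j = (A j * e2pi (RtoC (- (INR j / INR w) * x)))%C).
  { destruct j as [|j]; unfold f, A.
    - simpl (INR 0). replace (- (0 / INR w) * x) with 0 by (field; lra). rewrite e2pi_0; ring.
    - unfold star_term. simpl (Im _). rewrite (Ex (- (INR (S j) / INR w))). ring. }
  rewrite Ef, Ex.
  transitivity (A j * qpow (- (D / (4 * m))) (0%R, v) * (e2pi (RtoC (- (D / (4 * m)) * x)) *
    e2pi (RtoC (- (INR j / INR w) * x))))%C; [ring|].
  rewrite <- e2pi_plus, <- RtoC_plus. do 3 f_equal.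
  rewrite opp_IZR, plus_IZR, !mult_IZR, <- !INR_IZR_INZ. field. lra.
Qed.

(** * Conclusion *)

(** Minus the identity fixes tau, and the weight is even. *)
Lemma J1_even m phi tau z : J1 m phi -> in_H tau -> phi tau (- z)%C = phi tau z.
Proof.
  intros HJ Ht. assert (H := HJ (Mat2 (-1) 0 0 (-1)) tau z eq_refl Ht).
  assert (E1 : cocycle (Mat2 (-1) 0 0 (-1)) tau = RtoC (-1)) by (unfold cocycle; simpl; ring).
  assert (E2 : moebius (Mat2 (-1) 0 0 (-1)) tau = tau).
  { unfold moebius; simpl. replace (RtoC 0 * tau + RtoC (-1))%C with (RtoC (-1)) by ring. field; auto. }
  rewrite E1, E2 in H.
  replace (z / RtoC (-1))%C with (- z)%C in H.
  - rewrite H. simpl (m21 _).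
    replace (m * RtoC 0 * (z * z) / RtoC (-1))%C with (RtoC 0) by (field; auto).
    rewrite e2pi_0. replace (RtoC (-1)) with (- RtoC 1)%C by (rewrite <- RtoC_opp; f_equal; ring).
    simpl; ring.
  - replace (RtoC (-1)) with (- RtoC 1)%C by (rewrite <- RtoC_opp; f_equal; ring).
    field.
Qed.

Lemma J1_translate m phi tau z : J1 m phi -> in_H tau -> phi (tau + 1)%C z = phi tau z.
Proof.
  intros HJ Ht. assert (H := HJ (Mat2 1 1 0 1) tau z eq_refl Ht).
  assert (E1 : cocycle (Mat2 1 1 0 1) tau = RtoC 1) by (unfold cocycle; simpl; ring).
  assert (E2 : moebius (Mat2 1 1 0 1) tau = (tau + 1)%C) by (unfold moebius; simpl; field; intros E; apply C1_nz; rewrite <- E; ring).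
  rewrite E1, E2 in H. replace (z / RtoC 1)%C with z in H by (field; apply C1_nz).
  rewrite H. simpl (m21 _).
  replace (m * RtoC 0 * (z * z) / RtoC 1)%C with (RtoC 0) by (field; apply C1_nz).
  rewrite e2pi_0. simpl; ring.
Qed.

Lemma z_expansion_even m H phi tau rho : J1 m phi -> z_expansion H phi -> in_H tau ->
  H tau (- rho)%Z = H tau rho.
Proof.
  intros HJ HE Ht.
  apply (z_expansion_unique (fun tau rho => H tau (- rho)%Z) H phi); auto.
  intros t z Hz. rewrite <- (J1_even m phi t z HJ Hz).
  apply (is_Csum_inj Z.opp).
  - intros i j E; lia.
  - intros i Hi. exfalso. apply (Hi (- i)%Z). lia.
  - eapply is_Csum_ext; [|apply (HE t (- z)%C Hz)].
    intros j; cbv beta. rewrite Z.opp_involutive, opp_IZR, RtoC_opp. do 2 f_equal. ring.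
Qed.

Lemma z_expansion_translate m H phi tau rho : J1 m phi -> z_expansion H phi -> in_H tau ->
  H (tau + 1)%C rho = H tau rho.
Proof.
  intros HJ HE Ht.
  apply (z_expansion_unique (fun tau rho => H (tau + 1)%C rho) H phi); auto.
  intros t z Hz. rewrite <- (J1_translate m phi t z HJ Hz). apply HE.
  unfold in_H in *. rewrite Im_plus; simpl; lra.
Qed.

Lemma lsum_filter {I} (f : I -> C) (p : I -> bool) l :
  lsum f (filter p l) = lsum (fun i => if p i then f i else RtoC 0) l.
Proof.
  induction l as [|i l IH]; [reflexivity|]. simpl. rewrite (lsum_cons _ i l).
  destruct (p i); [rewrite lsum_cons|]; rewrite IH; ring.
Qed.

Lemma e2pi_cos x : (e2pi (RtoC (- x)) + e2pi (RtoC x) = RtoC (2 * cos (2 * PI * x)))%C.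
Proof.
  unfold e2pi, Cexp. rewrite !Re_2piI, !Im_2piI. simpl.
  replace (2 * PI * - x) with (- (2 * PI * x)) by ring.
  rewrite cos_neg, sin_neg, Rmult_0_r, Ropp_0, exp_0. apply Ceq; simpl; ring.
Qed.

(** The classes dropped by the filter in [kappa] are those where [polar] is 0, and averaging over r
    and -r turns exponentials into cosines. *)
Lemma kappa_main_sum m c r : (1 <= m)%Z ->
  (kappa m c r = - (RtoC (/ 2) * (main_sum m (polar m c) r + main_sum m (polar m c) (- r))))%C.
Proof.
  intros Hm. assert (Hm' := IZR_le _ _ Hm).
  unfold kappa, main_sum. rewrite lsum_filter, <- lsum_plus, <- lsum_scal. f_equal.
  apply lsum_ext. intros l _. unfold polar. rewrite opp_IZR.
  replace (- (- r * l / (2 * m))) with (r * l / (2 * m)) by (field; lra).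
  destruct (_ =? 0)%Z.
  - rewrite <- Cmult_plus_distr_l, e2pi_cos.
    replace (2 * PI * (r * l / (2 * m))) with (PI * l * r / m) by (field; lra).
    rewrite RtoC_mult. rewrite RtoC_inv by lra. field.
  - ring.
Qed.

Definition growth_asymptotics (m : Z) (c : Z -> Z -> C) (r : Z) : Prop :=
  exists (K : R) (D0 : Z), forall Delta : Z,
    disc_ok m Delta r -> (D0 <= Delta)%Z ->
    (Cmod (Ccoef m c Delta r
           - kappa m c r * RtoC (exp (PI * sqrt Delta / m)))%C
     <= K * exp (PI * sqrt Delta / (2 * m)))%R.

(** Common end of both cases: [H] belongs to the function that obeys (J1), the form or its
    completion, while [c] and [polar] belong to the form itself. *)
Lemma asymptotics_of_expansion (m : Z) H phi B (c : Z -> Z -> C) (r : Z) :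
  (1 <= m)%Z -> J1 m phi -> z_expansion H phi -> 0 <= B ->
  (forall rho, Cmod (polar m c rho) <= B) ->
  (forall rho k, polar m c (rho + 2 * m * k)%Z = polar m c rho) ->
  cusp_bound m H (polar m c) B ->
  (forall n s v, (0 < 4 * m * n - s * s)%Z -> 0 < v ->
    is_CInt (fun x => H (x, v) s * e2pi (- (n * (x, v))))%C (-1 / 2) (1 / 2) (c n s)) ->
  growth_asymptotics m c r.
Proof.
  intros Hm HJ HE HB HP Hper HC Hc.
  destruct (circle_asymptotics m H phi (polar m c) B c r Hm HJ HE HB HP Hper HC) as [K1 HK1].
  { intros n v; apply Hc. }
  destruct (circle_asymptotics m H phi (polar m c) B c (- r) Hm HJ HE HB HP Hper HC) as [K2 HK2].
  { intros n v; apply Hc. }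
  exists (/ 2 * (K1 + K2)), 100%Z. intros Delta [n Hn] HD.
  assert (EC : Ccoef m c Delta r = c n r).
  { unfold Ccoef. f_equal. rewrite Hn. apply Z.div_mul; lia. }
  assert (ED : (4 * m * n - r * r)%Z = Delta) by lia.
  assert (ED' : (4 * m * n - - r * - r)%Z = Delta) by lia.
  specialize (HK1 n ltac:(lia)). specialize (HK2 n ltac:(lia)).
  rewrite ED in HK1. rewrite ED' in HK2.
  (* In the mock case it is the completion that is known to be even, so evenness reaches [c] through
     the mean values of [H], available since Delta > 0. *)
  assert (Ecc : c n (- r)%Z = c n r).
  { refine (is_CInt_unique _ _ _ _ _ (Hc n (- r)%Z 1 ltac:(lia) Rlt_0_1) _).
    generalize (Hc n r 1 ltac:(lia) Rlt_0_1). apply is_CInt_ext; [lra|].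
    intros x _. rewrite (z_expansion_even m H phi) by (auto; unfold in_H; simpl; lra). reflexivity. }
  rewrite Ecc in HK2. rewrite EC, kappa_main_sum by auto.
  set (X := RtoC (exp (PI * sqrt Delta / m))) in *.
  replace (c n r - - (RtoC (/ 2) * (main_sum m (polar m c) r + main_sum m (polar m c) (- r))) * X)%C
    with (RtoC (/ 2) * ((c n r + main_sum m (polar m c) r * X) +
      (c n r + main_sum m (polar m c) (- r) * X)))%C.
  - rewrite Cmod_mult, Cmod_R, Rabs_right by lra.
    rewrite Rmult_assoc. apply Rmult_le_compat_l; [lra|].
    eapply Rle_trans; [apply Cmod_triangle|]. lra.
  - rewrite RtoC_inv by lra. field.
Qed.

Lemma cusp_bound_le m H P B B' : B <= B' -> cusp_bound m H P B -> cusp_bound m H P B'.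
Proof.
  intros HB HC tau rho Hv. eapply Rle_trans; [now apply HC|].
  apply Rmult_le_compat_r; [left; apply exp_pos|auto].
Qed.

Lemma weak_asymptotics (m : Z) phi c (r : Z) : (1 <= m)%Z -> weak_jacobi_form2 m phi ->
  fourier_expansion phi c -> optimal_growth m c ->
  growth_asymptotics m c r.
Proof.
  intros Hm [[_ [Hel _]] HJ] He Ho.
  destruct (polar_bound m phi c Hm He Hel) as [B1 [B10 HB1]].
  destruct (cusp_bound_zcoef m phi c Hm He Hel Ho) as [B2 [B20 HB2]].
  apply (asymptotics_of_expansion m (zcoef c) phi (B1 + B2)); auto.
  - now apply z_expansion_zcoef.
  - lra.
  - intros rho; generalize (HB1 rho); lra.
  - intros; now apply (polar_period m phi).
  - apply cusp_bound_le with (2 := HB2); lra.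
  - intros n s v _ Hv. assert (H := tau_extraction phi c s n v (-1 / 2) He Hv).
    replace (-1 / 2 + 1) with (1 / 2) in H by field. exact H.
Qed.

Lemma mock_asymptotics (m : Z) phi c (r : Z) : (1 <= m)%Z -> mock_jacobi_form2 m phi ->
  fourier_expansion phi c -> optimal_growth m c ->
  growth_asymptotics m c r.
Proof.
  intros Hm [[_ [Hel _]] (h & g & G & w & b & Hphi & _ & Hg & HJ)] He Ho.
  assert (Hm' := IZR_le _ _ Hm).
  set (st := fun (rho : Z) tau => star (w (rho mod (2 * m))%Z) (b (rho mod (2 * m))%Z) tau).
  set (th := fun (rho : Z) tau => qpow ((rho * rho)%Z / (4 * m)%Z) tau).
  set (H := fun tau rho => ((h (rho mod (2 * m))%Z tau + st rho tau) * th rho tau)%C).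
  match type of HJ with J1 _ ?f => set (phih := f) in * end.
  assert (HE : z_expansion H phih).
  { intros tau z Ht. unfold phih, H, st, th.
    exact (theta_expansion m (fun l => h l tau + star (w l) (b l) tau)%C tau z Hm Ht). }
  assert (HE0 : z_expansion (fun tau rho => h (rho mod (2 * m))%Z tau * th rho tau)%C phi).
  { intros tau z Ht. rewrite Hphi by auto. unfold th.
    exact (theta_expansion m (fun l => h l tau) tau z Hm Ht). }
  (* Comparing the theta decomposition of phi with its Fourier expansion identifies h q^(rho^2/4m)
     with [zcoef]; the completion adds the star term. *)
  assert (HH : forall tau rho, in_H tau -> H tau rho = (zcoef c tau rho + st rho tau * th rho tau)%C).
  { intros tau rho Ht.
    rewrite (z_expansion_unique (zcoef c) _ phi tau rho (z_expansion_zcoef phi c He) HE0 Ht).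
    unfold H; ring. }
  assert (Hres : forall rho : Z, In (rho mod (2 * m))%Z (residues (2 * m))).
  { intros rho. destruct (residue_decomp m rho Hm) as [l [k [_ [<- Hl]]]]; exact Hl. }
  destruct (list_bound (fun l B => forall tau, 1 / 2 <= Im tau -> Cmod (star (w l) (b l) tau) <= B)
    (residues (2 * m))) as [B3 [B30 HB3]].
  { intros l K K' HK HQ tau Hv. eapply Rle_trans; [now apply HQ|exact HK]. }
  { intros l Hl. destruct (Hg l Hl) as [_ [Hw Hq]]. now apply (star_bound (g l)). }
  destruct (polar_bound m phi c Hm He Hel) as [B1 [B10 HB1]].
  destruct (cusp_bound_zcoef m phi c Hm He Hel Ho) as [B2 [B20 HB2]].
  apply (asymptotics_of_expansion m H phih (B1 + B2 + B3)); auto.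
  - lra.
  - intros rho; generalize (HB1 rho); lra.
  - intros; now apply (polar_period m phi).
  - intros tau rho Hv. rewrite HH by (unfold in_H; lra).
    replace (_ - _)%C with ((zcoef c tau rho - polar m c rho * qpow ((rho * rho - 1) / (4 * m)) tau) +
      st rho tau * th rho tau)%C by ring.
    eapply Rle_trans; [apply Cmod_triangle|].
    assert (T1 := HB2 tau rho Hv).
    assert (T2 : Cmod (st rho tau * th rho tau) <= B3 * exp (- (2 * PI * Im tau * (rho * rho / (4 * m))))).
    { rewrite Cmod_mult. apply Rmult_le_compat; auto using Cmod_ge_0.
      - apply HB3; auto.
      - right. unfold th. rewrite Cmod_qpow. f_equal. rewrite !mult_IZR. ring. }
    assert (E0 := exp_pos (- (2 * PI * Im tau * (rho * rho / (4 * m))))). nra.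
  - intros n s v Hn Hv.
    set (F := fun x : R => (st s (x, v) * (th s (x, v) * e2pi (- (n * (x, v)))))%C).
    destruct (Hg _ (Hres s)) as [_ [Hw Hq]].
    assert (HFq : forall x : R, F x = (st s (x, v) *
      qpow (- (IZR (4 * m * n - s * s) / (4 * m))) (x, v))%C).
    { intros x. unfold F, th, qpow. f_equal. rewrite <- e2pi_plus. f_equal.
      rewrite minus_IZR, !mult_IZR.
      replace (- ((4 * m * n - s * s) / (4 * m))) with (s * s / (4 * m) + - n) by (field; lra).
      rewrite RtoC_plus, RtoC_opp. ring. }
    assert (Hshift : forall x : R, ((x + 1)%R, v) = ((x, v) + 1)%C)
      by (intros; apply Ceq; simpl; ring).
    (* Neither factor of [F] need be 1-periodic, as exponents are fractional. [F] is: up to an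
       integral power of q it is the difference between a coefficient of the completion, invariant
       by (J1), and a series in integral powers of q. *)
    assert (HFp : forall x, F (x + 1) = F x).
    { intros x. assert (Ht : in_H (x, v)) by pos.
      assert (Ht1 : in_H ((x, v) + 1)%C) by (rewrite <- Hshift; exact Hv).
      assert (EF : forall x, F x = ((H (x, v) s - zcoef c (x, v) s) * e2pi (- (n * (x, v))))%C).
      { intros u. rewrite HH by exact Hv. unfold F; ring. }
      rewrite !EF, Hshift.
      rewrite (z_expansion_translate m H phih) by auto.
      assert (E0 : zcoef c ((x, v) + 1)%C s = zcoef c (x, v) s).
      { apply (is_Csum_unique _ _ _ (is_Csum_zcoef phi c _ s He Ht1)).
        eapply is_Csum_ext; [|apply (is_Csum_zcoef phi c _ s He Ht)].
        intros k; cbv beta. f_equal. unfold qpow.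
        replace (k * ((x, v) + 1))%C with (k * (x, v) + k)%C by ring. symmetry; apply e2pi_add_Z. }
      rewrite E0. f_equal.
      replace (- (n * ((x, v) + 1)))%C with (- (n * (x, v)) + RtoC (IZR (- n)))%C
        by (rewrite opp_IZR, RtoC_opp; ring).
      apply e2pi_add_Z. }
    assert (HF0 := star_mean_zero _ _ _ m (4 * m * n - s * s) v F Hw Hq Hm Hn Hv HFq HFp).
    assert (Hx := tau_extraction phi c s n v (-1 / 2) He Hv).
    replace (-1 / 2 + 1) with (1 / 2) in Hx by field.
    replace (c n s) with (c n s + 0)%C by ring.
    assert (Hs := is_CInt_plus _ _ _ _ _ _ Hx HF0).
    revert Hs. apply is_CInt_ext; [lra|]. intros x _.
    rewrite HH by exact Hv. unfold F.
    eqC; ring.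
Qed.

Theorem theorem9p3 (m : Z) (phi : C -> C -> C) (c : Z -> Z -> C)
  (hm : (1 <= m)%Z)
  (hphi : weak_jacobi_form2 m phi \/ mock_jacobi_form2 m phi)
  (hc : fourier_expansion phi c)
  (hopt : optimal_growth m c)
  (r : Z) :
  exists (K : R) (D0 : Z), forall Delta : Z,
    disc_ok m Delta r -> (D0 <= Delta)%Z ->
    (Cmod (Ccoef m c Delta r
           - kappa m c r * RtoC (exp (PI * sqrt Delta / m)))%C
     <= K * exp (PI * sqrt Delta / (2 * m)))%R.
Proof.
  destruct hphi as [H|H].
  - now apply (weak_asymptotics m phi).
  - now apply (mock_asymptotics m phi).
Qed.
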